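(* Let $(h,(E=E^{+}\oplus E^{-},\tau,I),\Phi=\Phi^{+}\oplus\Phi^{-},\nabla^{+},\nabla^{-})$ be a quasi-Codazzi structure on an $n$-dimensional manifold $M$. If $\nabla^{+}$ and $\nabla^{-}$ are flat, then this structure naturally yields a quasi-Hessian structure on $M$.
   Context: Everything is $C^\infty$. Para-Hermitian vector bundle: a triple $(E,\tau,I)$ where $E\to M$ is a vector bundle of rank $2n$ over an $n$-dimensional manifold $M$, $\tau$ is a pseudo-Riemannian metric on the bundle $E$ (smooth fiberwise non-degenerate symmetric bilinear form), and $I:E\to E$ is a bundle map with (i) $I^2=\mathrm{id}$, $I\ne\mathrm{id}$; (ii) the eigenbundles $E^{+}$, $E^{-}$ of $I$ for the eigenvalues $1$, $-1$ have the same rank and $E=E^{+}\oplus E^{-}$; (iii) $\tau(IX,Y)+\tau(X,IY)=0$. Put $\omega(X,Y):=\tau(X,IY)$. Quasi-Codazzi structure on $M$: data $(h,(E,\tau,I),\Phi,\nabla^{+},\nabla^{-})$ where $(E,\tau,I)$ is a para-Hermitian vector bundle of rank $2n$ on $M$; $\Phi:TM\to E$ is a bundle map such that for every $p\in M$, $\mathrm{rank}\,\Phi_p=n$ and $\Phi_p(T_pM)$ is Lagrangian (i.e., $\omega$ vanishes on it); $h(Y,Z):=\tau(\Phi(Y),\Phi(Z))$ is the induced (possibly degenerate) symmetric $(0,2)$-tensor; $\nabla^{+}$ is a connection on $E^{+}$ and $\nabla^{-}$ is the connection on $E^{-}$ dual to it, i.e. $X\tau(\nu^{+},\nu^{-})=\tau(\nabla^{+}_X\nu^{+},\nu^{-})+\tau(\nu^{+},\nabla^{-}_X\nu^{-})$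 for $X\in\Gamma(TM)$, $\nu^{\pm}\in\Gamma(E^{\pm})$; and, writing $\Phi^{\pm}:=\pi^{\pm}\circ\Phi$ with $\pi^{\pm}:E\to E^{\pm}$ the projections, both connections are relatively torsion-free: $\nabla^{\pm}_X\Phi^{\pm}(Y)-\nabla^{\pm}_Y\Phi^{\pm}(X)-\Phi^{\pm}([X,Y])=0$ for all $X,Y\in\Gamma(TM)$. The connection $\nabla^{\pm}$ is flat if its curvature $\nabla^{\pm}_X\nabla^{\pm}_Y-\nabla^{\pm}_Y\nabla^{\pm}_X-\nabla^{\pm}_{[X,Y]}$ vanishes identically. Quasi-Hessian manifold: consider the standard contact manifold $\mathbb{R}^{2n+1}=T^{*}\mathbb{R}^n\times\mathbb{R}$ with Darboux coordinates $(\mathbf{x},\mathbf{p},z)$, $\mathbf{x},\mathbf{p}\in\mathbb{R}^n$, $z\in\mathbb{R}$ (contact form $dz-\sum_i p_i\,dx_i$; a Legendre submanifold is an $n$-dimensional submanifold on which this form vanishes). An affine Legendre equivalence is an affine transformation of $\mathbb{R}^{2n+1}$ of the form $\mathcal{L}(\mathbf{x},\mathbf{p},z)=(A\mathbf{x}+\mathbf{b},A'\mathbf{p}+\mathbf{b}',z+\mathbf{c}^{\top}\mathbf{x}+d)$ with $\mathbf{b},\mathbf{b}',\mathbf{c}\in\mathbb{R}^n$, $d\in\mathbb{R}$, $A,A'\in GL_n(\mathbb{R})$, $A'=(A^{\top})^{-1}$ and $\mathbf{b}'=A'\mathbf{c}$. A quasi-Hessian manifold is an affine manifold made up by gluing several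 Legendre submanifolds $L_\alpha\subset\mathbb{R}^{2n+1}$ via affine Legendre equivalences; a quasi-Hessian structure on $M$ is a presentation of $M$ as such a manifold. *)

(* Defs.v *)
From HB Require Import structures.
From mathcomp Require Import all_boot all_order all_algebra.
From mathcomp Require Import boolp classical_sets functions cardinality reals.
From mathcomp Require Import topology prodnormedzmodule normedtype landau derive.

Set Implicit Arguments.
Unset Strict Implicit.
Unset Printing Implicit Defensive.
Import Order.TTheory GRing.Theory Num.Theory.
Import numFieldNormedType.Exports.
Local Open Scope classical_set_scope.
Local Open Scope ring_scope.

(* C^k on an open set [U], with [f] arbitrary outside [U]. *)
Fixpoint Ck (R : realType) (V W : normedModType R) (k : nat) (U : set V)
    (f : V -> W) : Prop :=
  match k with
  | 0 => forall x, U x -> {for x, continuous f}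
  | k'.+1 => (forall x, U x -> differentiable f x) /\
             (forall v : V, Ck k' U (fun x => 'D_v f x))
  end.

Definition Cinfty (R : realType) (V W : normedModType R) (U : set V)
    (f : V -> W) : Prop := forall k, Ck k U f.

(* A homeomorphism from the open set [dom] of [M] onto an open set of R^n;
   only the values of [coord] on [dom] and of [param] on the image matter. *)
Record chart (R : realType) (n : nat) (M : topologicalType) := Chart {
  dom : set M;
  coord : M -> 'cV[R]_n;
  param : 'cV[R]_n -> M;
  open_dom : open dom;
  open_codom : open (coord @` dom);
  coordK : forall p, dom p -> param (coord p) = p;
  coord_cont : forall p, dom p -> {for p, continuous coord};
  param_cont : forall u, (coord @` dom) u -> {for u, continuous param} }.

(* [pref p] selects a chart around [p]; it only serves to model T_pM by R^n. *)
Record manifold (R : realType) (n : nat) := Manifold {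
  carrier :> topologicalType;
  manifold_hausdorff : hausdorff_space carrier;
  manifold_second_countable : @second_countable carrier;
  atlas : Type;
  chart_of : atlas -> chart R n carrier;
  pref : carrier -> atlas;
  pref_dom : forall p, dom (chart_of (pref p)) p;
  atlas_compat : forall a b : atlas,
    Cinfty (coord (chart_of a) @` (dom (chart_of a) `&` dom (chart_of b)))
           (coord (chart_of b) \o param (chart_of a)) }.

Section Calculus.
Variables (R : realType) (n : nat) (M : manifold R n).

Definition smooth_on (W : normedModType R) (U : set M) (f : M -> W) : Prop :=
  forall a : atlas M,
    Cinfty (coord (chart_of a) @` (dom (chart_of a) `&` U))
           (f \o param (chart_of a)).

(* An element of T_pM is given by its components in the chart [pref p]. *)
Definition tangent (p : M) := 'cV[R]_n.

(* The differential df_p(v). *)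
Definition dir (W : normedModType R) (f : M -> W) (p : M) (v : tangent p) : W :=
  'D_v (f \o param (chart_of (pref p))) (coord (chart_of (pref p)) p).

(* Components of [v] in the chart [a]. *)
Definition tcoord (a : atlas M) (p : M) (v : tangent p) : 'cV[R]_n :=
  dir (coord (chart_of a)) v.

Definition vfield := forall p : M, tangent p.

Definition smooth_vfield (X : vfield) : Prop :=
  forall a : atlas M,
    smooth_on (dom (chart_of a)) (fun p => tcoord a (X p)).

(* The usual coordinate formula [X,Y]^i = X(Y^i) - Y(X^i), evaluated at [p] in
   the chart [pref p]. *)
Definition lie_bracket (X Y : vfield) : vfield := fun p =>
  dir (fun q => tcoord (pref p) (Y q)) (X p)
  - dir (fun q => tcoord (pref p) (X q)) (Y p).

(* A real vector bundle of rank [r]; [triv a p] is the inverse of the fibre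
   component of a local trivialization over [tdom a]. *)
Record vbundle (r : nat) := VBundle {
  fib : M -> vectType R;
  tidx : Type;
  tdom : tidx -> set M;
  triv : tidx -> forall p : M, 'cV[R]_r -> fib p;
  open_tdom : forall a, open (tdom a);
  tdom_cover : forall p, exists a, tdom a p;
  triv_linear : forall a p, tdom a p -> linear (@triv a p);
  triv_bij : forall a p, tdom a p -> bijective (@triv a p);
  triv_compat : forall a b, exists g : M -> 'M[R]_r,
    smooth_on (tdom a `&` tdom b) g /\
    forall p, tdom a p -> tdom b p ->
      forall v, triv a p v = triv b p (g p *m v) }.

End Calculus.
Arguments vfield {R n} M.
Arguments tangent {R n M} p.

Section Bundles.
Variables (R : realType) (n : nat) (M : manifold R n) (r : nat).
Variable (E : vbundle M r).

Definition section := forall p : M, fib E p.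

Definition smooth_section (s : section) : Prop :=
  forall a : tidx E, exists c : M -> 'cV[R]_r,
    smooth_on (tdom a) c /\ forall p, tdom a p -> s p = triv a p (c p).

Definition smooth_metric (tau : forall p, fib E p -> fib E p -> R) : Prop :=
  forall (a : tidx E) (i j : 'I_r),
    smooth_on (tdom a) (fun p =>
      tau p (triv a p (delta_mx i 0)) (triv a p (delta_mx j 0)) : R^o).

Definition smooth_endo (I : forall p, 'End(fib E p)) : Prop :=
  forall a : tidx E, exists J : M -> 'M[R]_r,
    smooth_on (tdom a) J /\
    forall p, tdom a p -> forall v, I p (triv a p v) = triv a p (J p *m v).

Definition smooth_anchor (Phi : forall p : M, 'Hom('cV[R]_n, fib E p)) : Prop :=
  forall (a : tidx E) (b : atlas M), exists P : M -> 'M[R]_(r, n),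
    smooth_on (tdom a `&` dom (chart_of b)) P /\
    forall p, tdom a p -> dom (chart_of b) p -> forall v : tangent p,
      Phi p v = triv a p (P p *m tcoord b v).

(* Smooth sections of a subbundle [F] of [E]. *)
Definition Gamma (F : forall p, {vspace fib E p}) (s : section) : Prop :=
  smooth_section s /\ forall p, s p \in F p.

(* A connection on the subbundle [F]; the values of [D] on arguments that are
   not smooth, or not sections of [F], are irrelevant. *)
Record is_connection (F : forall p, {vspace fib E p})
    (D : vfield M -> section -> section) : Prop := IsConnection {
  conn_Gamma : forall X s, smooth_vfield X -> Gamma F s -> Gamma F (D X s);
  conn_addl : forall X Y s, smooth_vfield X -> smooth_vfield Y -> Gamma F s ->
    forall p, D (fun q => X q + Y q) s p = D X s p + D Y s p;
  conn_scalel : forall (f : M -> R^o) X s,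
    smooth_on setT f -> smooth_vfield X -> Gamma F s ->
    forall p, D (fun q => f q *: X q) s p = f p *: D X s p;
  conn_addr : forall X s t, smooth_vfield X -> Gamma F s -> Gamma F t ->
    forall p, D X (fun q => s q + t q) p = D X s p + D X t p;
  conn_leibniz : forall (f : M -> R^o) X s,
    smooth_on setT f -> smooth_vfield X -> Gamma F s ->
    forall p, D X (fun q => f q *: s q) p
              = dir f (X p) *: s p + f p *: D X s p }.

Definition flat (F : forall p, {vspace fib E p})
    (D : vfield M -> section -> section) : Prop :=
  forall X Y s, smooth_vfield X -> smooth_vfield Y -> Gamma F s ->
  forall p, D X (D Y s) p - D Y (D X s) p - D (lie_bracket X Y) s p = 0.

(* The local section [e] of [F] over [U] is smooth and parallel. As [D] acts on
   global sections, it is evaluated at [p] on a global one with the same germ. *)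
Definition parallel_on (F : forall p, {vspace fib E p})
    (D : vfield M -> section -> section) (U : set M) (e : section) : Prop :=
  forall p, U p -> exists s, [/\ Gamma F s, (\forall q \near p, s q = e q) &
    forall X, smooth_vfield X -> D X s p = 0].

End Bundles.

Record para_hermitian (R : realType) (n : nat) (M : manifold R n) :=
    ParaHermitian {
  bundle :> vbundle M (2 * n)%N;
  tau : forall p, fib bundle p -> fib bundle p -> R;
  inv : forall p, 'End(fib bundle p);
  tau_smooth : smooth_metric tau;
  tau_sym : forall p u v, tau (p := p) u v = tau v u;
  tau_linear : forall p v (c : R) u u',
    tau (p := p) (c *: u + u') v = c * tau u v + tau u' v;
  tau_nondeg : forall p u, (forall v, tau (p := p) u v = 0) -> u = 0;
  inv_smooth : smooth_endo inv;
  inv_invol : forall p u, inv p (inv p u) = u;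
  inv_neq_id : exists p, exists u, inv p u <> u;
  eig_rank : forall p,
    \dim (passmx.leigenspace (inv p) 1) = \dim (passmx.leigenspace (inv p) (-1));
  eig_direct : forall p,
    directv (passmx.leigenspace (inv p) 1 + passmx.leigenspace (inv p) (-1))%VS;
  eig_sum : forall p,
    (passmx.leigenspace (inv p) 1 + passmx.leigenspace (inv p) (-1))%VS = fullv;
  inv_tau : forall p u v, tau (p := p) (inv p u) v + tau u (inv p v) = 0 }.

Section ParaHermitianTheory.
Variables (R : realType) (n : nat) (M : manifold R n) (E : para_hermitian M).

Definition omega (p : M) (u v : fib E p) : R := tau u (inv E p v).
Definition Eplus (p : M) : {vspace fib E p} := passmx.leigenspace (inv E p) 1.
Definition Eminus (p : M) : {vspace fib E p} := passmx.leigenspace (inv E p) (-1).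
Definition pi_plus (p : M) : 'End(fib E p) := daddv_pi (Eplus p) (Eminus p).
Definition pi_minus (p : M) : 'End(fib E p) := daddv_pi (Eminus p) (Eplus p).

Definition dual_connections (D D' : vfield M -> section E -> section E) :=
  forall X s t, smooth_vfield X -> Gamma Eplus s -> Gamma Eminus t ->
  forall p, dir (fun q => tau (s q) (t q) : R^o) (X p)
            = tau (D X s p) (t p) + tau (s p) (D' X t p).

Definition rel_torsion_free (Psi : forall p : M, tangent p -> fib E p)
    (D : vfield M -> section E -> section E) : Prop :=
  forall X Y, smooth_vfield X -> smooth_vfield Y ->
  forall p, D X (fun q => Psi q (Y q)) p - D Y (fun q => Psi q (X q)) p
            - Psi p (lie_bracket X Y p) = 0.

End ParaHermitianTheory.
Arguments Eplus {R n M} E p.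
Arguments Eminus {R n M} E p.
Arguments omega {R n M E} p u v.

Record quasi_codazzi (R : realType) (n : nat) (M : manifold R n) :=
    QuasiCodazzi {
  qc_E :> para_hermitian M;
  Phi : forall p : M, 'Hom('cV[R]_n, fib qc_E p);
  nabla_plus : vfield M -> section qc_E -> section qc_E;
  nabla_minus : vfield M -> section qc_E -> section qc_E;
  Phi_smooth : smooth_anchor Phi;
  Phi_rank : forall p, \dim (limg (Phi p)) = n;
  Phi_lagrangian : forall p (v w : tangent p), omega p (Phi p v) (Phi p w) = 0;
  nabla_plus_conn : is_connection (Eplus qc_E) nabla_plus;
  nabla_minus_conn : is_connection (Eminus qc_E) nabla_minus;
  nabla_dual : dual_connections nabla_plus nabla_minus;
  nabla_plus_torsion : rel_torsion_free
    (fun p (v : tangent p) => pi_plus qc_E p (Phi p v)) nabla_plus;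
  nabla_minus_torsion : rel_torsion_free
    (fun p (v : tangent p) => pi_minus qc_E p (Phi p v)) nabla_minus }.

Arguments Phi {R n M} q p.
Arguments nabla_plus {R n M} q X s p.
Arguments nabla_minus {R n M} q X s p.

Definition Phi_plus (R : realType) (n : nat) (M : manifold R n)
    (C : quasi_codazzi M) (p : M) (v : tangent p) : fib C p :=
  pi_plus C p (Phi C p v).

Definition Phi_minus (R : realType) (n : nat) (M : manifold R n)
    (C : quasi_codazzi M) (p : M) (v : tangent p) : fib C p :=
  pi_minus C p (Phi C p v).

Definition qc_h (R : realType) (n : nat) (M : manifold R n)
    (C : quasi_codazzi M) (p : M) (v w : tangent p) : R :=
  tau (Phi C p v) (Phi C p w).

Section Legendre.
Variables (R : realType) (n : nat).

(* Points [(x, p, z)] of T^*R^n x R. *)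
Definition contact_space : normedModType R :=
  ('cV[R]_n * 'cV[R]_n * R^o)%type.
Definition xpart (j : contact_space) : 'cV[R]_n := j.1.1.
Definition ppart (j : contact_space) : 'cV[R]_n := j.1.2.
Definition zpart (j : contact_space) : R^o := j.2.

(* The value at [j] of the contact form dz - sum_i p_i dx_i on the vector [w]. *)
Definition contact_form (j w : contact_space) : R :=
  zpart w - \sum_(i < n) ppart j i 0 * xpart w i 0.

Definition affine_legendre_equiv (F : contact_space -> contact_space) : Prop :=
  exists (A A' : 'M[R]_n) (b b' c : 'cV[R]_n) (d : R),
    [/\ A \in unitmx, A' = invmx A^T, b' = A' *m c &
      forall j, F j = (A *m xpart j + b, A' *m ppart j + b',
                       zpart j + (c^T *m xpart j) 0 0 + d)].

Variable (M : manifold R n).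

(* [f] restricts to a smooth embedding of the open set [U] whose image is a
   Legendre submanifold, i.e. to a diffeomorphism of [U] onto one. *)
Record legendre_embedding (U : set M) (f : M -> contact_space) : Prop :=
    LegendreEmbedding {
  leg_smooth : smooth_on U f;
  leg_immersion : forall p (v : tangent p), U p -> dir f v = 0 -> v = 0;
  leg_inj : {in U &, injective f};
  leg_homeo : forall V : set M, open V -> V `<=` U ->
    exists2 W : set contact_space, open W & f @` V = W `&` (f @` U);
  leg_contact : forall p (v : tangent p), U p ->
    contact_form (f p) (dir f v) = 0 }.

(* A presentation of [M] as a gluing of Legendre submanifolds
   L_a = [qh_leg a @` qh_dom a]. *)
Record quasi_hessian := QuasiHessian {
  qh_idx : Type;
  qh_dom : qh_idx -> set M;
  qh_leg : qh_idx -> M -> contact_space;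
  qh_open : forall a, open (qh_dom a);
  qh_cover : forall p, exists a, qh_dom a p;
  qh_embedding : forall a, legendre_embedding (qh_dom a) (qh_leg a);
  qh_glue : forall a b, exists2 F, affine_legendre_equiv F &
    forall p, qh_dom a p -> qh_dom b p -> qh_leg b p = F (qh_leg a p) }.

(* The data (h, E, tau, I, Phi, nabla^+, nabla^-) are those carried by the
   quasi-Hessian structure [Q]: on each piece, Phi^+ and Phi^- are dx and dp in
   parallel frames of E^+ and E^- that are dual with respect to 2 tau, and h is
   the pullback of the metric sum_i (dx_i dp_i + dp_i dx_i) / 2. The factor 1/2
   makes h the Hessian of f on a regular piece z = f(x), p = df(x). *)
Definition yields (C : quasi_codazzi M) (Q : quasi_hessian) : Prop :=
  forall a : qh_idx Q,
    let dx (p : M) (v : tangent p) := xpart (dir (qh_leg a) v) in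
    let dp (p : M) (v : tangent p) := ppart (dir (qh_leg a) v) in
    (exists e f : 'I_n -> section C,
      [/\ forall i,
            parallel_on (Eplus C) (nabla_plus C) (qh_dom a) (e i),
          forall i,
            parallel_on (Eminus C) (nabla_minus C) (qh_dom a) (f i),
          forall p, qh_dom a p ->
            forall i j, tau (e i p) (f j p) = (i == j)%:R / 2%:R,
          forall p (v : tangent p), qh_dom a p ->
            Phi_plus C v = \sum_(i < n) dx p v i 0 *: e i p &
          forall p (v : tangent p), qh_dom a p ->
            Phi_minus C v = \sum_(i < n) dp p v i 0 *: f i p]) /\
    (forall p (v w : tangent p), qh_dom a p ->
       qc_h C v w = (\sum_(i < n) (dx p v i 0 * dp p w i 0
                                   + dp p v i 0 * dx p w i 0)) / 2%:R).

End Legendre.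

(* Main.v *)
From HB Require Import structures.
From mathcomp Require Import all_boot all_order all_algebra.
From mathcomp Require Import boolp classical_sets functions cardinality reals.
From mathcomp Require Import topology prodnormedzmodule normedtype landau derive.
From mathcomp Require Import realfun sequences exp.
From mathcomp Require Import ring lra zify.
Require Import Defs.

Set Implicit Arguments.
Unset Strict Implicit.
Unset Printing Implicit Defensive.
Import Order.TTheory GRing.Theory Num.Theory.
Import numFieldNormedType.Exports.
Local Open Scope classical_set_scope.
Local Open Scope ring_scope.

(** As both connections are flat, so is their sum on E; hence near every point
    there are parallel frames e_i of E^+ and f_i of E^- with
    2 tau(e_i, f_j) = delta_ij (a Frobenius theorem, proved by passing to the
    limit in Euler products along rays). The components of Phi^+ in the frame e
    and of Phi^- in the frame f are 1-forms which are closed by relative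
    torsion-freeness, so locally they are dx_i and dp_i. That Phi has Lagrangian
    image says that sum_i p_i dx_i is closed as well, so locally it is dz; since
    Phi is injective, (x, p, z) is a Legendre immersion. Two dual pairs of
    parallel frames on a ball differ by constant matrices A and A^-T, so the
    corresponding maps (x, p, z) differ by an affine Legendre equivalence. To
    glue pieces whose overlap may be disconnected, the cover is chosen so fine
    that two overlapping pieces lie in a common larger one. *)

(** * Differentiation in normed spaces *)

(** Duality of the connections does more than make the frames dual. It makes [tau] constant on pairs
    of parallel sections, so dual bases at one point spread to dual frames on a ball, and so the
    matrices comparing two dual pairs of frames are constant. It also turns a derivative of
    tau(Phi^+ Y, f) with f parallel into tau(nabla^+ Phi^+ Y, f), which is how torsion-freeness
    becomes closedness. The connections act on global sections and global vector fields only. Every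
    local computation is therefore made with global fields that have the right germ, obtained by
    multiplying local frames with bump functions. Frames, potentials and comparisons live on balls
    of a chart: these are convex in coordinates, so a function with zero derivative is constant
    there. *)

Section DirectionalDerivatives.
Variable R : realType.
Implicit Types (V W U : normedModType R).

(** Differentiability and the values of the derivative travel together, so that sum, product and
    chain rules compose without mentioning ['d f x]. *)
Definition has_diff V W (f : V -> W) (x : V) (L : V -> W) : Prop :=
  differentiable f x /\ forall v, 'D_v f x = L v.

Lemma has_diffE V W (f : V -> W) x :
  differentiable f x -> has_diff f x (fun v => 'D_v f x).
Proof. by []. Qed.

Lemma has_diff_eq V W (f : V -> W) x L L' :
  has_diff f x L -> (forall v, L v = L' v) -> has_diff f x L'.
Proof. by move=> [df dL] e; split=> // v; rewrite dL e. Qed.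

Lemma has_diff_ext V W (f g : V -> W) x L :
  (forall y, g y = f y) -> has_diff f x L -> has_diff g x L.
Proof. by move=> /funext ->. Qed.

(** The first order expansion of [f] holds for [g] near [x], and [diff_unique] then identifies the
    differential of [g]. *)
Lemma has_diff_near V W (f g : V -> W) x L :
  (\forall y \near x, f y = g y) -> has_diff f x L -> has_diff g x L.
Proof.
move=> fg [df dL]; split; last first.
  by move=> v; rewrite -(near_eq_derive v fg) dL.
have fgx : f x = g x by apply: nbhs_singleton fg.
move: df => /diff_locallyP [c e]; apply/diff_locallyP.
have h : g \o shift x = cst (g x) + 'd f x +o_ 0 id.
  apply/eqaddoP => r r0; move/eqaddoP : e => /(_ r r0).
  have fg0 : \forall y \near (0 : V), f (y + x) = g (y + x).
    by move: fg; rewrite (near_shift 0) subr0.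
  apply: filterS2 fg0 => y; rewrite !fctE /= fgx => -> //.
have := diff_unique c h => dg.
by rewrite dg; split.
Qed.

Lemma near_differentiable V W (f g : V -> W) x :
  (\forall y \near x, f y = g y) -> differentiable f x -> differentiable g x.
Proof. by move=> fg df; have [] := has_diff_near fg (has_diffE df). Qed.

Lemma has_diff_comp U V W (f : U -> V) (g : V -> W) x Lf Lg :
  has_diff f x Lf -> has_diff g (f x) Lg ->
  has_diff (fun y => g (f y)) x (fun v => Lg (Lf v)).
Proof.
move=> [df ef] [dg eg]; split; first exact: differentiable_comp.
move=> v; have dc : differentiable (g \o f) x by exact: differentiable_comp.
by rewrite (deriveE _ dc) diff_comp //= -deriveE // -deriveE // ef eg.
Qed.

Lemma diffZD V W (f : V -> W) x a v w : differentiable f x ->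
  'D_(a *: v + w) f x = a *: 'D_v f x + 'D_w f x.
Proof. by move=> df; rewrite !deriveE // linearP. Qed.

Lemma diffZv V W (f : V -> W) x a v : differentiable f x ->
  'D_(a *: v) f x = a *: 'D_v f x.
Proof. by move=> df; rewrite !deriveE // linearZ. Qed.

Lemma diffBv V W (f : V -> W) x v w : differentiable f x ->
  'D_(v - w) f x = 'D_v f x - 'D_w f x.
Proof. by move=> df; rewrite !deriveE // linearB. Qed.

Lemma diff_sumv V W (f : V -> W) x I (r : seq I) (P : pred I) (F : I -> V) :
  differentiable f x ->
  'D_(\sum_(i <- r | P i) F i) f x = \sum_(i <- r | P i) 'D_(F i) f x.
Proof.
move=> df; rewrite deriveE // linear_sum.
by apply: eq_bigr => i _; rewrite deriveE.
Qed.

Lemma has_diff_cst V W (a : W) (x : V) : has_diff (fun=> a) x (fun=> 0).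
Proof.
by split=> [|v]; [exact: differentiable_cst|exact: (derive_cst a x v)].
Qed.

Lemma has_diff_id V (x : V) : has_diff (fun y => y) x id.
Proof. by split=> [|v]; [exact: ex_diff|exact: derive_id]. Qed.

Lemma has_diffD V W (f g : V -> W) x L M :
  has_diff f x L -> has_diff g x M ->
  has_diff (fun y => f y + g y) x (fun v => L v + M v).
Proof.
move=> [df ef] [dg eg]; split=> [|v]; first exact: differentiableD.
by rewrite deriveD ?ef ?eg //; exact: diff_derivable.
Qed.

Lemma has_diffN V W (f : V -> W) x L :
  has_diff f x L -> has_diff (fun y => - f y) x (fun v => - L v).
Proof.
move=> [df ef]; split=> [|v]; first exact: differentiableN.
by rewrite deriveN ?ef //; exact: diff_derivable.
Qed.

Lemma has_diffB V W (f g : V -> W) x L M :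
  has_diff f x L -> has_diff g x M ->
  has_diff (fun y => f y - g y) x (fun v => L v - M v).
Proof. by move=> hf hg; apply: has_diffD => //; exact: has_diffN. Qed.

Lemma has_diff_sum V W I (r : seq I) (P : pred I) (f : I -> V -> W) x L :
  (forall i, P i -> has_diff (f i) x (L i)) ->
  has_diff (fun y => \sum_(i <- r | P i) f i y) x
           (fun v => \sum_(i <- r | P i) L i v).
Proof.
move=> h; elim: r => [|i r IH].
  apply: has_diff_eq (has_diff_ext _ (has_diff_cst 0 _)) _ => v; by rewrite big_nil.
case Pi : (P i).
  apply: has_diff_eq (has_diff_ext _ (has_diffD (h _ Pi) IH)) _ => v;
    by rewrite big_cons Pi.
by apply: has_diff_eq (has_diff_ext _ IH) _ => v; rewrite big_cons Pi.
Qed.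

Lemma has_diff_fsum V W (I : finType) (f : I -> V -> W) x L :
  (forall i, has_diff (f i) x (L i)) ->
  has_diff (fun y => \sum_i f i y) x (fun v => \sum_i L i v).
Proof. by move=> h; apply: has_diff_sum => i _; exact: h. Qed.

Lemma linear_has_diff V W (L : V -> W) x : linear L -> continuous L ->
  has_diff L x L.
Proof.
move=> lL cL; pose lM := GRing.isLinear.Build _ _ _ _ _ lL.
pose F : {linear V -> W} := HB.pack L lM.
have dF : differentiable (F : V -> W) x by exact: linear_differentiable.
by split=> // v; rewrite -[L]/(F : V -> W) deriveE // diff_lin.
Qed.

Lemma has_diff_lin V W U (L : W -> U) (f : V -> W) x M :
  linear L -> continuous L -> has_diff f x M ->
  has_diff (fun y => L (f y)) x (fun v => L (M v)).
Proof. by move=> lL cL hf; apply: (has_diff_comp hf (linear_has_diff _ lL cL)). Qed.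

Lemma has_diff_pair V W W' (f : V -> W) (g : V -> W') x L M :
  has_diff f x L -> has_diff g x M ->
  has_diff (fun y => (f y, g y)) x (fun v => (L v, M v)).
Proof.
move=> [df ef] [dg eg].
have dp : differentiable (fun y => (f y, g y)) x by exact: differentiable_pair.
by split=> // v; rewrite deriveE // diff_pair //= -!deriveE // ef eg.
Qed.

Lemma has_diff_bilin V W W' U (B : W -> W' -> U) (f : V -> W) (g : V -> W')
    x L M : (forall w, linear (B w)) -> (forall w', linear (B^~ w')) ->
  continuous (fun p : W * W' => B p.1 p.2) ->
  has_diff f x L -> has_diff g x M ->
  has_diff (fun y => B (f y) (g y)) x (fun v => B (f x) (M v) + B (L v) (g x)).
Proof.
move=> lr ll cB hf hg.
have bB : bilinear_for (GRing.Scale.Law.clone _ _ *:%R _)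
    (GRing.Scale.Law.clone _ _ *:%R _) B by split=> w a y z /=; rewrite ?lr ?ll.
pose bM := bilinear_isBilinear.Build R W W' U _ _ B bB.
pose F : {bilinear W -> W' -> U} := HB.pack B bM.
have hB : has_diff (fun q : W * W' => F q.1 q.2) (f x, g x)
   (fun q => B (f x) q.2 + B q.1 (g x)).
  have dB : differentiable (fun q : W * W' => F q.1 q.2) (f x, g x).
    exact: differentiable_bilin.
  by split=> // v; rewrite deriveE // diff_bilin.
exact: (has_diff_comp (has_diff_pair hf hg) hB).
Qed.

Lemma has_diffZ V W (a : V -> R^o) (f : V -> W) x L M :
  has_diff a x L -> has_diff f x M ->
  has_diff (fun y => a y *: f y) x (fun v => a x *: M v + L v *: f x).
Proof.
apply: (@has_diff_bilin V R^o W W (fun a w => a *: w)).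
- by move=> w c y z; rewrite scalerDr !scalerA mulrC.
- by move=> w c y z; rewrite scalerDl scalerA.
- by move=> p; apply: scale_continuous.
Qed.

Lemma mx_norm_entry m n (A : 'M[R]_(m, n)) i j : `|A i j| <= `|A|.
Proof.
rewrite [leRHS]/Num.Def.normr/= mx_normrE.
exact: (le_bigmax _ (fun ij => `|A ij.1 ij.2|) (i, j)).
Qed.

Lemma mx_norm_le m n (A : 'M[R]_(m, n)) (c : R) : 0 <= c ->
  (forall i j, `|A i j| <= c) -> `|A| <= c.
Proof.
move=> c0 h; rewrite [leLHS]/Num.Def.normr/= mx_normrE.
by apply: bigmax_le => // ij _; exact: h.
Qed.

(** Such a map is a finite sum of coordinates times constant vectors. *)
Lemma linear_mx_continuous m n W (L : 'M[R]_(m, n) -> W) :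
  linear L -> continuous L.
Proof.
move=> lL; pose lM := GRing.isLinear.Build _ _ _ _ _ lL.
pose F : {linear 'M[R]_(m, n) -> W} := HB.pack L lM.
have -> : L = fun A => \sum_i \sum_j A i j *: L (delta_mx i j).
  apply/funext=> A; rewrite {1}[A]matrix_sum_delta -[L]/(F : _ -> _) linear_sum.
  apply: eq_bigr => i _; rewrite linear_sum; apply: eq_bigr => j _.
  by rewrite linearZ.
move=> A; apply: differentiable_continuous.
pose c i j (A : 'M[R]_(m, n)) : R^o := A i j.
have h i j := has_diffZ (has_diffE (differentiable_coord A i j : differentiable (c i j) A))
  (has_diff_cst (L (delta_mx i j)) A).
have hs i := @has_diff_sum _ _ _ (index_enum _) xpredT _ _ _ (fun j _ => h i j).
by have [] := has_diff_fsum hs.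
Qed.

Lemma linear_fun0 V W (L : V -> W) : linear L -> L 0 = 0.
Proof.
move=> lL; have := lL 1 0 0; rewrite !scale1r addr0.
by move=> /(congr1 (fun x => x - L 0)); rewrite addrK subrr.
Qed.

Lemma linear_scalar_continuous W (L : R^o -> W) : linear L -> continuous L.
Proof.
move=> lL; have e : (fun a : R^o => a *: L 1) = L.
  apply/funext=> a; have := lL a 1 0.
  by rewrite (linear_fun0 lL) !addr0 => <-; congr (L _); exact: mulr1.
by rewrite -e => a; apply: scalel_continuous.
Qed.

End DirectionalDerivatives.

(** * Calculus of $C^k$ and smooth functions on open sets *)

Section SmoothFunctions.
Variable R : realType.
Implicit Types (V W U : normedModType R).

Lemma Ck_sub V W k (U U' : set V) (f : V -> W) : U' `<=` U ->
  Ck k U f -> Ck k U' f.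
Proof.
move=> s; elim: k f => [|k IH] f /=; first by move=> h x /s; exact: h.
by move=> [d h]; split=> [x /s|v]; [exact: d|exact: IH].
Qed.

(** [Ck] is a conjunction of pointwise conditions on derivatives taken in the whole space, so any
    set containing [x] can serve as [N]. *)
Lemma Ck_cover V W k (U : set V) (f : V -> W) :
  (forall x, U x -> exists N, N x /\ Ck k N f) -> Ck k U f.
Proof.
elim: k f => [|k IH] f /= h; first by move=> x /h [N [Nx]]; exact.
split=> [x /h [N [Nx []]]|v]; first by move=> + _; exact.
by apply: IH => x /h [N [Nx [_]]] /(_ v); exists N.
Qed.

Lemma open_near (T : topologicalType) (U : set T) x : open U -> U x ->
  \forall y \near x, U y.
Proof. by move=> oU Ux; apply: open_nbhs_nbhs; split. Qed.

Lemma Ck_ext V W k (U : set V) (f g : V -> W) : open U ->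
  (forall x, U x -> f x = g x) -> Ck k U f -> Ck k U g.
Proof.
move=> oU; elim: k f g => [|k IH] f g fg /=.
  move=> cf x Ux; have fgx : \forall y \near x, f y = g y.
    by apply: filterS (open_near oU Ux) => y; exact: fg.
  have : f y @[y --> x] --> g x by rewrite -(fg _ Ux); exact: cf.
  by apply: cvg_trans; apply: near_eq_cvg; apply: filterS fgx => y ->.
have nfg x : U x -> \forall y \near x, f y = g y.
  by move=> Ux; apply: filterS (open_near oU Ux) => y; exact: fg.
move=> [df h]; split=> [x Ux|v].
  exact: near_differentiable (nfg _ Ux) (df _ Ux).
by apply: IH (h v) => x /nfg; exact: near_eq_derive.
Qed.

Lemma Ck_diff V W k (U : set V) (f : V -> W) x :
  Ck k.+1 U f -> U x -> differentiable f x.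
Proof. by move=> [h _]; exact: h. Qed.

Lemma CkS V W k (U : set V) (f : V -> W) : Ck k.+1 U f -> Ck k U f.
Proof.
elim: k f => [|k IH] f; last by move=> [d h]; split=> // v; exact: IH.
by move=> [d _] x Ux; apply: differentiable_continuous; exact: d.
Qed.

Lemma Ck_cont V W k (U : set V) (f : V -> W) x :
  Ck k U f -> U x -> {for x, continuous f}.
Proof. by elim: k => [|k IH]; [exact|move=> /CkS; exact: IH]. Qed.

Lemma Ck_cst V W k (U : set V) (a : W) : Ck k U (fun=> a).
Proof.
elim: k a => [|k IH] a /=; first by move=> x _; exact: cst_continuous.
split=> [x _|v]; first exact: differentiable_cst.
have -> : (fun x : V => 'D_v (fun=> a : W) x) = fun=> 0.
  by apply/funext => x; exact: derive_cst.
exact: IH.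
Qed.

Lemma Ck_lin V W W' k (U : set V) (L : W -> W') (f : V -> W) :
  open U -> linear L -> continuous L -> Ck k U f -> Ck k U (fun x => L (f x)).
Proof.
move=> oU lL cL; elim: k f => [|k IH] f /=.
  move=> cf x Ux; apply: (@continuous_comp _ _ _ f L); [exact: cf|exact: cL].
move=> [df h].
have hL x : U x -> has_diff (fun x => L (f x)) x (fun v => L ('D_v f x)).
  by move=> Ux; apply: has_diff_lin => //; apply: has_diffE; exact: df.
split=> [x /hL []//|v].
by apply: Ck_ext (IH _ (h v)) => // x /hL [_ ->].
Qed.

Lemma Ck_add V W k (U : set V) (f g : V -> W) : open U ->
  Ck k U f -> Ck k U g -> Ck k U (fun x => f x + g x).
Proof.
move=> oU; elim: k f g => [|k IH] f g /=.
  by move=> cf cg x Ux; apply: cvgD; [exact: cf|exact: cg].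
move=> [df hf] [dg hg].
have h x : U x -> has_diff (fun x => f x + g x) x (fun v => 'D_v f x + 'D_v g x).
  by move=> Ux; apply: has_diffD; apply: has_diffE; [exact: df|exact: dg].
split=> [x /h []//|v].
by apply: Ck_ext (IH _ _ (hf v) (hg v)) => // x /h [_ ->].
Qed.

Lemma Ck_sum V W k (U : set V) I (r : seq I) (P : pred I) (f : I -> V -> W) :
  open U -> (forall i, P i -> Ck k U (f i)) ->
  Ck k U (fun x => \sum_(i <- r | P i) f i x).
Proof.
move=> oU h; elim: r => [|i r IH].
  by apply: Ck_ext (Ck_cst k U 0) => // x _; rewrite big_nil.
case Pi : (P i); last by apply: Ck_ext IH => // x _; rewrite big_cons Pi.
by apply: Ck_ext (Ck_add oU (h _ Pi) IH) => // x _; rewrite big_cons Pi.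
Qed.

Lemma Ck_bilin V W W' W'' k (U : set V) (B : W -> W' -> W'') (f : V -> W)
    (g : V -> W') : open U ->
  (forall w, linear (B w)) -> (forall w', linear (B^~ w')) ->
  continuous (fun p : W * W' => B p.1 p.2) ->
  Ck k U f -> Ck k U g -> Ck k U (fun x => B (f x) (g x)).
Proof.
move=> oU lr ll cB; elim: k f g => [|k IH] f g.
  move=> cf cg x Ux.
  apply: (@continuous_comp _ _ _ (fun x => (f x, g x)) (fun p => B p.1 p.2)).
    by apply: cvg_pair; [exact: cf|exact: cg].
  exact: cB.
move=> Cf Cg; have [df hf] := Cf; have [dg hg] := Cg.
have h x : U x -> has_diff (fun x => B (f x) (g x)) x
    (fun v => B (f x) ('D_v g x) + B ('D_v f x) (g x)).
  by move=> Ux; apply: has_diff_bilin => //; apply: has_diffE; [exact: df|exact: dg].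
split=> [x /h []//|v].
have := Ck_add oU (IH _ _ (CkS Cf) (hg v)) (IH _ _ (hf v) (CkS Cg)).
by apply: Ck_ext => // x /h [_ ->].
Qed.

Lemma scale_linear_r W (a : R^o) : linear (fun w : W => a *: w).
Proof. by move=> c y z; rewrite scalerDr !scalerA mulrC. Qed.

Lemma scale_linear_l W (w : W) : linear (fun a : R^o => a *: w).
Proof. by move=> c y z; rewrite scalerDl scalerA. Qed.

Lemma Ck_scale V W k (U : set V) (a : V -> R^o) (f : V -> W) : open U ->
  Ck k U a -> Ck k U f -> Ck k U (fun x => a x *: f x).
Proof.
move=> oU; apply: (@Ck_bilin V R^o W W k U (fun a w => a *: w)) => //.
- exact: scale_linear_r.
- exact: scale_linear_l.
- by move=> p; apply: scale_continuous.
Qed.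

Lemma coord_linear m n (i : 'I_m) (j : 'I_n) :
  linear (fun A : 'M[R]_(m, n) => A i j : R^o).
Proof. by move=> a A B; rewrite !mxE. Qed.

Lemma Ck_entry V m n k (U : set V) (A : V -> 'M[R]_(m, n)) i j : open U ->
  Ck k U A -> Ck k U (fun x => A x i j : R^o).
Proof.
move=> oU; apply: (@Ck_lin _ _ R^o _ _ (fun A : 'M[R]_(m, n) => A i j : R^o)) => //.
  exact: coord_linear.
exact/linear_mx_continuous/coord_linear.
Qed.

Lemma Ck_mx V m n k (U : set V) (A : V -> 'M[R]_(m, n)) : open U ->
  (forall i j, Ck k U (fun x => A x i j : R^o)) -> Ck k U A.
Proof.
move=> oU h.
have hs : Ck k U (fun x => \sum_i \sum_j (A x i j : R^o) *: delta_mx i j : 'M[R]_(m, n)).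
  apply: Ck_sum => // i _; apply: Ck_sum => // j _.
  by apply: Ck_scale => //; exact: Ck_cst.
by apply: Ck_ext hs => // x _; rewrite [in RHS](matrix_sum_delta (A x)).
Qed.

Lemma Ck_mulmx V m n p k (U : set V) (A : V -> 'M[R]_(m, n))
    (B : V -> 'M[R]_(n, p)) : open U ->
  Ck k U A -> Ck k U B -> Ck k U (fun x => A x *m B x).
Proof.
move=> oU hA hB; apply: Ck_mx => // i j.
have hs : Ck k U (fun x => \sum_l (A x i l : R^o) *: (B x l j : R^o) : R^o).
  by apply: Ck_sum => // l _; apply: Ck_scale => //; exact: Ck_entry.
by apply: Ck_ext hs => // x _; rewrite mxE.
Qed.

Lemma cV_sum_delta m (v : 'cV[R]_m) : v = \sum_i v i 0 *: delta_mx i 0.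
Proof.
by rewrite {1}[v]matrix_sum_delta; apply: eq_bigr => i _; rewrite big_ord1.
Qed.

Lemma sum_delta_scale m W (l : 'I_m) (g : 'I_m -> W) :
  \sum_k (delta_mx l 0 : 'cV[R]_m) k 0 *: g k = g l.
Proof.
rewrite (bigD1 l) //= big1 => [|k kl]; first by rewrite mxE !eqxx addr0 scale1r.
by rewrite mxE (negbTE kl) scale0r.
Qed.

(** The derivative ['D_('D_v f x) g (f x)] has a direction that varies with [x]. Expanding it in the
    standard basis of R^m gives a sum of products to which the induction applies. *)
Lemma Ck_comp V W m k (U : set V) (U' : set 'cV[R]_m) (f : V -> 'cV[R]_m)
    (g : 'cV[R]_m -> W) : open U -> open U' ->
  (forall x, U x -> U' (f x)) ->
  Ck k U f -> Ck k U' g -> Ck k U (fun x => g (f x)).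
Proof.
move=> oU oU' fU; elim: k g => [|k IH] g Cf Cg.
  move=> x Ux; apply: (@continuous_comp _ _ _ f g); first exact: Cf.
  by apply: Cg; exact: fU.
have [df hf] := Cf; have [dg hg] := Cg.
have h x : U x -> has_diff (fun x => g (f x)) x (fun v => 'D_('D_v f x) g (f x)).
  move=> Ux; apply: has_diff_comp; apply: has_diffE; first exact: df.
  by apply: dg; exact: fU.
split=> [x /h []//|v].
have hs : Ck k U (fun x => \sum_i ('D_v f x i 0 : R^o) *: 'D_(delta_mx i 0) g (f x)).
  apply: Ck_sum => // i _; apply: Ck_scale => //.
    by apply: Ck_entry => //; exact: hf.
  by apply: (IH (fun y => 'D_(delta_mx i 0) g y)); [exact: CkS|exact: hg].
apply: Ck_ext hs => // x Ux; have [_ ->] := h x Ux.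
have dgx : differentiable g (f x) by apply: dg; exact: fU.
rewrite [in RHS](cV_sum_delta ('D_v f x)) diff_sumv //.
by apply: eq_bigr => i _; rewrite diffZv.
Qed.

Lemma Ck_pair V W W' k (U : set V) (f : V -> W) (g : V -> W') : open U ->
  Ck k U f -> Ck k U g -> Ck k U (fun x => (f x, g x)).
Proof.
move=> oU; elim: k f g => [|k IH] f g /=.
  by move=> cf cg x Ux; apply: cvg_pair; [exact: cf|exact: cg].
move=> [df hf] [dg hg].
have h x : U x -> has_diff (fun x => (f x, g x)) x (fun v => ('D_v f x, 'D_v g x)).
  by move=> Ux; apply: has_diff_pair; apply: has_diffE; [exact: df|exact: dg].
split=> [x /h []//|v].
by apply: Ck_ext (IH _ _ (hf v) (hg v)) => // x /h [_ ->].
Qed.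

Lemma Ck_id V k (U : set V) : Ck k U (fun x => x).
Proof.
case: k => [|k] /=; first by move=> x _; exact: cvg_id.
split=> [x _|v]; first by have [] := has_diff_id x.
have -> : (fun x : V => 'D_v (fun x : V => x) x) = fun=> v.
  by apply/funext => x; exact: derive_id.
exact: Ck_cst.
Qed.

Lemma Cinfty_sub V W (U U' : set V) (f : V -> W) : U' `<=` U ->
  Cinfty U f -> Cinfty U' f.
Proof. by move=> s h k; exact: Ck_sub (h k). Qed.

Lemma Cinfty_cover V W (U : set V) (f : V -> W) :
  (forall x, U x -> exists N, N x /\ Cinfty N f) -> Cinfty U f.
Proof.
by move=> h k; apply: Ck_cover => x /h [N [Nx hN]]; exists N; split.
Qed.

Lemma Cinfty_ext V W (U : set V) (f g : V -> W) : open U ->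
  (forall x, U x -> f x = g x) -> Cinfty U f -> Cinfty U g.
Proof. by move=> oU e h k; exact: Ck_ext (h k). Qed.

Lemma Cinfty_diff V W (U : set V) (f : V -> W) x :
  Cinfty U f -> U x -> differentiable f x.
Proof. by move=> /(_ 1); exact: Ck_diff. Qed.

Lemma Cinfty_cont V W (U : set V) (f : V -> W) x :
  Cinfty U f -> U x -> {for x, continuous f}.
Proof. by move=> /(_ 0); exact: Ck_cont. Qed.

Lemma Cinfty_derive V W (U : set V) (f : V -> W) v :
  Cinfty U f -> Cinfty U (fun x => 'D_v f x).
Proof. by move=> h k; have [_] := h k.+1; exact. Qed.

Lemma Cinfty_deriveI V W (U : set V) (f : V -> W) :
  (forall x, U x -> differentiable f x) ->
  (forall v, Cinfty U (fun x => 'D_v f x)) -> Cinfty U f.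
Proof.
move=> d h [|k]; last by split=> // v; exact: h.
by move=> x Ux; apply: differentiable_continuous; exact: d.
Qed.

Lemma Cinfty_cst V W (U : set V) (a : W) : Cinfty U (fun=> a).
Proof. by move=> k; exact: Ck_cst. Qed.

Lemma Cinfty_id V (U : set V) : Cinfty U (fun x => x).
Proof. by move=> k; exact: Ck_id. Qed.

Lemma Cinfty_add V W (U : set V) (f g : V -> W) : open U ->
  Cinfty U f -> Cinfty U g -> Cinfty U (fun x => f x + g x).
Proof. by move=> oU hf hg k; exact: Ck_add. Qed.

Lemma Cinfty_scale V W (U : set V) (a : V -> R^o) (f : V -> W) : open U ->
  Cinfty U a -> Cinfty U f -> Cinfty U (fun x => a x *: f x).
Proof. by move=> oU hf hg k; exact: Ck_scale. Qed.

Lemma Cinfty_sum V W (U : set V) I (r : seq I) (P : pred I) (f : I -> V -> W) :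
  open U -> (forall i, P i -> Cinfty U (f i)) ->
  Cinfty U (fun x => \sum_(i <- r | P i) f i x).
Proof. by move=> oU h k; apply: Ck_sum => // i Pi; exact: h. Qed.

Lemma Cinfty_opp V W (U : set V) (f : V -> W) : open U ->
  Cinfty U f -> Cinfty U (fun x => - f x).
Proof.
move=> oU h; apply: Cinfty_ext (Cinfty_scale oU (@Cinfty_cst V R^o U (-1)) h) => // x _.
by rewrite scaleN1r.
Qed.

Lemma Cinfty_entry V m n (U : set V) (A : V -> 'M[R]_(m, n)) i j : open U ->
  Cinfty U A -> Cinfty U (fun x => A x i j : R^o).
Proof. by move=> oU h k; exact: Ck_entry. Qed.

Lemma Cinfty_mx V m n (U : set V) (A : V -> 'M[R]_(m, n)) : open U ->
  (forall i j, Cinfty U (fun x => A x i j : R^o)) -> Cinfty U A.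
Proof. by move=> oU h k; apply: Ck_mx => // i j; exact: h. Qed.

Lemma Cinfty_mulmx V m n p (U : set V) (A : V -> 'M[R]_(m, n))
    (B : V -> 'M[R]_(n, p)) : open U ->
  Cinfty U A -> Cinfty U B -> Cinfty U (fun x => A x *m B x).
Proof. by move=> oU hA hB k; exact: Ck_mulmx. Qed.

Lemma Cinfty_comp V W m (U : set V) (U' : set 'cV[R]_m) (f : V -> 'cV[R]_m)
    (g : 'cV[R]_m -> W) : open U -> open U' ->
  (forall x, U x -> U' (f x)) ->
  Cinfty U f -> Cinfty U' g -> Cinfty U (fun x => g (f x)).
Proof. by move=> oU oU' fU hf hg k; exact: Ck_comp (hf k) (hg k). Qed.

Lemma Cinfty_pair V W W' (U : set V) (f : V -> W) (g : V -> W') : open U ->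
  Cinfty U f -> Cinfty U g -> Cinfty U (fun x => (f x, g x)).
Proof. by move=> oU hf hg k; exact: Ck_pair. Qed.

(* Post-composition with a scalar function all of whose derivatives exist, the
   k-th one being [h k]. *)
Lemma Cinfty_comp1 V (U : set V) (h : nat -> R -> R) (f : V -> R^o) : open U ->
  (forall k t, is_derive (t : R^o) (1 : R^o) (h k : R^o -> R^o) (h k.+1 t)) ->
  Cinfty U f -> Cinfty U (fun x => h 0%N (f x) : R^o).
Proof.
move=> oU dh hf k; elim: k (0%N) => [|k IH] l.
  move=> x Ux; apply: (@continuous_comp _ _ R^o f (h l)); first exact: (hf 0%N).
  by apply: differentiable_continuous; apply/derivable1_diffP; have [] := dh l (f x).
have H x : U x -> has_diff (fun x => h l (f x) : R^o) x
   (fun v => ('D_v f x : R^o) *: (h l.+1 (f x) : R^o)).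
  move=> Ux; apply: (has_diff_comp (has_diffE (Cinfty_diff hf Ux))
    (Lg := fun v : R^o => v *: (h l.+1 (f x) : R^o))).
  have [d e] := dh l (f x).
  have d' : differentiable (h l : R^o -> R^o) (f x) by apply/derivable1_diffP.
  by split=> // v; rewrite -e -diffZv // [v *: _]mulr1.
split=> [x /H []//|v].
have := Ck_scale oU (Cinfty_derive v hf k) (IH l.+1).
by apply: Ck_ext => // x /H [_ ->].
Qed.

End SmoothFunctions.

(** * Mean value inequality and symmetry of second derivatives *)

Section MeanValue.
Variable R : realType.
Implicit Types (V W : normedModType R).

Lemma has_diff_entry V m n (A : V -> 'M[R]_(m, n)) x L i j :
  has_diff A x L -> has_diff (fun y => A y i j : R^o) x (fun v => L v i j).
Proof.
apply: (@has_diff_lin _ _ _ R^o (fun A : 'M[R]_(m, n) => A i j : R^o)).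
  exact: coord_linear.
exact/linear_mx_continuous/coord_linear.
Qed.

Lemma has_diff_mx V m n (A : V -> 'M[R]_(m, n)) x (L : V -> 'M[R]_(m, n)) :
  (forall i j, has_diff (fun y => A y i j : R^o) x (fun v => L v i j)) ->
  has_diff A x L.
Proof.
move=> h.
have hij i j := has_diffZ (h i j) (has_diff_cst (delta_mx i j : 'M[R]_(m, n)) x).
have hi i := @has_diff_sum _ _ _ _ (index_enum _) xpredT _ _ _ (fun j _ => hij i j).
have hs := has_diff_fsum hi.
apply: has_diff_eq (has_diff_ext _ hs) _ => [y|v].
  by rewrite [LHS]matrix_sum_delta.
rewrite [RHS]matrix_sum_delta; apply: eq_bigr => i _; apply: eq_bigr => j _.
by rewrite scaler0 add0r.
Qed.

Lemma has_diff_mulmx V m n p (A : V -> 'M[R]_(m, n)) (B : V -> 'M[R]_(n, p))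
    x (L : V -> 'M[R]_(m, n)) (M : V -> 'M[R]_(n, p)) :
  has_diff A x L -> has_diff B x M ->
  has_diff (fun y => A y *m B y) x (fun v => A x *m M v + L v *m B x).
Proof.
move=> hA hB; apply: has_diff_mx => i j.
have hl l := has_diffZ (has_diff_entry i l hA) (has_diff_entry l j hB).
have hs := has_diff_fsum hl.
apply: has_diff_eq (has_diff_ext _ hs) _ => [y|v]; first by rewrite mxE.
by rewrite !mxE big_split.
Qed.

Lemma has_diff_line V (x v : V) (t : R^o) :
  has_diff (fun s : R^o => x + s *: v) t (fun s => s *: v).
Proof.
apply: has_diff_eq (has_diffD (has_diff_cst x t)
  (has_diffZ (has_diff_id t) (has_diff_cst v t))) _ => s.
by rewrite add0r scaler0 add0r.
Qed.

Lemma mvt_line V (f : V -> R^o) x v :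
  (forall t : R, 0 <= t <= 1 -> differentiable f (x + t *: v)) ->
  exists2 c : R, 0 <= c <= 1 & f (x + v) - f x = 'D_v f (x + c *: v).
Proof.
move=> df.
have h t : 0 <= t <= 1 -> has_diff (fun s : R^o => f (x + s *: v)) t
    (fun s => 'D_(s *: v) f (x + t *: v)).
  move=> t01; apply: (has_diff_comp (has_diff_line x v t)).
  by apply: has_diffE; exact: df.
have [||c] := @MVT_segment R (fun s => f (x + s *: v))
    (fun t => 'D_v f (x + t *: v)) 0 1 ler01.
- move=> t; rewrite in_itv /= => /andP[t0 t1].
  have [d e] := h t (introT andP (conj (ltW t0) (ltW t1))).
  split; first exact: diff_derivable.
  by have := e 1; rewrite scale1r.
- apply: continuous_in_subspaceT => t; rewrite inE /= in_itv /= => t01.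
  by apply: differentiable_continuous; have [] := h t t01.
- rewrite in_itv /= => c01; rewrite scale1r scale0r addr0 subr0 mulr1.
  by exists c.
Qed.

(** The norm is the maximum over the entries, so the scalar theorem applied to each entry loses no
    factor, although the intermediate points differ. *)
Lemma mean_value_ineq V m n (f : V -> 'M[R]_(m, n)) x v (K : R) : 0 <= K ->
  (forall t : R, 0 <= t <= 1 -> differentiable f (x + t *: v)) ->
  (forall t : R, 0 <= t <= 1 -> `|'D_v f (x + t *: v)| <= K) ->
  `|f (x + v) - f x| <= K.
Proof.
move=> K0 df bf; apply: mx_norm_le => // i j; rewrite !mxE.
have h t : 0 <= t <= 1 -> has_diff (fun y => f y i j : R^o) (x + t *: v)
    (fun w => 'D_w f (x + t *: v) i j).
  by move=> /df d; exact: has_diff_entry.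
have [|c c01 ->] := @mvt_line V (fun y => f y i j : R^o) x v.
  by move=> t /h [].
have [_ ->] := h c c01.
by apply: le_trans (mx_norm_entry _ _ _) _; exact: bf.
Qed.

Lemma ball_segment V (u x v : V) (r t : R) : 0 <= t <= 1 ->
  `|x - u| < r -> `|x + v - u| < r -> `|x + t *: v - u| < r.
Proof.
move=> /andP[t0 t1].
rewrite [x + v - u]addrAC [x + t *: v - u]addrAC; move: (x - u) => w hx hy.
have -> : w + t *: v = (1 - t) *: w + t *: (w + v).
  by rewrite scalerDr addrA -scalerDl subrK scale1r.
apply: le_lt_trans (ler_normD _ _) _; rewrite !normrZ ger0_norm ?subr_ge0 //.
rewrite (ger0_norm t0).
have [t_eq0|tn0] := eqVneq t 0; first by rewrite t_eq0 subr0 mul1r mul0r addr0.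
have tp : 0 < t by rewrite lt_neqAle eq_sym tn0.
have -> : r = (1 - t) * r + t * r by rewrite -mulrDl subrK mul1r.
apply: ler_ltD; first by apply: ler_wpM2l; [rewrite subr_ge0|exact: ltW].
by rewrite ltr_pM2l.
Qed.

Lemma near0_scale_pos V (x : V) (P : set V) (u v : V) :
  (\forall y \near x, P y) ->
  exists2 h : R, 0 < h & forall a b : R, 0 <= a <= h -> 0 <= b <= h ->
    P (x + a *: u + b *: v).
Proof.
move=> /nbhs_ballP [e /= e0 he].
(* The summand 1 keeps [K] positive when both directions vanish. *)
pose K := `|u| + `|v| + 1.
have K0 : 0 < K by rewrite /K; apply: ltr_wpDl => //; apply: addr_ge0.
exists (e / K); first exact: divr_gt0.
move=> a b /andP[a0 ah] /andP[b0 bh]; apply: he.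
rewrite -ball_normE /= -addrA opprD addNKr normrN.
apply: le_lt_trans (ler_normD _ _) _; rewrite !normrZ !ger0_norm //.
apply: (@le_lt_trans _ _ (e / K * (`|u| + `|v|))).
  by rewrite mulrDr; apply: lerD; apply: ler_wpM2r.
rewrite mulrAC ltr_pdivrMr // ltr_pM2l // /K; lra.
Qed.

(** Mean value theorem twice: for [y |-> f (y + h *: v) - f y] along [h *: u], then for ['D_u f]
    along [h *: v]. *)
Lemma second_difference V (f : V -> R^o) (x u v : V) (h : R) : 0 < h ->
  (forall a b : R, 0 <= a <= h -> 0 <= b <= h ->
    differentiable f (x + a *: u + b *: v) /\
    differentiable (fun y => 'D_u f y) (x + a *: u + b *: v)) ->
  exists a b : R, [/\ 0 <= a <= h, 0 <= b <= h &
    f (x + h *: u + h *: v) - f (x + h *: u) - f (x + h *: v) + f x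
    = h * h * 'D_v (fun y => 'D_u f y) (x + a *: u + b *: v)].
Proof.
move=> h0 df; have hh : 0 <= h <= h by rewrite lexx ltW.
have z0 : 0 <= (0 : R) <= h by rewrite lexx ltW.
have sc t : 0 <= t <= 1 -> 0 <= t * h <= h.
  move=> /andP[t0 t1]; rewrite mulr_ge0 ?(ltW h0) //=.
  by rewrite -[leRHS]mul1r ler_wpM2r // ltW.
pose g y := f (y + h *: v) - f y : R^o.
have dg t : 0 <= t <= 1 -> has_diff g (x + t *: (h *: u))
   (fun w => 'D_w f (x + t *: (h *: u) + h *: v) - 'D_w f (x + t *: (h *: u))).
  move=> /sc th; have [d1 _] := df _ _ th hh; have [d2 _] := df _ _ th z0.
  rewrite scale0r addr0 in d2; rewrite scalerA.
  apply: has_diffB; last exact: has_diffE.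
  apply: (has_diff_comp (g := f) (Lf := id) (Lg := fun w => 'D_w f (x + (t * h) *: u + h *: v))).
    apply: has_diff_eq (has_diffD (has_diff_id _) (has_diff_cst (h *: v) _)) _ => w.
    by rewrite addr0.
  exact: has_diffE.
have [t /dg [] //|a /[dup] a01 /sc ah] := @mvt_line V g x (h *: u).
have [dga ->] := dg a a01 => ega.
pose y := x + a *: (h *: u).
have [|b /sc bh] := @mvt_line V (fun z => 'D_u f z) y (h *: v).
  by move=> t /sc th; have [_] := df _ _ ah th; rewrite /y !scalerA.
have [d1 _] := df _ _ ah hh; have [d2 _] := df _ _ ah z0.
have [_ d3] := df _ _ ah bh.
rewrite !scalerA => egb.
exists (a * h), (b * h); split=> //.
have -> : f (x + h *: u + h *: v) - f (x + h *: u) - f (x + h *: v) + f x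
  = g (x + h *: u) - g x by rewrite /g; ring.
rewrite ega !scalerA !diffZv //; last by rewrite scale0r addr0 in d2.
rewrite -scalerBr -mulrA [_ *: _ in LHS]/(_ * _); congr (_ * _).
by move: egb; rewrite /y !scalerA diffZv // => ->.
Qed.

Lemma dist_half_le (e X Y Z : R) :
  `|X - Y| < e / 2 -> `|Z - Y| < e / 2 -> `|X - Z| <= e.
Proof.
move=> h3; rewrite distrC => h4; rewrite (le_trans (ler_distD Y _ _)) //.
by rewrite (splitr e) ltW // ltrD.
Qed.

(** The second difference is symmetric in [u] and [v], so the two mixed derivatives take a common
    value at points arbitrarily close to [x]; continuity does the rest. *)
Lemma schwarz V (U : set V) (f : V -> R^o) (x u v : V) : open U -> U x ->
  Ck 2 U f ->
  'D_v (fun y => 'D_u f y) x = 'D_u (fun y => 'D_v f y) x.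
Proof.
move=> oU Ux [df hf].
have c2 a b : {for x, continuous (fun y => 'D_b (fun y => 'D_a f y) y)}.
  by have [_ /(_ b)] := hf a; exact.
apply/eqP; rewrite -subr_eq0 -normr_le0; apply/ler_addgt0Pr => e e0.
rewrite add0r.
have e2 : 0 < e / 2 by rewrite divr_gt0.
have near1 a b : \forall y \near x, `|'D_b (fun y => 'D_a f y) x - 'D_b (fun y => 'D_a f y) y| < e / 2.
  by have /cvgrPdist_lt := c2 a b; apply.
have [h1 h10 H1] := near0_scale_pos u v (filterI (open_near oU Ux) (near1 u v)).
have [h2 h20 H2] := near0_scale_pos v u (filterI (open_near oU Ux) (near1 v u)).
pose h := Num.min h1 h2.
have h0 : 0 < h by rewrite lt_min h10.
have r1 a : 0 <= a <= h -> 0 <= a <= h1.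
  by move=> /andP[-> /=]; rewrite le_min => /andP[].
have r2 a : 0 <= a <= h -> 0 <= a <= h2.
  by move=> /andP[-> /=]; rewrite le_min => /andP[].
have [|a [b [ah bh E1]]] := @second_difference V f x u v h h0.
  move=> a b /r1 ah /r1 bh; have [Uy _] := H1 a b ah bh.
  by split; [exact: df|have [+ _] := hf u; apply].
have [|a' [b' [ah' bh' E2]]] := @second_difference V f x v u h h0.
  move=> a' b' /r2 ah' /r2 bh'; have [Uy _] := H2 a' b' ah' bh'.
  by split; [exact: df|have [+ _] := hf v; apply].
have [_ K1] := H1 a b (r1 _ ah) (r1 _ bh).
have [_ K2] := H2 a' b' (r2 _ ah') (r2 _ bh').
have E : 'D_v (fun y => 'D_u f y) (x + a *: u + b *: v)
   = 'D_u (fun y => 'D_v f y) (x + a' *: v + b' *: u).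
  have hh0 : h * h != 0 by rewrite mulf_neq0 // gt_eqF.
  apply: (mulfI hh0).
  have eA : x + h *: v + h *: u = x + h *: u + h *: v by exact: addrAC.
  apply: (etrans (esym E1)); apply: (etrans _ E2).
  by rewrite eA; congr (_ + _); exact: addrAC.
by rewrite E in K1; exact: dist_half_le K1 K2.
Qed.

End MeanValue.

(** * The Frobenius theorem and the Poincare lemma *)

Section MatrixNorm.
Variable R : realType.

(** The maximum norm is not submultiplicative; the inner dimension that appears here is the origin
    of the factors [m%:R] in the Euler scheme. *)
Lemma mx_norm_mulmx m n p (A : 'M[R]_(m, n)) (B : 'M[R]_(n, p)) :
  `|A *m B| <= n%:R * `|A| * `|B|.
Proof.
apply: mx_norm_le; first by rewrite !mulr_ge0 ?ler0n ?normr_ge0.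
move=> i j; rewrite mxE; apply: le_trans (ler_norm_sum _ _ _) _.
apply: (@le_trans _ _ (\sum_(l < n) `|A| * `|B|)).
  apply: ler_sum => l _; rewrite normrM; apply: ler_pM => //; exact: mx_norm_entry.
by rewrite sumr_const card_ord -mulrA mulr_natl.
Qed.

Lemma mx_norm1 m : `|1%:M : 'M[R]_m| <= 1.
Proof.
apply: mx_norm_le => // i j; rewrite mxE; case: (i == j); rewrite ?normr1 //.
by rewrite normr0.
Qed.

(** For functions without a formula to differentiate: the limit of the Euler products, and exp(- 1 /
    t) at 0. *)
Lemma quadratic_has_diff (V W : normedModType R) (f : V -> W) x (L : V -> W)
    (C r : R) : 0 < r -> linear L -> continuous L ->
  (forall v, `|v| < r -> `|f (x + v) - f x - L v| <= C * (`|v| * `|v|)) ->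
  has_diff f x L.
Proof.
move=> r0 lL cL H.
pose lM := GRing.isLinear.Build _ _ _ _ _ lL.
pose F : {linear V -> W} := HB.pack L lM.
have e : f \o shift x = cst (f x) + (F : V -> W) +o_ 0 id.
  apply/eqaddoP => eps eps0.
  have K0 : 0 < `|C| + 1 by apply: ltr_wpDl.
  apply/nbhs_ballP; exists (Num.min r (eps / (`|C| + 1))).
    by rewrite /= lt_min r0 divr_gt0.
  move=> v; rewrite -ball_normE /= sub0r normrN lt_min => /andP[vr ve].
  rewrite !fctE /= opprD addrA [v + x]addrC.
  apply: le_trans (H v vr) _; rewrite mulrA; apply: ler_wpM2r => //.
  apply: (@le_trans _ _ ((`|C| + 1) * `|v|)).
    apply: ler_wpM2r => //; apply: le_trans (ler_norm C) _; lra.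
  by rewrite mulrC -ler_pdivlMr // ltW.
have cF : continuous (F : V -> W) by exact: cL.
have dE := diff_unique cF e.
have df : differentiable f x by apply/diff_locallyP; rewrite dE; split.
by split=> // v; rewrite deriveE // dE.
Qed.

End MatrixNorm.

(** Lets the majorant 4 / (p + 1) stand in for the geometric decay by factors 1/4 in [GN_cauchy]. *)
Lemma quarter_inv (R : realType) (p : nat) :
  (p.+1%:R : R)^-1 / 4 <= p.+2%:R^-1.
Proof.
rewrite -invfM lef_pV2 ?posrE ?mulr_gt0 ?ltr0n //.
by rewrite -natrM ler_nat; lia.
Qed.

(** * Euler products for a flat linear system dF = a F *)

Section EulerScheme.
Variables (R : realType) (n m : nat).
(** [a x v] is the coefficient form at [x] on the vector [v], and [b x u v] its derivative in [x]
    along [u]. Then [a_flat] is the integrability condition of dF = a F, and [cr] makes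
    multiplication by [a y x], for [y] on the ray to [x], a contraction by 1/4. *)
Variables (a : 'cV[R]_n -> 'cV[R]_n -> 'M[R]_m).
Variables (b : 'cV[R]_n -> 'cV[R]_n -> 'cV[R]_n -> 'M[R]_m).
Variables (c r : R).
Hypothesis (c0 : 0 <= c) (r1 : r <= 1) (cr : m%:R * c * r <= 1 / 4).
Hypothesis a_lin : forall x, linear (a x).
Hypothesis a_diag : forall (t : R) (x : 'cV[R]_n), 0 <= t <= 1 -> `|x| < r ->
  has_diff (fun y => a (t *: y) y) x (fun v => a (t *: x) v + t *: b (t *: x) v x).
Hypothesis a_bound : forall (x v : 'cV[R]_n), `|x| < r -> `|a x v| <= c * `|v|.
Hypothesis b_bound : forall (x u v : 'cV[R]_n), `|x| < r -> `|b x u v| <= c * (`|u| * `|v|).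
Hypothesis a_taylor : forall (x u v : 'cV[R]_n), `|x| < r -> `|x + u| < r ->
  `|a (x + u) v - a x v - b x u v| <= c * (`|u| * `|u| * `|v|).
Hypothesis b_linl : forall (x v : 'cV[R]_n) (h : R) (u : 'cV[R]_n),
  `|x| < r -> b x (h *: u) v = h *: b x u v.
Hypothesis a_flat : forall (x u v : 'cV[R]_n), `|x| < r ->
  b x u v - b x v u = a x u *m a x v - a x v *m a x u.

(** [K] bounds multiplication by [a x v] per unit of [v]. In [D] the factor 2 bounds the Euler
    product, and 2 + 3 K = 1 + 1 + 2 K + K collects the four second order terms of
    [euler_err_rec]. *)
Let K := m%:R * c.
Let D := 2 * K * (2 + 3 * K).

Let K0 : 0 <= K. Proof. by rewrite mulr_ge0. Qed.
Let D0 : 0 <= D.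
Proof. by rewrite /D !mulr_ge0 // addr_ge0 // mulr_ge0. Qed.

(* [euler h j x] approximates at time [j h] the solution along the ray
   [t |-> t x]; [deuler h j x] is its derivative in [x]. *)
Fixpoint euler (h : R) (j : nat) (x : 'cV[R]_n) : 'M[R]_m :=
  if j is j'.+1 then
    euler h j' x + h *: (a ((j'%:R * h) *: x) x *m euler h j' x)
  else 1%:M.

Fixpoint deuler (h : R) (j : nat) (x v : 'cV[R]_n) : 'M[R]_m :=
  if j is j'.+1 then
    deuler h j' x v + h *: (a ((j'%:R * h) *: x) x *m deuler h j' x v
      + (a ((j'%:R * h) *: x) v + (j'%:R * h) *: b ((j'%:R * h) *: x) v x)
        *m euler h j' x)
  else 0.

Section Steps.
Variables (N : nat).
Hypothesis N0 : (0 < N)%N.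
Let h : R := N%:R^-1.

Let h0 : 0 < h. Proof. by rewrite invr_gt0 ltr0n. Qed.

Let jh j : (j <= N)%N -> 0 <= j%:R * h <= 1.
Proof.
move=> jN; rewrite mulr_ge0 ?ler0n ?(ltW h0) //=.
by rewrite ler_pdivrMr ?ltr0n // mul1r ler_nat.
Qed.

Let node j (x : 'cV[R]_n) : (j <= N)%N -> `|x| < r -> `|(j%:R * h) *: x| < r.
Proof.
move=> /jh /andP[j0 j1] xr; rewrite normrZ ger0_norm //.
by apply: le_lt_trans xr; rewrite -[leRHS]mul1r ler_wpM2r.
Qed.

Lemma euler_has_diff j (x : 'cV[R]_n) : (j <= N)%N -> `|x| < r ->
  @has_diff R 'cV[R]_n 'M[R]_m (euler h j) x (deuler h j x).
Proof.
move=> + xr; elim: j => [|j IH] jN /=; first exact: has_diff_cst.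
have {}IH := IH (ltnW jN).
apply: has_diffD => //.
have hA := @has_diff_mulmx R 'cV[R]_n m m m _ _ x _ _
  (a_diag (jh (ltnW jN)) xr) IH.
apply: has_diff_eq (has_diffZ (has_diff_cst (h : R^o) x) hA) _ => v.
by rewrite scale0r addr0.
Qed.

Lemma euler_step_bound j (x : 'cV[R]_n) (g : 'M[R]_m) : (j <= N)%N -> `|x| < r ->
  `|a ((j%:R * h) *: x) x *m g| <= 1 / 4 * `|g|.
Proof.
move=> jN xr; apply: le_trans (mx_norm_mulmx _ _) _.
apply: ler_wpM2r => //; apply: le_trans cr; rewrite -mulrA ler_wpM2l //.
apply: le_trans (a_bound _ (node jN xr)) _; rewrite ler_wpM2l //; exact: ltW.
Qed.

Lemma euler_bound j (x : 'cV[R]_n) : (j <= N)%N -> `|x| < r -> `|euler h j x| <= 2.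
Proof.
move=> jN xr.
(* A bound growing with [j] is what the induction preserves: it never exceeds 2, so one step adds at
   most (h / 4) * 2 <= h. *)
suff H : `|euler h j x| <= 1 + j%:R * h.
  by apply: le_trans H _; have /andP[_] := jh jN; lra.
elim: j jN => [|j IH] jN /=; first by rewrite mul0r addr0; exact: mx_norm1.
have {}IH := IH (ltnW jN).
apply: le_trans (ler_normD _ _) _; rewrite normrZ (gtr0_norm h0).
have H1 := euler_step_bound (euler h j x) (ltnW jN) xr.
have /andP[_ j1] := jh (ltnW jN).
have H2 : h * `|a ((j%:R * h) *: x) x *m euler h j x| <= h * 1.
  rewrite ler_pM2l //; apply: le_trans H1 _; lra.
by rewrite -natr1 mulrDl; lra.
Qed.

(* Flatness is what makes [euler] an approximate solution in all directions [v],
   not only along the ray: the error is of order [h]. *)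
Definition euler_err j x v : 'M[R]_m :=
  deuler h j x v - (j%:R * h) *: (a ((j%:R * h) *: x) v *m euler h j x).

(* The second order terms cancel by [a_flat]. *)
Lemma euler_err_rec j (x v : 'cV[R]_n) : (j < N)%N -> `|x| < r ->
  let y := (j%:R * h) *: x in
  let B0 := a y v in let B1 := a (y + h *: x) v in
  euler_err j.+1 x v = euler_err j x v + h *: (a y x *m euler_err j x v)
    - h *: ((h *: b y x v
            + j.+1%:R *: (B1 - B0 - h *: b y x v)
            + (j%:R * h) *: ((B1 - B0) *m a y x)
            + h *: (B1 *m a y x)) *m euler h j x).
Proof.
move=> jN xr y B0 B1; rewrite /euler_err /=.
have -> : (j.+1%:R * h) *: x = y + h *: x.
  by rewrite -natr1 mulrDl mul1r scalerDl.
rewrite -/y -/B0 -/B1.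
have yr : `|y| < r by exact: node (ltnW jN) xr.
have fl : b y v x = b y x v + (B0 *m a y x - a y x *m B0).
  by rewrite -(a_flat v x yr) addrC subrK.
rewrite {}fl; move: (deuler h j x v) (euler h j x) (b y x v) (a y x) (B0) (B1).
move=> dg g bb ax {}B0 {}B1.
rewrite !(mulmxDl, mulmxDr, mulNmx, mulmxN, =^~ scalemxAl, =^~ scalemxAr, scalerDr, scalerN, scalerBr, mulmxA, scalerA).
rewrite -natr1.
apply/matrixP => k l; rewrite !mxE.
ring.
Qed.

(** Each step contributes D h^2 |v| from the second order terms. The contraction applied to the
    previous error contributes at most half as much, because j h <= 1, so the constant 2 D absorbs
    both. *)
Lemma euler_err_bound j (x v : 'cV[R]_n) : (j <= N)%N -> `|x| < r ->
  `|euler_err j x v| <= 2 * D * j%:R * h * h * `|v|.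
Proof.
move=> + xr; elim: j => [|j IH] jN.
  by rewrite /euler_err /= !mul0r scale0r subrr normr0 mulr0 !mul0r.
rewrite euler_err_rec //; set y := (j%:R * h) *: x.
set E := euler_err j x v; set g := euler h j x.
have {}IH : `|E| <= 2 * D * j%:R * h * h * `|v| := IH (ltnW jN).
have yr : `|y| < r by exact: node (ltnW jN) xr.
have y'E : y + h *: x = (j.+1%:R * h) *: x.
  by rewrite -natr1 mulrDl mul1r scalerDl.
have y'r : `|y + h *: x| < r by rewrite y'E; exact: node jN xr.
have g2 : `|g| <= 2 := euler_bound (ltnW jN) xr.
have st : `|a y x *m E| <= 1 / 4 * `|E| := euler_step_bound E (ltnW jN) xr.
have x1 : `|x| <= 1 by exact: le_trans (ltW xr) r1.
have v0 := normr_ge0 v; have x0 := normr_ge0 x.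
set B0 := a y v; set B1 := a (y + h *: x) v; set bb := b y x v.
have hbb : `|bb| <= c * `|v|.
  apply: le_trans (b_bound _ _ yr) _; rewrite ler_wpM2l //.
  by rewrite -[leRHS]mul1r ler_wpM2r.
have hax : `|a y x| <= c.
  apply: le_trans (a_bound _ yr) _; rewrite -[leRHS]mulr1 ler_wpM2l //.
have hB1 : `|B1| <= c * `|v| := a_bound _ y'r.
set rho := B1 - B0 - h *: bb.
have hrho : `|rho| <= c * `|v| * (h * h).
  rewrite /rho /bb -(b_linl _ _ _ yr); apply: le_trans (a_taylor _ yr y'r) _.
  rewrite normrZ (gtr0_norm h0) -[leRHS]mulrA ler_wpM2l // mulrC ler_wpM2l //.
  rewrite mulrACA -[leRHS]mulr1 ler_wpM2l ?mulr_ge0 ?(ltW h0) //.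
  by rewrite mulr_ile1.
have hB10 : `|B1 - B0| <= 2 * c * `|v| * h.
  have -> : B1 - B0 = rho + h *: bb by rewrite subrK.
  apply: le_trans (ler_normD _ _) _; rewrite normrZ (gtr0_norm h0).
  have h1 : h <= 1 by rewrite invf_le1 ?ltr0n // ler1n.
  have := ler_wpM2l (ltW h0) hbb.
  have : c * `|v| * (h * h) <= c * `|v| * h.
    by rewrite ler_wpM2l ?mulr_ge0 // -[leRHS]mulr1 ler_wpM2l // ltW.
  have := hrho; nra.
have /andP[j0 j1] := jh (ltnW jN); have /andP[j0' j1'] := jh jN.
set S := (X in X *m g).
have hS : `|S| <= h * (c * `|v| * (2 + 3 * K)).
  rewrite /S; apply: le_trans (ler_normD _ _) _.
  apply: le_trans (lerD (ler_normD _ _) (lexx _)) _.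
  apply: le_trans (lerD (lerD (ler_normD _ _) (lexx _)) (lexx _)) _.
  rewrite !normrZ (gtr0_norm h0) (ger0_norm (ler0n _ j)) (ger0_norm (ler0n _ j.+1)).
  have e1 := ler_wpM2l (ltW h0) hbb.
  have e2 : j.+1%:R * `|rho| <= h * (c * `|v|).
    apply: le_trans (ler_wpM2l (ler0n _ _) hrho) _.
    have -> : j.+1%:R * (c * `|v| * (h * h)) = (h * (c * `|v|)) * (j.+1%:R * h) by ring.
    by rewrite -[leRHS]mulr1 ler_wpM2l // !mulr_ge0 // ltW.
  have e3 : j%:R * h * `|(B1 - B0) *m a y x| <= h * (c * `|v| * (2 * K)).
    apply: (@le_trans _ _ (1 * `|(B1 - B0) *m a y x|)); first by rewrite ler_wpM2r.
    rewrite mul1r; apply: le_trans (mx_norm_mulmx _ _) _.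
    apply: (@le_trans _ _ (m%:R * (2 * c * `|v| * h) * c)).
      apply: ler_pM => //; first by rewrite mulr_ge0.
      by rewrite ler_wpM2l.
    by rewrite /K; lra.
  have e4 : h * `|B1 *m a y x| <= h * (c * `|v| * K).
    rewrite ler_wpM2l ?(ltW h0) //; apply: le_trans (mx_norm_mulmx _ _) _.
    apply: (@le_trans _ _ (m%:R * (c * `|v|) * c)).
      apply: ler_pM => //; first by rewrite mulr_ge0.
      by rewrite ler_wpM2l.
    by rewrite /K; lra.
  apply: le_trans (lerD (lerD (lerD e1 e2) e3) e4) _; lra.
have hSg : `|h *: (S *m g)| <= D * h * h * `|v|.
  rewrite normrZ (gtr0_norm h0).
  apply: (@le_trans _ _ (h * (m%:R * (h * (c * `|v| * (2 + 3 * K))) * 2))).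
    rewrite ler_wpM2l ?(ltW h0) //; apply: le_trans (mx_norm_mulmx _ _) _.
    apply: ler_pM => //; first by rewrite mulr_ge0.
    by rewrite ler_wpM2l.
  by rewrite /D /K; lra.
have Dh : 0 <= D * h := mulr_ge0 D0 (ltW h0).
apply: le_trans (ler_normB _ _) _.
apply: le_trans (lerD (ler_normD _ _) (lexx _)) _; rewrite normrZ (gtr0_norm h0).
have e5 : h * `|a y x *m E| <= h * (1 / 4 * (2 * D * h * `|v|)).
  rewrite ler_wpM2l ?(ltW h0) //; apply: le_trans st _; rewrite ler_wpM2l ?divr_ge0 //.
  apply: le_trans IH _.
  have -> : 2 * D * j%:R * h * h * `|v| = 2 * D * h * `|v| * (j%:R * h) by ring.
  rewrite -[leRHS]mulr1; apply: ler_wpM2l => //.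
  by rewrite -mulrA -mulrA mulr_ge0 // mulrA mulr_ge0.
have hhv : 0 <= D * h * h * `|v|.
  by apply: mulr_ge0 => //; apply: mulr_ge0 => //; exact: ltW.
apply: le_trans (lerD (lerD IH e5) hSg) _; rewrite -natr1; lra.
Qed.

End Steps.

Let GN (N : nat) (x : 'cV[R]_n) : 'M[R]_m := euler N.+1%:R^-1 N.+1 x.
Let dGN (N : nat) (x v : 'cV[R]_n) : 'M[R]_m := deuler N.+1%:R^-1 N.+1 x v.

Let D2 : 0 <= 2 * D. Proof. by apply: mulr_ge0 => //. Qed.

Let invN (N : nat) : 0 <= (N.+1%:R : R)^-1. Proof. by rewrite invr_ge0. Qed.

Let GN_diff N (x : 'cV[R]_n) : `|x| < r ->
  @has_diff R 'cV[R]_n 'M[R]_m (GN N) x (dGN N x).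
Proof. exact: (@euler_has_diff N.+1 isT N.+1 x (leqnn _)). Qed.

Let GN_bound N (x : 'cV[R]_n) : `|x| < r -> `|GN N x| <= 2.
Proof. exact: (@euler_bound N.+1 isT N.+1 x (leqnn _)). Qed.

Let dGN_approx N (x v : 'cV[R]_n) : `|x| < r ->
  `|dGN N x v - a x v *m GN N x| <= 2 * D * N.+1%:R^-1 * `|v|.
Proof.
move=> xr; have N0 : (N.+1%:R : R) != 0 by rewrite pnatr_eq0.
have := @euler_err_bound N.+1 isT N.+1 x v (leqnn _) xr.
rewrite /euler_err mulfV // !scale1r.
by rewrite -[2 * D * _ * _]mulrA mulfV // mulr1.
Qed.

Let dGN_bound N (x v : 'cV[R]_n) : `|x| < r ->
  `|dGN N x v| <= (2 * K + 2 * D) * `|v|.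
Proof.
move=> xr; rewrite -(subrK (a x v *m GN N x) (dGN N x v)).
apply: le_trans (ler_normD _ _) _.
have e1 : `|dGN N x v - a x v *m GN N x| <= 2 * D * `|v|.
  apply: le_trans (dGN_approx N v xr) _; rewrite ler_wpM2r //.
  by rewrite -[leRHS]mulr1 (ler_wpM2l D2) // invf_le1 ?ltr0n // ler1n.
have e2 : `|a x v *m GN N x| <= 2 * K * `|v|.
  apply: le_trans (mx_norm_mulmx _ _) _.
  have -> : 2 * K * `|v| = m%:R * (c * `|v|) * 2 by rewrite /K; ring.
  apply: ler_pM => //; [by rewrite mulr_ge0| |exact: GN_bound].
  by rewrite ler_wpM2l // a_bound.
by apply: le_trans (lerD e1 e2) _; lra.
Qed.

Let a0 x : a x 0 = 0.
Proof. exact: (@linear_fun0 R 'cV[R]_n 'M[R]_m (a x) (a_lin x)). Qed.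

Let GN0 N : GN N 0 = 1%:M.
Proof.
rewrite /GN; move: N.+1 (N.+1%:R^-1) => j h; elim: j => [//|j IH] /=.
by rewrite a0 mul0mx scaler0 addr0.
Qed.

(** Two Euler products agree at 0 and solve dF = a F up to [eps]. By the mean value inequality along
    the ray, a bound d on their difference over the ball improves to d / 4 + eps. Starting from d =
    4 and iterating, only 2 eps remains. *)
Let GN_cauchy N M (x : 'cV[R]_n) : `|x| < r ->
  `|GN N x - GN M x| <= 2 * (2 * D * (N.+1%:R^-1 + M.+1%:R^-1)).
Proof.
set eps := 2 * D * _.
have eps0 : 0 <= eps by apply: mulr_ge0 => //; exact: addr_ge0.
suff H p (y : 'cV[R]_n) : `|y| < r -> `|GN N y - GN M y| <= 4 / p.+1%:R + 2 * eps.
  move=> xr; apply/ler_addgt0Pr => e e0.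
  have [p hp] : exists p : nat, 4 / e < p%:R.
    by exists (Num.truncn (4 / e)).+1; exact: truncnS_gt.
  apply: le_trans (H p x xr) _; rewrite addrC lerD2l ler_pdivrMr ?ltr0n //.
  rewrite mulrC -ler_pdivrMr // ltW //; apply: lt_trans hp _; by rewrite ltr_nat.
elim: p y => [|p IH] y yr.
  rewrite divr1; apply: le_trans (ler_normB _ _) _.
  by have := GN_bound N yr; have := GN_bound M yr; lra.
have y1 : `|y| <= 1 by exact: le_trans (ltW yr) r1.
have tr t : 0 <= t <= 1 -> `|0 + t *: y| < r.
  move=> /andP[t0 t1]; rewrite add0r normrZ ger0_norm //.
  by apply: le_lt_trans yr; rewrite -[leRHS]mul1r ler_wpM2r.
have hd t : 0 <= t <= 1 -> @has_diff R 'cV[R]_n 'M[R]_m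
    (fun z => GN N z - GN M z) (0 + t *: y)
    (fun v => dGN N (0 + t *: y) v - dGN M (0 + t *: y) v).
  by move=> /tr h; apply: has_diffB; exact: GN_diff.
have p0 : 0 <= 4 / p.+1%:R :> R by rewrite divr_ge0.
have B0 : 0 <= 1 / 4 * (4 / p.+1%:R + 2 * eps) + eps.
  apply: addr_ge0 => //; apply: mulr_ge0; first by rewrite divr_ge0.
  by apply: addr_ge0 => //; apply: mulr_ge0.
have := @mean_value_ineq R 'cV[R]_n m m (fun z => GN N z - GN M z) 0 y _ B0.
rewrite add0r !GN0 subrr subr0 => H.
apply: (@le_trans _ _ (1 / 4 * (4 / p.+1%:R + 2 * eps) + eps)).
  apply: H => t t01; first by have [] := hd t t01.
  have [_ ->] := hd t t01; have zr := tr t t01; set z := 0 + t *: y in zr *.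
  have -> : dGN N z y - dGN M z y = a z y *m (GN N z - GN M z)
     + ((dGN N z y - a z y *m GN N z) - (dGN M z y - a z y *m GN M z)).
    rewrite mulmxBr.
    move: (dGN N z y) (dGN M z y) (a z y *m GN N z) (a z y *m GN M z) => p1 p2 p3 p4.
    by apply/matrixP => i j; rewrite !mxE; ring.
  apply: le_trans (ler_normD _ _) _; apply: lerD.
    apply: le_trans (mx_norm_mulmx _ _) _; apply: ler_pM => //; last exact: IH.
      by rewrite mulr_ge0.
    apply: le_trans cr; rewrite -mulrA ler_wpM2l //.
    apply: le_trans (a_bound _ zr) _; rewrite ler_wpM2l //; exact: ltW.
  apply: le_trans (ler_normB _ _) _; rewrite /eps mulrDr.
  have w (l : nat) : 2 * D * l.+1%:R^-1 * `|y| <= 2 * D * l.+1%:R^-1.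
    by rewrite -[leRHS]mulr1 ler_wpM2l //; exact: mulr_ge0.
  by apply: lerD; [exact: le_trans (dGN_approx N y zr) (w N)
                  |exact: le_trans (dGN_approx M y zr) (w M)].
move: eps0 (quarter_inv R p).
by move: (p.+1%:R^-1) (p.+2%:R^-1) (eps) => s1 s2 s3; lra.
Qed.

Let G (x : 'cV[R]_n) : 'M[R]_m := lim (GN N x @[N --> \oo]).

Let GN_cvg (x : 'cV[R]_n) (e : R) : `|x| < r -> 0 < e ->
  \forall N \near \oo, `|G x - GN N x| < e.
Proof.
move=> xr e0; have : cvg (GN N x @[N --> \oo]).
  apply/cauchy_cvgP/cauchy_exP => d d0.
  have [p hp] : exists p : nat, 8 * D / d < p%:R.
    by exists (Num.truncn (8 * D / d)).+1; exact: truncnS_gt.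
  exists (GN p x); exists p => // M /= pM; rewrite -ball_normE /=.
  apply: le_lt_trans (GN_cauchy p M xr) _.
  have pp : (p.+1%:R : R) > 0 by rewrite ltr0n.
  have hM : (M.+1%:R : R)^-1 <= p.+1%:R^-1.
    by rewrite lef_pV2 ?posrE ?ltr0n // ler_nat ltnS.
  have h1 : 8 * D * p.+1%:R^-1 < d.
    rewrite ltr_pdivrMr // [ltRHS]mulrC -ltr_pdivrMr //; apply: lt_trans hp _.
    by rewrite ltr_nat.
  move: (ler_wpM2l D0 hM) h1.
  by move: (D) (p.+1%:R^-1) (M.+1%:R^-1) => q1 q2 q3; lra.
by move=> /cvgrPdist_lt; apply.
Qed.

(** The estimate is proved for the Euler products with a constant independent of [N], up to an error
    [e] that is then sent to 0. Here 6 K = m * 3 c * 2 comes from the variation of [a], and K (2 K +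
    2 D) from the Lipschitz bound on [GN N]. *)
Let G_quadratic (x v : 'cV[R]_n) : `|x| < r -> `|x + v| < r ->
  `|G (x + v) - G x - a x v *m G x|
    <= (6 * K + K * (2 * K + 2 * D)) * (`|v| * `|v|).
Proof.
move=> xr yr; apply/ler_addgt0Pr => e e0; have v0 := normr_ge0 v.
have v2 : `|v| <= 2.
  have -> : v = (x + v) - x by rewrite addrAC subrr add0r.
  by apply: le_trans (ler_normB _ _) _; move: xr yr r1; lra.
have e4 : 0 < e / 4 by rewrite divr_gt0.
(* The error [e] is spent in four quarters: two on [G - GN] at the endpoints, one on the defect of
   [GN] as a solution, and one on [a x v] times [G x - GN N x], for which [e'] is chosen. *)
pose e' := e / (4 * (K * `|v| + 1)).
have Kv : 0 <= K * `|v| by rewrite mulr_ge0.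
have e'0 : 0 < e' by rewrite divr_gt0 // mulr_gt0 // ltr_wpDl.
(* Since |v| <= 2, the defect 2 D |v| / (N + 1) is at most e / 4 as soon as 16 D / e <= N + 1. *)
have [p hp] : exists p : nat, 16 * D / e < p%:R.
  by exists (Num.truncn (16 * D / e)).+1; exact: truncnS_gt.
have [N [[[h1 h2] h3] h4]] : exists N, ((`|G (x + v) - GN N (x + v)| < e / 4 /\
   `|G x - GN N x| < e / 4) /\ `|G x - GN N x| < e') /\ (p <= N)%N.
  apply: (@filter_ex _ \oo); apply: filterI; last by exists p.
  apply: filterI; last exact: GN_cvg.
  by apply: filterI; exact: GN_cvg.
have h5 : 2 * D * N.+1%:R^-1 * `|v| <= e / 4.
  apply: (@le_trans _ _ (4 * D * N.+1%:R^-1)).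
    have -> : 4 * D * N.+1%:R^-1 = 2 * D * N.+1%:R^-1 * 2.
      by move: (D) (N.+1%:R^-1) => q1 q2; ring.
    by rewrite ler_wpM2l //; exact: mulr_ge0.
  have pN : (N.+1%:R : R) > 0 by rewrite ltr0n.
  rewrite ler_pdivrMr //.
  have : 16 * D / e < N.+1%:R by apply: lt_trans hp _; rewrite ltr_nat.
  rewrite ltr_pdivrMr // => /ltW.
  by move: (D) (N.+1%:R) => q1 q2; lra.
have seg t : 0 <= t <= 1 -> `|x + t *: v| < r.
  move=> t01; rewrite -[_ + _]subr0; apply: (ball_segment (u := 0)) => //; by rewrite subr0.
have Lip t : 0 <= t <= 1 -> `|GN N (x + t *: v) - GN N x| <= (2 * K + 2 * D) * `|v|.
  move=> t01; have /andP[t0 t1] := t01.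
  have ss s : 0 <= s <= 1 -> `|x + s *: (t *: v)| < r.
    move=> /andP[s0 s1]; rewrite scalerA; apply: seg.
    by rewrite mulr_ge0 // mulr_ile1.
  have C0 : 0 <= (2 * K + 2 * D) * `|v|.
    by rewrite mulr_ge0 // addr_ge0 // mulr_ge0.
  apply: (@mean_value_ineq R 'cV[R]_n m m (GN N) x (t *: v) _ C0).
    by move=> s /ss h; have [] := GN_diff N h.
  move=> s /ss h; have [_ ->] := GN_diff N h.
  apply: le_trans (dGN_bound N _ h) _.
  rewrite normrZ ger0_norm // ler_wpM2l //; first by rewrite addr_ge0 // mulr_ge0.
  by rewrite -[leRHS]mul1r ler_wpM2r.
(* With the linear part at [x] removed, the increment of [f] is the first order remainder, and its
   derivative is small. *)
pose f z := GN N z - a x (z - x) *m GN N x.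
have hf t : 0 <= t <= 1 -> @has_diff R 'cV[R]_n 'M[R]_m f (x + t *: v)
   (fun w => dGN N (x + t *: v) w - a x w *m GN N x).
  move=> t01; apply: has_diffB; first exact: GN_diff (seg t t01).
  have lL : linear (fun w : 'cV[R]_n => a x w *m GN N x).
    by move=> s w1 w2; rewrite a_lin mulmxDl -scalemxAl.
  apply: (has_diff_lin lL (linear_mx_continuous lL)).
  apply: has_diff_eq (has_diffB (has_diff_id _) (has_diff_cst x _)) _ => w.
  by rewrite subr0.
have Q0 : 0 <= (6 * K + K * (2 * K + 2 * D)) * (`|v| * `|v|) + e / 4.
  rewrite addr_ge0 ?(ltW e4) // mulr_ge0 ?mulr_ge0 // addr_ge0 ?mulr_ge0 //.
  by rewrite addr_ge0 // mulr_ge0.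
have main := @mean_value_ineq R 'cV[R]_n m m f x v _ Q0.
have {}main : `|f (x + v) - f x| <= (6 * K + K * (2 * K + 2 * D)) * (`|v| * `|v|) + e / 4.
  apply: main => t t01; first by have [] := hf t t01.
  have [_ ->] := hf t t01; have zr := seg t t01; set z := x + t *: v in zr *.
  have -> : dGN N z v - a x v *m GN N x = (a z v - a x v) *m GN N z
    + a x v *m (GN N z - GN N x) + (dGN N z v - a z v *m GN N z).
    rewrite mulmxBr mulmxBl.
    move: (dGN N z v) (a z v *m GN N z) (a x v *m GN N z) (a x v *m GN N x) => p1 p2 p3 p4.
    by apply/matrixP => i j; rewrite !mxE; ring.
  apply: le_trans (ler_normD _ _) _; apply: lerD; last first.
    by apply: le_trans (dGN_approx N v zr) _.
  apply: le_trans (ler_normD _ _) _; rewrite mulrDl; apply: lerD.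
    apply: le_trans (mx_norm_mulmx _ _) _.
    have azx : `|a z v - a x v| <= 3 * c * (`|v| * `|v|).
      have /andP[t0 t1] := t01.
      have tv : `|t *: v| <= `|v|.
        by rewrite normrZ ger0_norm // -[leRHS]mul1r ler_wpM2r.
      rewrite -(subrK (b x (t *: v) v) (a z v - a x v)).
      apply: le_trans (ler_normD _ _) _.
      have q1 := a_taylor v xr zr; have q2 := b_bound (t *: v) v xr.
      have q3 : c * (`|t *: v| * `|v|) <= c * (`|v| * `|v|).
        by rewrite ler_wpM2l // ler_wpM2r.
      have q4 : c * (`|t *: v| * `|t *: v| * `|v|) <= c * (2 * (`|v| * `|v|)).
        rewrite ler_wpM2l //; apply: (@le_trans _ _ (`|v| * `|v| * `|v|)).
          by rewrite ler_wpM2r // ler_pM.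
        by rewrite mulrC ler_wpM2r // mulr_ge0.
      apply: le_trans (lerD (le_trans q1 q4) (le_trans q2 q3)) _; lra.
    apply: (@le_trans _ _ (m%:R * (3 * c * (`|v| * `|v|)) * 2)).
      apply: ler_pM => //; [by rewrite mulr_ge0| |exact: GN_bound].
      by rewrite ler_wpM2l.
    by rewrite /K; lra.
  apply: le_trans (mx_norm_mulmx _ _) _.
  have -> : K * (2 * K + 2 * D) * (`|v| * `|v|)
    = m%:R * (c * `|v|) * ((2 * K + 2 * D) * `|v|) by rewrite /K; ring.
  apply: ler_pM => //; [by rewrite mulr_ge0| |exact: Lip].
  by rewrite ler_wpM2l // a_bound.
have Gsplit : G (x + v) - G x - a x v *m G x = (f (x + v) - f x)
   + ((G (x + v) - GN N (x + v)) - (G x - GN N x) - a x v *m (G x - GN N x)).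
  rewrite /f subrr a0 mul0mx subr0 mulmxBr [x + v - x]addrAC subrr add0r.
  move: (G _) (G x) (GN N _) (GN N x) (a x v *m _) (a x v *m _) => p1 p2 p3 p4 p5 p6.
  by apply/matrixP => i j; rewrite !mxE; ring.
rewrite Gsplit; apply: le_trans (ler_normD _ _) _.
have h6 : `|a x v *m (G x - GN N x)| <= e / 4.
  apply: le_trans (mx_norm_mulmx _ _) _.
  apply: (@le_trans _ _ (K * `|v| * e')).
    apply: ler_pM => //; [by rewrite mulr_ge0| |exact: ltW].
    by rewrite /K -mulrA ler_wpM2l // a_bound.
  have e'E : e' * (4 * (K * `|v| + 1)) = e.
    by rewrite divfK // mulf_neq0 // gt_eqF // ltr_wpDl.
  by rewrite -e'E; move: e'0 Kv; move: (K * _) => q; lra.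
have h7 := ler_normB (G (x + v) - GN N (x + v)) (G x - GN N x).
have h8 := ler_normB (G (x + v) - GN N (x + v) - (G x - GN N x)) (a x v *m (G x - GN N x)).
by move: main h1 h2 h6 h7 h8; lra.
Qed.

Lemma euler_limit : exists F : 'cV[R]_n -> 'M[R]_m, F 0 = 1%:M /\
  forall x : 'cV[R]_n, `|x| < r -> has_diff F x (fun v => a x v *m F x).
Proof.
exists G; split=> [|x xr].
  rewrite /G; have -> : (fun N => GN N 0) = fun=> 1%:M by apply/funext => N; exact: GN0.
  exact: lim_cst.
have lL : linear (fun v : 'cV[R]_n => a x v *m G x).
  by move=> s w1 w2; rewrite a_lin mulmxDl -scalemxAl.
have rx : 0 < r - `|x| by rewrite subr_gt0.
apply: (quadratic_has_diff rx lL (linear_mx_continuous lL)) => v hv.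
apply: G_quadratic => //; apply: le_lt_trans (ler_normD _ _) _.
by rewrite -ltrBrDl.
Qed.

End EulerScheme.

(** * Local solvability of flat linear systems *)

Section Frobenius.
Variable R : realType.

Lemma sum_scale_bound n m k (v : 'cV[R]_n) (F : 'I_n -> 'M[R]_(m, k)) (C : R) :
  (forall i, `|F i| <= C) -> `|\sum_i v i 0 *: F i| <= n%:R * (`|v| * C).
Proof.
move=> hF; apply: le_trans (ler_norm_sum _ _ _) _.
apply: (@le_trans _ _ (\sum_(i < n) `|v| * C)).
  apply: ler_sum => i _; rewrite normrZ; apply: ler_pM => //.
  exact: mx_norm_entry.
by rewrite sumr_const card_ord mulr_natl.
Qed.

Lemma derive_sum_delta n (W : normedModType R) (f : 'cV[R]_n -> W) x v :
  differentiable f x -> 'D_v f x = \sum_i v i 0 *: 'D_(delta_mx i 0) f x.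
Proof.
move=> df; rewrite {1}[v]cV_sum_delta diff_sumv //.
by apply: eq_bigr => i _; rewrite diffZv.
Qed.

Lemma near_bounded (V W : normedModType R) (U : set V) (f : V -> W) u0 :
  Cinfty U f -> U u0 -> \forall x \near u0, `|f x| <= `|f u0| + 1.
Proof.
move=> Cf U0; have /cvgrPdist_lt /(_ 1 ltr01) := Cinfty_cont Cf U0.
apply: filterS => x h; rewrite -(subrK (f u0) (f x)).
by apply: le_trans (ler_normD _ _) _; rewrite addrC lerD2l distrC ltW.
Qed.

Lemma near_ball_norm (V : normedModType R) (u0 : V) (P : set V) :
  (\forall x \near u0, P x) -> exists2 r : R, 0 < r &
    forall x, `|x - u0| < r -> P x.
Proof.
move=> /nbhs_ballP [r /= r0 h]; exists r => // x xr.
by apply: h; rewrite -ball_normE /= distrC.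
Qed.

Lemma ball_norm_near (V : normedModType R) (u0 : V) (r : R) : 0 < r ->
  \forall x \near u0, `|x - u0| < r.
Proof.
by move=> r0; apply/nbhs_ballP; exists r => // x; rewrite -ball_normE /= distrC.
Qed.

Lemma open_ball_norm (V : normedModType R) (u0 : V) (r : R) :
  open [set x | `|x - u0| < r].
Proof.
rewrite openE => x /= xr; have r0 : 0 < r - `|x - u0| by rewrite subr_gt0.
apply: filterS (ball_norm_near x r0) => y yx /=.
rewrite -(subrK x y) -addrA; apply: le_lt_trans (ler_normD _ _) _.
by rewrite -ltrBrDr.
Qed.

Lemma near_family_bounded (V W : normedModType R) (I : finType) (U : set V)
    (f : I -> V -> W) u0 : (forall i, Cinfty U (f i)) -> U u0 ->
  exists2 C : R, 0 <= C & \forall x \near u0, forall i, `|f i x| <= C.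
Proof.
move=> Cf U0; exists (\sum_i (`|f i u0| + 1)).
  by apply: sumr_ge0 => i _; rewrite addr_ge0.
apply: filter_forall => i; apply: filterS (near_bounded (Cf i) U0) => x hx.
apply: le_trans hx _; rewrite (bigD1 i) //= lerDl; apply: sumr_ge0 => j _.
by rewrite addr_ge0.
Qed.

Section Coefficients.
Variables (n m : nat) (U : set 'cV[R]_n) (u0 : 'cV[R]_n).
Variable A : 'I_n -> 'cV[R]_n -> 'M[R]_m.
Hypotheses (oU : open U) (U0 : U u0) (CA : forall i, Cinfty U (A i)).

Let dlt (i : 'I_n) : 'cV[R]_n := delta_mx i 0.

Let uniform_bound : exists2 C : R, 0 <= C & exists2 r : R, 0 < r &
  forall x, `|x - u0| < r -> U x /\
  forall i j k, `|A i x| <= C /\ `|'D_(dlt j) (A i) x| <= C /\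
    `|'D_(dlt k) (fun y => 'D_(dlt j) (A i) y) x| <= C.
Proof.
have CD i j := Cinfty_derive (dlt j) (CA i).
have [C1 C10 /near_ball_norm [r1 r10 h1]] := near_family_bounded CA U0.
have [C2 C20 /near_ball_norm [r2 r20 h2]] :=
  near_family_bounded (fun p : 'I_n * 'I_n => CD p.1 p.2) U0.
have [C3 C30 /near_ball_norm [r3 r30 h3]] :=
  near_family_bounded (fun p : 'I_n * 'I_n * 'I_n =>
    Cinfty_derive (dlt p.2) (CD p.1.1 p.1.2)) U0.
have [r4 r40 h4] := near_ball_norm (open_near oU U0).
exists (C1 + C2 + C3); first by rewrite !addr_ge0.
exists (Num.min (Num.min r1 r2) (Num.min r3 r4)).
  by rewrite !lt_min r10 r20 r30.
move=> x; rewrite !lt_min => /andP[/andP[x1 x2] /andP[x3 x4]].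
split; first exact: h4.
move=> i j k; split; last split.
- by apply: le_trans (h1 _ x1 i) _; rewrite -addrA lerDl addr_ge0.
- by apply: le_trans (h2 _ x2 (i, j)) _; rewrite addrAC lerDr addr_ge0.
- by apply: le_trans (h3 _ x3 (i, j, k)) _; rewrite lerDr addr_ge0.
Qed.

(** Translated by [u0], because the Euler scheme runs along rays from the origin. *)
Let a (x v : 'cV[R]_n) : 'M[R]_m := \sum_i v i 0 *: A i (u0 + x).
Let b (x u v : 'cV[R]_n) : 'M[R]_m := \sum_i v i 0 *: 'D_u (A i) (u0 + x).

Hypothesis A_flat : forall x i j, U x ->
  'D_(dlt i) (A j) x - 'D_(dlt j) (A i) x = A i x *m A j x - A j x *m A i x.

Let b_flat (x u v : 'cV[R]_n) : U (u0 + x) ->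
  b x u v - b x v u = a x u *m a x v - a x v *m a x u.
Proof.
move=> Ux; have dA i := Cinfty_diff (CA i) Ux.
have aE p q : a x p *m a x q = \sum_i \sum_j (p i 0 * q j 0) *:
    (A i (u0 + x) *m A j (u0 + x)).
  rewrite /a mulmx_suml; apply: eq_bigr => i _; rewrite mulmx_sumr.
  by apply: eq_bigr => j _; rewrite -scalemxAl -scalemxAr scalerA.
have bE p q : b x p q = \sum_i \sum_j (p i 0 * q j 0) *:
    'D_(dlt i) (A j) (u0 + x).
  rewrite exchange_big /=; apply: eq_bigr => j _.
  rewrite (derive_sum_delta _ (dA j)) scaler_sumr.
  by apply: eq_bigr => i _; rewrite scalerA mulrC.
rewrite aE bE [b x v u]bE [a x v *m _]aE.
rewrite [X in _ - X]exchange_big [X in _ = _ - X]exchange_big -!sumrB.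
apply: eq_bigr => i _; rewrite -!sumrB; apply: eq_bigr => j _.
by rewrite [v j 0 * _]mulrC -!scalerBr A_flat.
Qed.

Let a_diag t (x : 'cV[R]_n) : U (u0 + t *: x) ->
  has_diff (fun y => a (t *: y) y) x
    (fun v => a (t *: x) v + t *: b (t *: x) v x).
Proof.
move=> Ux.
have hA i : has_diff (fun y => A i (u0 + t *: y)) x
    (fun v => t *: 'D_v (A i) (u0 + t *: x)).
  have dA := Cinfty_diff (CA i) Ux.
  have hl : has_diff (fun y : 'cV[R]_n => u0 + t *: y) x (fun v => t *: v).
    apply: has_diff_eq (has_diffD (has_diff_cst u0 x)
      (has_diffZ (has_diff_cst (t : R^o) x) (has_diff_id x))) _ => v.
    by rewrite scale0r addr0 add0r.
  by apply: has_diff_eq (has_diff_comp hl (has_diffE dA)) _ => v; rewrite diffZv.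
have hi i := has_diffZ (has_diff_entry i 0 (has_diff_id x)) (hA i).
have hs := has_diff_fsum hi.
apply: has_diff_eq hs _ => v; rewrite big_split [RHS]addrC /=; congr (_ + _).
rewrite /b scaler_sumr; apply: eq_bigr => i _.
by rewrite !scalerA mulrC.
Qed.

(** Mean value inequality twice: for [A i] minus its linearization at [x], then for ['D_u (A i)].
    The factor n * n comes from expanding both directions in the standard basis. *)
Let taylor i (x u : 'cV[R]_n) (C : R) : 0 <= C ->
  (forall t, 0 <= t <= 1 -> U (x + t *: u) /\ forall j k,
     `|'D_(dlt k) (fun y => 'D_(dlt j) (A i) y) (x + t *: u)| <= C) ->
  `|A i (x + u) - A i x - 'D_u (A i) x| <= n%:R * n%:R * C * (`|u| * `|u|).
Proof.
move=> C0 h; set Q := _ * _ * C * _.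
have Q0 : 0 <= Q by rewrite !mulr_ge0.
have Ux : U x by have [] := h 0; rewrite ?lexx ?ler01 // scale0r addr0.
have dA y : U y -> differentiable (A i) y := Cinfty_diff (CA i).
pose D y := 'D_u (A i) y.
have CD : Cinfty U D by exact: Cinfty_derive.
have D_bound t : 0 <= t <= 1 -> `|'D_u D (x + t *: u)| <= Q.
  move=> /h [Ut hb].
  rewrite (derive_sum_delta _ (Cinfty_diff CD Ut)).
  rewrite /Q -!mulrA [C * _]mulrC -[_ * C]mulrA.
  have -> : n%:R * (n%:R * (`|u| * (`|u| * C))) = n%:R * (`|u| * (n%:R * (`|u| * C))).
    by ring.
  apply: sum_scale_bound => k.
  rewrite /D (near_eq_derive (g := fun y => \sum_j u j 0 *: 'D_(dlt j) (A i) y)); last first.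
    apply: filterS (open_near oU Ut) => y Uy.
    exact: derive_sum_delta (dA _ Uy).
  have hj j := has_diffZ (has_diff_cst (u j 0 : R^o) (x + t *: u))
    (has_diffE (Cinfty_diff (Cinfty_derive (dlt j) (CA i)) Ut)).
  have [_ ->] := has_diff_fsum hj.
  under eq_bigr => j _ do rewrite scale0r addr0.
  by apply: sum_scale_bound => j; exact: hb.
pose f y := A i y - 'D_(y - x) (A i) x.
have hf t : 0 <= t <= 1 -> has_diff f (x + t *: u)
    (fun w => 'D_w (A i) (x + t *: u) - 'D_w (A i) x).
  move=> /h [Ut _]; apply: has_diffB; first exact: has_diffE (dA _ Ut).
  have lL : linear (fun w => 'D_w (A i) x).
    by move=> s w1 w2; rewrite diffZD //; exact: dA.
  apply: (has_diff_lin lL (linear_mx_continuous lL)).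
  apply: has_diff_eq (has_diffB (has_diff_id _) (has_diff_cst x _)) _ => w.
  by rewrite subr0.
have xux : x + u - x = u by rewrite addrAC subrr add0r.
have fx : f x = A i x by rewrite /f subrr derive0 subr0.
have fxu : f (x + u) = A i (x + u) - 'D_u (A i) x by rewrite /f xux.
have -> : A i (x + u) - A i x - 'D_u (A i) x = f (x + u) - f x.
  by rewrite fx fxu; exact: addrAC.
clear fx fxu xux.
apply: (mean_value_ineq Q0) => t t01; first by have [+ _] := hf t t01; exact.
have [_ ->] := hf t t01; have /andP[t0 t1] := t01.
have ss s : 0 <= s <= 1 -> 0 <= s * t <= 1.
  by move=> /andP[s0 s1]; rewrite mulr_ge0 // mulr_ile1.
have Dd s : 0 <= s <= 1 -> differentiable D (x + s *: (t *: u)).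
  move=> /ss st; have [Us _] := h _ st; rewrite scalerA.
  exact: Cinfty_diff CD Us.
apply: (@mean_value_ineq R _ _ _ D x (t *: u) Q Q0) => s s01; first exact: Dd.
have st := ss _ s01.
rewrite (diffZv _ _ (Dd _ s01)) normrZ (ger0_norm t0) scalerA.
apply: le_trans (ler_wpM2l t0 (D_bound _ st)) _.
by rewrite -[leRHS]mul1r ler_wpM2r.
Qed.

Theorem frobenius : exists G : 'cV[R]_n -> 'M[R]_m, G u0 = 1%:M /\
  \forall x \near u0, has_diff G x (fun v => (\sum_i v i 0 *: A i x) *m G x).
Proof.
have [C C0 [r1 r10 hC]] := uniform_bound.
(* The three summands serve the bounds on [a], on [b] and on the Taylor remainder of [a], which
   involve one, two and three sums over the coordinates. *)
pose c := C * (n%:R + n%:R * n%:R + n%:R * n%:R * n%:R).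
have nn : (0 : R) <= n%:R by [].
have c0 : 0 <= c by rewrite mulr_ge0 // !addr_ge0 // !mulr_ge0.
have mc0 : 0 <= m%:R * c by rewrite mulr_ge0.
(* The last term gives the contraction condition m c r <= 1/4; the added 1 avoids a vanishing
   denominator. *)
pose r := Num.min (Num.min 1 r1) (1 / (4 * (m%:R * c + 1))).
have mc1 : 0 < 4 * (m%:R * c + 1) by rewrite mulr_gt0 // ltr_wpDl.
have r0 : 0 < r by rewrite !lt_min ltr01 r10 divr_gt0.
have [rle1 rler1 rler2] : [/\ r <= 1, r <= r1 & r <= 1 / (4 * (m%:R * c + 1))].
  by rewrite /r !ge_min !lexx ?orbT.
have cr : m%:R * c * r <= 1 / 4.
  apply: (@le_trans _ _ ((m%:R * c + 1) * r)); first by rewrite ler_wpM2r ?(ltW r0) // lerDl.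
  move: rler2; rewrite ler_pdivlMr //; lra.
have hr (x : 'cV[R]_n) : `|x| < r -> `|(u0 + x) - u0| < r1.
  by move=> xr; rewrite addrAC subrr add0r (lt_le_trans xr).
have [|||||||G [G1 hG]] := @euler_limit R n m a b c r c0 rle1 cr.
- move=> x s v w; rewrite /a scaler_sumr -big_split; apply: eq_bigr => i _.
  by rewrite !mxE scalerDl scalerA.
- move=> t x /andP[t0 t1] xr; apply: a_diag; have [] // := hC (u0 + t *: x) _.
  apply: hr; rewrite normrZ ger0_norm //; apply: le_lt_trans xr.
  by rewrite -[leRHS]mul1r ler_wpM2r.
- move=> x v xr; have [_ hb] := hC _ (hr x xr).
  apply: (@le_trans _ _ (n%:R * (`|v| * C))).
    by apply: sum_scale_bound => i; have [+ _] := hb i i i.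
  rewrite /c [leRHS]mulrC mulrCA ler_wpM2l // mulrC ler_wpM2l //.
  by rewrite -addrA lerDl addr_ge0 // !mulr_ge0.
- move=> x u v xr; have [Ux hb] := hC _ (hr x xr).
  apply: (@le_trans _ _ (n%:R * (`|v| * (n%:R * (`|u| * C))))).
    apply: sum_scale_bound => i.
    rewrite (derive_sum_delta _ (Cinfty_diff (CA i) Ux)).
    by apply: sum_scale_bound => j; have [_ [+ _]] := hb i j j.
  have -> : n%:R * (`|v| * (n%:R * (`|u| * C))) = C * (n%:R * n%:R) * (`|u| * `|v|).
    by ring.
  by rewrite ler_wpM2r ?mulr_ge0 // ler_wpM2l // addrAC lerDr addr_ge0 // !mulr_ge0.
- move=> x u v xr yr.
  rewrite /a /b -!sumrB.
  under eq_bigr => i _ do rewrite -!scalerBr.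
  apply: (@le_trans _ _ (n%:R * (`|v| * (n%:R * n%:R * C * (`|u| * `|u|))))).
    apply: sum_scale_bound => i; rewrite addrA.
    apply: taylor => // t t01.
    have [|Ut hb] := hC (u0 + x + t *: u).
      have -> : u0 + x + t *: u = u0 + (x + t *: u) by rewrite addrA.
      by apply: hr; have := @ball_segment R _ 0 x u r t t01; rewrite !subr0; exact.
    split; first exact: Ut.
    by move=> j k; have [_ [_]] := hb i j k.
  have -> : n%:R * (`|v| * (n%:R * n%:R * C * (`|u| * `|u|)))
     = C * (n%:R * n%:R * n%:R) * (`|u| * `|u| * `|v|) by ring.
  by rewrite ler_wpM2r ?mulr_ge0 // ler_wpM2l // lerDr addr_ge0 // !mulr_ge0.
- move=> x v h u xr; rewrite /b scaler_sumr; apply: eq_bigr => i _.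
  have [Ux _] := hC _ (hr x xr).
  by rewrite (diffZv _ _ (Cinfty_diff (CA i) Ux)) !scalerA mulrC.
- by move=> x u v xr; apply: b_flat; have [] := hC _ (hr x xr).
exists (fun x => G (x - u0)); split; first by rewrite subrr.
apply: filterS (ball_norm_near u0 r0) => x xr.
have h1 : has_diff (fun y => y - u0) x id.
  apply: has_diff_eq (has_diffB (has_diff_id x) (has_diff_cst u0 x)) _ => v.
  by rewrite subr0.
apply: has_diff_eq (has_diff_comp h1 (hG _ xr)) _ => v.
by rewrite /a addrC subrK.
Qed.

End Coefficients.
End Frobenius.

(** * Regularity of solutions and potentials of closed forms *)

Section Potentials.
Variable R : realType.

Lemma ball_constant (V : normedModType R) m k (f : V -> 'M[R]_(m, k)) u0 (r : R) :
  (forall x, `|x - u0| < r -> has_diff f x (fun=> 0)) ->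
  forall x y, `|x - u0| < r -> `|y - u0| < r -> f x = f y.
Proof.
move=> h x y xr yr.
have yE : x + (y - x) = y by rewrite addrC subrK.
have seg t : 0 <= t <= 1 -> `|x + t *: (y - x) - u0| < r.
  by move=> t01; apply: ball_segment => //; rewrite yE.
have := @mean_value_ineq R V m k f x (y - x) 0 (lexx 0).
rewrite yE => H.
have {H} : `|f y - f x| <= 0.
  apply: H => t /seg /h [d e]; first exact: d.
  by rewrite e normr0.
by rewrite normr_le0 subr_eq0 => /eqP.
Qed.

(** Bootstrap: the derivatives of [G] are [A] times [G], so [G] of class $C^j$ has derivatives of
    class $C^j$. *)
Lemma Cinfty_linear_system n m k (U : set 'cV[R]_n)
    (A : 'I_n -> 'cV[R]_n -> 'M[R]_m) (G : 'cV[R]_n -> 'M[R]_(m, k)) :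
  open U -> (forall i, Cinfty U (A i)) ->
  (forall x, U x -> has_diff G x (fun v => (\sum_i v i 0 *: A i x) *m G x)) ->
  Cinfty U G.
Proof.
move=> oU CA hG; elim=> [|j IH].
  by move=> x /hG [d _]; exact: differentiable_continuous.
split=> [x /hG []//|v].
have H : Ck j U (fun x => (\sum_i (v i 0 : R^o) *: A i x) *m G x).
  apply: Ck_mulmx => //; apply: Ck_sum => // i _.
  by apply: Ck_scale => //; [exact: Ck_cst|exact: CA].
by apply: Ck_ext H => // x /hG [_ ->].
Qed.

Lemma Cinfty_primitive n (U : set 'cV[R]_n) (th : 'I_n -> 'cV[R]_n -> R^o)
    (F : 'cV[R]_n -> R^o) :
  open U -> (forall i, Cinfty U (th i)) ->
  (forall x, U x -> has_diff F x (fun v => \sum_i v i 0 *: th i x)) ->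
  Cinfty U F.
Proof.
move=> oU Cth hF; apply: Cinfty_deriveI => [x /hF []//|v].
have H : Cinfty U (fun x => \sum_i (v i 0 : R^o) *: th i x).
  apply: Cinfty_sum => // i _.
  by apply: Cinfty_scale => //; exact: Cinfty_cst.
by apply: Cinfty_ext H => // x /hF [_ ->].
Qed.

(* The connection matrix of [dx_0 = th, dx_1 = 0] turns a closed form [th] into
   a flat linear system. *)
Theorem poincare n (U : set 'cV[R]_n) (u0 : 'cV[R]_n)
    (th : 'I_n -> 'cV[R]_n -> R^o) : open U -> U u0 ->
  (forall i, Cinfty U (th i)) ->
  (forall x i j, U x ->
     'D_(delta_mx i 0) (th j) x = 'D_(delta_mx j 0) (th i) x) ->
  exists F : 'cV[R]_n -> R^o,
    \forall x \near u0, has_diff F x (fun v => \sum_i v i 0 *: th i x).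
Proof.
move=> oU U0 Cth closed.
pose i0 : 'I_2 := ord0; pose i1 : 'I_2 := ord_max.
pose N : 'M[R]_2 := delta_mx i0 i1.
have NN : N *m N = 0 by rewrite mul_delta_mx_cond.
pose A i x : 'M[R]_2 := th i x *: N.
have CA i : Cinfty U (A i).
  by apply: Cinfty_scale => //; exact: Cinfty_cst.
have dA x i j : U x -> 'D_(delta_mx i 0) (A j) x = 'D_(delta_mx i 0) (th j) x *: N.
  move=> Ux; have [_ ->] := has_diffZ (has_diffE (Cinfty_diff (Cth j) Ux)) (has_diff_cst N x).
  by rewrite scaler0 add0r.
have [x i j Ux|G [G1 nG]] := @frobenius R n 2 U u0 A oU U0 CA.
  rewrite !dA // closed // subrr /A -!scalemxAl -!scalemxAr NN.
  by rewrite !scaler0 subrr.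
have [r r0 hG] := near_ball_norm nG.
have hE x (i j : 'I_2) : `|x - u0| < r -> has_diff (fun y => G y i j : R^o) x
    (fun v => (\sum_i v i 0 *: th i x) *: (N *m G x) i j).
  move=> /hG /(has_diff_entry i j) h; apply: has_diff_eq h _ => v.
  have -> : \sum_i v i 0 *: A i x = (\sum_i v i 0 *: th i x : R) *: N.
    by rewrite scaler_suml; apply: eq_bigr => l _; rewrite scalerA.
  by rewrite -scalemxAl mxE.
have N0 (B : 'M[R]_2) j : (N *m B) i0 j = B i1 j.
  rewrite mxE (bigD1 i1) //= big1 ?addr0 => [|l ln]; last by rewrite mxE (negbTE ln) andbF mul0r.
  by rewrite mxE !eqxx mul1r.
have N1 (B : 'M[R]_2) j : (N *m B) i1 j = 0.
  by rewrite mxE big1 // => l _; rewrite mxE mul0r.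
(* The second row of [N] is zero, so this entry stays at its initial value 1. Hence the differential
   of the entry [(i0, i1)], which is [th] times this one, is [th] itself. *)
have G11 x : `|x - u0| < r -> G x i1 i1 = 1.
  move=> xr; pose f y : 'M[R]_1 := (G y i1 i1)%:M.
  have : f x = f u0.
    apply: (@ball_constant _ _ _ f u0 r) => //; last by rewrite subrr normr0.
    move=> y yr; apply: has_diff_mx => i j; rewrite !ord1.
    apply: has_diff_eq (has_diff_ext _ (hE y i1 i1 yr)) _ => [z|v].
      by rewrite /f mxE eqxx mulr1n.
    by rewrite N1 scaler0 mxE.
  by move=> /matrixP /(_ 0 0); rewrite /f !mxE !eqxx !mulr1n G1 mxE eqxx.
exists (fun x => G x i0 i1 : R^o).
apply: filterS (ball_norm_near u0 r0) => x xr.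
apply: has_diff_eq (hE x i0 i1 xr) _ => v.
by rewrite N0 G11 // [_ *: _]mulr1.
Qed.

End Potentials.

(** * Cut-off functions *)

Section Cutoff.
Variable R : realType.

Lemma is_derive_has_diff (f : R -> R) (t d : R) :
  @has_diff R R^o R^o f t (fun v => v * d) -> is_derive (t : R^o) (1 : R^o) (f : R^o -> R^o) d.
Proof.
move=> [df e]; split; first exact: diff_derivable.
by rewrite e mul1r.
Qed.

Lemma has_diff_is_derive (f : R -> R) (t d : R) :
  is_derive (t : R^o) (1 : R^o) (f : R^o -> R^o) d ->
  @has_diff R R^o R^o f t (fun v => v * d).
Proof.
move=> [df e]; have df' : differentiable (f : R^o -> R^o) t by apply/derivable1_diffP.
by split=> // v; rewrite -e -[RHS]diffZv // [v *: _]mulr1.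
Qed.

(** All derivatives of exp(- 1 / t), extended by zero, have this form; the polynomial in 1 / t is
    carried as a parameter. *)
Definition flat_exp (P : {poly R}) (t : R) : R :=
  if 0 < t then P.[t^-1] * expR (- t^-1) else 0.

(** With s = 1 / t this says that [flat_exp P] is O(t^2) at 0. The bound comes from the term of
    degree size P + 2 in the exponential series, hence the factorial. *)
Lemma poly_expR_bound (P : {poly R}) : exists C : R,
  forall s : R, 1 <= s -> `|P.[s]| * expR (- s) * (s * s) <= C.
Proof.
exists ((\sum_(i < size P) `|P`_i|) * ((size P).+2)`!%:R) => s s1.
have s0 : 0 <= s by exact: le_trans s1.
have hP : `|P.[s]| <= (\sum_(i < size P) `|P`_i|) * s ^+ size P.
  rewrite horner_coef mulr_suml; apply: le_trans (ler_norm_sum _ _ _) _.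
  apply: ler_sum => i _; rewrite normrM ler_wpM2l // ger0_norm ?exprn_ge0 //.
  by apply: ler_weXn2l => //; exact: ltnW.
have S0 : 0 <= \sum_(i < size P) `|P`_i| by exact: sumr_ge0.
have he : s ^+ (size P).+2 * expR (- s) <= ((size P).+2)`!%:R.
  rewrite expRN ler_pdivrMr ?expR_gt0 //.
  have f0 : (0 : R) < ((size P).+2)`!%:R by rewrite ltr0n fact_gt0.
  rewrite mulrC -ler_pdivrMr //.
  by apply: le_trans (expR_ge1Dxn (size P).+1 s0); rewrite lerDr.
apply: (@le_trans _ _ ((\sum_(i < size P) `|P`_i|) * (s ^+ (size P).+2 * expR (- s)))).
  rewrite !exprS; set S := \sum_(_ < _) _.
  have -> : S * (s * (s * s ^+ size P) * expR (- s)) =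
    S * s ^+ size P * expR (- s) * (s * s) by ring.
  by rewrite ler_wpM2r ?mulr_ge0 // ler_wpM2r ?expR_ge0.
by rewrite ler_wpM2l.
Qed.

(** For s = 1 / t one has ds/dt = - s^2, whence the polynomial X^2 (P - P'). At 0 the quadratic
    bound gives derivative 0. *)
Lemma flat_exp_derive (P : {poly R}) (t : R) :
  is_derive (t : R^o) (1 : R^o) (flat_exp P : R^o -> R^o) (flat_exp ('X^2 * (P - P^`())) t).
Proof.
apply: is_derive_has_diff; case: (ltgtP 0 t) => [t0|t0|<-].
- have tn : t != 0 by rewrite gt_eqF.
  have hinv : is_derive (t : R^o) (1 : R^o) (fun y : R^o => y^-1 : R^o) (- t ^- 2).
    have := @is_deriveV R id t 1 1 tn (is_derive_id _ _).
    by rewrite [_ *: _]mulr1.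
  have hP := is_derive1_comp (is_derive_poly P t^-1) hinv.
  have hN : is_derive (t : R^o) (1 : R^o) (fun y : R^o => - y^-1 : R^o) (t ^- 2).
    by have := is_deriveN hinv; rewrite opprK.
  have hE := @is_derive1_comp R expR (fun y => - y^-1) t _ _ (is_derive_expR _) hN.
  have hM := has_diffZ (has_diff_is_derive hP) (has_diff_is_derive hE).
  have nt : \forall y \near (t : R^o), 0 < y by exact: lt_nbhsr.
  apply: has_diff_eq (has_diff_near _ hM) _.
    by apply: filterS nt => y y0; rewrite /flat_exp y0.
  move=> v; rewrite /flat_exp t0 hornerM hornerXn hornerD hornerN /=.
  rewrite exprVn.
  have aux (x y z w : R) : x * (v * (y * z)) + v * (w * - z) * y
    = v * (z * (x - w) * y) by ring.
  exact: aux.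
- apply: has_diff_eq (has_diff_near _ (has_diff_cst (0 : R^o) (t : R^o))) _.
    apply: filterS (lt_nbhsl t0) => y y0.
    by rewrite /flat_exp ltNge (ltW y0).
  by move=> v; rewrite /flat_exp ltNge (ltW t0) mulr0.
- have [C hC] := poly_expR_bound P.
  apply: has_diff_eq (_ : has_diff _ _ (fun=> 0)) _; last first.
    by move=> v; rewrite /flat_exp ltxx mulr0.
  have lL : linear (fun _ : R^o => 0 : R^o) by move=> a x y; rewrite scaler0 addr0.
  apply: (quadratic_has_diff ltr01 lL (linear_scalar_continuous lL) (C := C)) => v v1.
  have v0 := normr_ge0 v.
  have C0 : 0 <= C.
    by apply: le_trans (hC 1 (lexx _)); rewrite !mulr1 mulr_ge0 ?expR_ge0.
  rewrite add0r subr0 {2}/flat_exp ltxx subr0 /flat_exp.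
  case: ifP => [vp|_]; last by rewrite normr0 !mulr_ge0.
  have e1 : 1 <= v^-1.
    by rewrite -invr1 lef_pV2 ?posrE // ltW //; apply: le_lt_trans (ler_norm _) v1.
  have := hC _ e1; rewrite normrM (ger0_norm (expR_ge0 _)) (gtr0_norm vp).
  by rewrite -invfM ler_pdivrMr // mulr_gt0.
Qed.

Fixpoint flat_poly (k : nat) : {poly R} :=
  if k is k'.+1 then 'X^2 * (flat_poly k' - (flat_poly k')^`()) else 1.

Definition flat_exp1 (t : R) : R := flat_exp 1 t.

Lemma Cinfty_flat_exp1 (V : normedModType R) (U : set V) (f : V -> R^o) :
  open U -> Cinfty U f -> Cinfty U (fun x => flat_exp1 (f x) : R^o).
Proof.
move=> oU Cf; apply: (@Cinfty_comp1 R V U (fun k => flat_exp (flat_poly k))) => //.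
by move=> k t; exact: flat_exp_derive.
Qed.

(* Equal to 0 on [t <= 0] and to 1 on [1 <= t]: composing [exp (- 1 / t)] with
   itself yields the value 1 exactly without dividing by a function. *)
Definition smooth_step (t : R) : R :=
  expR 1 * flat_exp1 (1 - expR 1 * flat_exp1 (1 - t)).

Lemma flat_exp1_le0 (t : R) : t <= 0 -> flat_exp1 t = 0.
Proof. by move=> t0; rewrite /flat_exp1 /flat_exp ltNge t0. Qed.

Lemma flat_exp1_ge1 (t : R) : 1 <= t -> 1 <= expR 1 * flat_exp1 t.
Proof.
move=> t1; have t0 : 0 < t by exact: lt_le_trans t1.
rewrite /flat_exp1 /flat_exp t0 hornerC mul1r -expRD -[leLHS]expR0 ler_expR.
by rewrite subr_ge0 invf_le1.
Qed.

Lemma smooth_step0 (t : R) : t <= 0 -> smooth_step t = 0.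
Proof.
move=> t0; rewrite /smooth_step [X in _ * X]flat_exp1_le0 ?mulr0 //.
by rewrite subr_le0 flat_exp1_ge1 //; lra.
Qed.

Lemma smooth_step1 (t : R) : 1 <= t -> smooth_step t = 1.
Proof.
move=> t1; rewrite /smooth_step (@flat_exp1_le0 (1 - t)); last by lra.
rewrite mulr0 subr0 /flat_exp1 /flat_exp ltr01 hornerC mul1r -expRD invr1.
by rewrite subrr expR0.
Qed.

Lemma Cinfty_smooth_step (V : normedModType R) (U : set V) (f : V -> R^o) :
  open U -> Cinfty U f -> Cinfty U (fun x => smooth_step (f x) : R^o).
Proof.
move=> oU Cf.
have C1 (g : V -> R^o) (s : R^o) : Cinfty U g -> Cinfty U (fun x => s - expR 1 * g x : R^o).
  move=> Cg; have h : Cinfty U (fun x => (s : R^o) + (- expR 1 : R^o) *: g x).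
    apply: Cinfty_add => //; first exact: Cinfty_cst.
    by apply: Cinfty_scale => //; exact: Cinfty_cst.
  by apply: Cinfty_ext h => // x _; rewrite [_ *: _]mulNr.
have C2 : Cinfty U (fun x => 1 - f x : R^o).
  by apply: Cinfty_add => //; [exact: Cinfty_cst|exact: Cinfty_opp].
have C3 := Cinfty_flat_exp1 oU (C1 _ 1 (Cinfty_flat_exp1 oU C2)).
apply: Cinfty_ext (Cinfty_scale oU (@Cinfty_cst R V R^o U (expR 1 : R^o)) C3) => // x _.
Qed.

(** The norm of R^n is the maximum norm, which is not smooth, so the cut-off is built on the sum of
    squares [q] and compared with the norm on both sides. *)
Lemma bump n (u0 : 'cV[R]_n) (r : R) : 0 < r ->
  exists chi : 'cV[R]_n -> R^o, [/\ Cinfty setT chi,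
    exists2 d : R, 0 < d & forall x, `|x - u0| < d -> chi x = 1 &
    forall x, r <= `|x - u0| -> chi x = 0].
Proof.
move=> r0; pose q (x : 'cV[R]_n) : R := \sum_i (x i 0 - u0 i 0) ^+ 2.
(* The function [f] below is at least 1 where q <= s and at most 0 where 2 s <= q. Outside the ball
   of radius [r] one has q >= r^2 = 4 s. *)
pose s : R := (r / 2) ^+ 2.
have s0 : 0 < s by rewrite exprn_gt0 // divr_gt0.
pose f (x : 'cV[R]_n) : R := 2 - s^-1 * q x.
exists (fun x => smooth_step (f x)); split.
- apply: Cinfty_smooth_step; first exact: openT.
  have oT := @openT 'cV[R]_n.
  have Cc i : Cinfty setT (fun x : 'cV[R]_n => x i 0 - u0 i 0 : R^o).
    apply: (@Cinfty_add R _ R^o) => //; last exact: (@Cinfty_cst _ _ R^o).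
    by apply: Cinfty_entry => //; exact: Cinfty_id.
  have Cq : Cinfty setT (fun x : 'cV[R]_n => \sum_i (x i 0 - u0 i 0 : R^o) *: (x i 0 - u0 i 0 : R^o) : R^o).
    by apply: Cinfty_sum => // i _; apply: Cinfty_scale.
  have h : Cinfty setT (fun x : 'cV[R]_n => (2 : R^o) + (- s^-1 : R^o) *:
     (\sum_i (x i 0 - u0 i 0 : R^o) *: (x i 0 - u0 i 0 : R^o) : R^o)).
    apply: Cinfty_add => //; first exact: Cinfty_cst.
    by apply: Cinfty_scale => //; exact: Cinfty_cst.
  apply: Cinfty_ext h => // x _; rewrite /f /q [_ *: _]mulNr.
  by congr (_ - _ * _); apply: eq_bigr => i _; rewrite expr2.
(* With every coordinate below this bound, q <= n s / (n + 1)^2 <= s; the successor also covers n =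
   0. *)
- exists (r / 2 / n.+1%:R); first by rewrite divr_gt0 // divr_gt0.
  move=> x xd; apply: smooth_step1; rewrite /f.
  suff : s^-1 * q x <= 1 by lra.
  rewrite mulrC ler_pdivrMr // mul1r.
  apply: (@le_trans _ _ (\sum_(i < n) (r / 2 / n.+1%:R) ^+ 2)).
    apply: ler_sum => i _; rewrite -[leLHS]ger0_norm ?sqr_ge0 // normrX.
    rewrite lerXn2r ?nnegrE // ?divr_ge0 ?(ltW r0) //.
    by apply: le_trans (ltW xd); have := mx_norm_entry (x - u0) i 0; rewrite !mxE.
  rewrite sumr_const card_ord -[_ *+ n]mulr_natr exprMn -/s -mulrA -[leRHS]mulr1.
  rewrite ler_wpM2l ?(ltW s0) // exprVn mulrC ler_pdivrMr ?exprn_gt0 // mul1r.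
  by rewrite -natrX ler_nat; nia.
- move=> x xr; apply: smooth_step0; rewrite /f.
  suff : 2 <= s^-1 * q x by lra.
  have [i hi] : exists i, r <= `|x i 0 - u0 i 0|.
    apply: contrapT => /forallNP h.
    have [r' r'0 hr'] : exists2 r' : R, 0 <= r' < r & forall i, `|x i 0 - u0 i 0| <= r'.
      exists (\big[Num.max/0]_i `|x i 0 - u0 i 0|).
        apply/andP; split; first exact: bigmax_ge_id.
        by apply: bigmax_lt => // i _; rewrite ltNge; apply/negP; exact: h.
      by move=> i; exact: le_bigmax.
    have /andP[a b] := r'0.
    have : `|x - u0| <= r'.
      by apply: mx_norm_le => // i j; rewrite !mxE ord1; exact: hr'.
    by move=> c; have := lt_le_trans b (le_trans xr c); rewrite ltxx.
  have hq : r ^+ 2 <= q x.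
    rewrite /q (bigD1 i) //=; apply: (@le_trans _ _ ((x i 0 - u0 i 0) ^+ 2)).
      rewrite -[leRHS]ger0_norm ?sqr_ge0 // normrX lerXn2r ?nnegrE //; exact: ltW.
    by rewrite lerDl; apply: sumr_ge0 => j _; exact: sqr_ge0.
  rewrite mulrC ler_pdivlMr //; apply: le_trans hq.
  rewrite /s exprMn; have r2 : 0 <= r ^+ 2 by exact: sqr_ge0.
  by rewrite mulrCA ler_piMr //; lra.
Qed.

End Cutoff.

(** * Charts, vector fields and connections *)

Local Notation phi a := (coord (chart_of a)).
Local Notation psi a := (param (chart_of a)).
Local Notation D a := (dom (chart_of a)).

Section ChartCalculus.
Variables (R : realType) (n : nat) (M : manifold R n).
Implicit Types (a b : atlas M) (p q : M) (W : normedModType R).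

Lemma open_D a : open (D a). Proof. exact: open_dom. Qed.

Lemma cimgP a (V : set M) u :
  (phi a @` (D a `&` V)) u <-> (phi a @` D a) u /\ V (psi a u).
Proof.
split=> [[p [Dp Vp] <-]|[[p Dp <-]]].
  by split; [exists p|rewrite coordK].
by rewrite coordK // => Vp; exists p.
Qed.

Lemma psi_D a u : (phi a @` D a) u -> D a (psi a u).
Proof. by move=> [p Dp <-]; rewrite coordK. Qed.

Lemma psiK a u : (phi a @` D a) u -> phi a (psi a u) = u.
Proof. by move=> [p Dp <-]; rewrite coordK. Qed.

Lemma open_cimg a (V : set M) : open V -> open (phi a @` (D a `&` V)).
Proof.
move=> oV; rewrite openE => u /cimgP [cu Vu].
have n1 := open_near (@open_codom _ _ _ (chart_of a)) cu.
have n2 : \forall v \near u, V (psi a v).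
  exact: (param_cont cu (open_near oV Vu)).
by apply: filterS2 n1 n2 => v h1 h2; apply/cimgP.
Qed.

Lemma cimg_coord a (V : set M) p : D a p -> V p ->
  (phi a @` (D a `&` V)) (phi a p).
Proof. by move=> Dp Vp; exists p. Qed.

Lemma near_psi a p (P : set M) : D a p -> (\forall q \near p, P q) ->
  \forall u \near phi a p, P (psi a u).
Proof.
move=> Dp Pp; have cu : (phi a @` D a) (phi a p) by exists p.
by have := param_cont cu; rewrite /prop_for /continuous_at coordK // => /(_ _ Pp).
Qed.

Lemma near_phi a p (P : set 'cV[R]_n) : D a p ->
  (\forall u \near phi a p, P u) -> \forall q \near p, P (phi a q).
Proof. by move=> Dp Pp; exact: (coord_cont Dp Pp). Qed.

Definition chart_diff W (f : M -> W) a p :=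
  differentiable (f \o psi a) (phi a p).

Lemma smooth_chart_diff W (f : M -> W) (U : set M) a p :
  smooth_on U f -> D a p -> U p -> chart_diff f a p.
Proof.
move=> sf Dp Up; apply: Cinfty_diff (sf a) _; exact: cimg_coord.
Qed.

Lemma transition_diff a b p : D a p -> D b p -> chart_diff (phi b) a p.
Proof.
move=> Da Db; apply: Cinfty_diff (@atlas_compat _ _ M a b) _; exact: cimg_coord.
Qed.

Lemma dirE W (f : M -> W) p (v : tangent p) :
  dir f v = 'D_v (f \o psi (pref p)) (phi (pref p) p).
Proof. by []. Qed.

(** [dir] is computed in the chart [pref p], which jumps with [p]. The chain rule through the
    transition map moves every computation to one fixed chart [a]. *)
Lemma dir_chart_has_diff W (f : M -> W) a p : D a p -> chart_diff f a p ->
  has_diff (f \o psi (pref p)) (phi (pref p) p)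
    (fun v => 'D_(tcoord a (v : tangent p)) (f \o psi a) (phi a p)).
Proof.
move=> Da df; have Dp := pref_dom p.
have hT := has_diffE (transition_diff Dp Da).
rewrite /chart_diff in df.
have df' : differentiable (f \o psi a) ((phi a \o psi (pref p)) (phi (pref p) p)).
  by rewrite /= coordK.
have h := has_diff_comp hT (has_diffE df').
rewrite /= coordK // in h.
have nD : \forall u \near phi (pref p) p, D a (psi (pref p) u).
  by apply: near_psi => //; apply: open_near => //; exact: open_D.
by apply: has_diff_near h; apply: filterS nD => u Du; rewrite /= coordK.
Qed.

Lemma dir_chart W (f : M -> W) a p (v : tangent p) : D a p -> chart_diff f a p ->
  dir f v = 'D_(tcoord a v) (f \o psi a) (phi a p).
Proof. by move=> Da df; have [_ e] := dir_chart_has_diff Da df; exact: e. Qed.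

Lemma tcoord_pref p (v : tangent p) : tcoord (pref p) v = v.
Proof.
have Dp := pref_dom p.
have h : has_diff (phi (pref p) \o psi (pref p)) (phi (pref p) p) id.
  apply: has_diff_near (has_diff_id _).
  have := open_near (@open_codom _ _ _ (chart_of (pref p))) (ex_intro2 _ _ p Dp erefl).
  by apply: filterS => u cu; rewrite /= psiK.
by rewrite /tcoord dirE; have [_ ->] := h.
Qed.

(** The inverse of [tcoord a] at [p], as [tcoordK] and [frameK] show; for basis vectors [w], the
    coordinate fields of the chart. *)
Definition frame a p (w : 'cV[R]_n) : tangent p :=
  'D_w (phi (pref p) \o psi a) (phi a p).

Lemma tcoord_linear a p : D a p -> linear (fun v : tangent p => tcoord a v).
Proof.
move=> Da s v w; rewrite /tcoord !dirE diffZD //.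
exact: transition_diff (pref_dom p) Da.
Qed.

Lemma tcoordK a p (v : tangent p) : D a p -> frame a p (tcoord a v) = v.
Proof.
move=> Da; have Dp := pref_dom p.
by rewrite /frame -dir_chart ?[dir _ _]tcoord_pref //; exact: transition_diff.
Qed.

Lemma tcoord_frame a b p w : D a p -> D b p ->
  tcoord b (frame a p w) = 'D_w (phi b \o psi a) (phi a p).
Proof.
move=> Da Db; have Dp := pref_dom p.
have h1 := has_diffE (transition_diff Da Dp).
have d2 := transition_diff Dp Db; rewrite /chart_diff in d2.
have d2' : differentiable (phi b \o psi (pref p)) ((phi (pref p) \o psi a) (phi a p)).
  by rewrite /= coordK.
have h := has_diff_comp h1 (has_diffE d2').
rewrite /= coordK // in h.
have nD : \forall u \near phi a p, D (pref p) (psi a u).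
  by apply: near_psi => //; apply: open_near => //; exact: open_D.
have h' : has_diff (phi b \o psi a) (phi a p) (fun w => tcoord b (frame a p w)).
  by apply: has_diff_near h; apply: filterS nD => u Du; rewrite /= coordK.
by have [_ ->] := h'.
Qed.

Lemma frameK a p w : D a p -> tcoord a (frame a p w) = w.
Proof.
move=> Da; rewrite tcoord_frame //.
have h : has_diff (phi a \o psi a) (phi a p) id.
  apply: has_diff_near (has_diff_id _).
  have := open_near (@open_codom _ _ _ (chart_of a)) (ex_intro2 _ _ p Da erefl).
  by apply: filterS => u cu; rewrite /= psiK.
by have [_ ->] := h.
Qed.

Lemma tcoord_inj a p : D a p -> injective (fun v : tangent p => tcoord a v).
Proof. by move=> Da v w e; rewrite -(tcoordK v Da) e tcoordK. Qed.

Lemma dir_near W (f g : M -> W) p (v : tangent p) :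
  (\forall q \near p, f q = g q) -> dir f v = dir g v.
Proof.
move=> fg; rewrite !dirE; apply: near_eq_derive.
exact: (near_psi (pref_dom p) fg).
Qed.

Lemma chart_diff_near W (f g : M -> W) a p : D a p ->
  (\forall q \near p, f q = g q) -> chart_diff f a p -> chart_diff g a p.
Proof.
move=> Da fg; apply: near_differentiable; exact: (near_psi Da fg).
Qed.

Lemma smooth_on_chart W (f : M -> W) (U : set M) a : open U -> U `<=` D a ->
  Cinfty (phi a @` (D a `&` U)) (f \o psi a) -> smooth_on U f.
Proof.
move=> oU UD Cf b.
have h : Cinfty (phi b @` (D b `&` U)) (fun u => (f \o psi a) ((phi a \o psi b) u)).
  apply: (@Cinfty_comp _ _ _ _ _ (phi a @` (D a `&` U))) => //.
  - exact: open_cimg.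
  - exact: open_cimg.
  - by move=> u /cimgP [cu Uu]; apply: cimg_coord => //; exact: UD.
  - apply: Cinfty_sub (@atlas_compat _ _ M b a) => u [p [Dp Up] <-].
    by apply: cimg_coord => //; exact: UD.
apply: Cinfty_ext h; first exact: open_cimg.
by move=> u /cimgP [cu Uu] /=; rewrite coordK //; exact: UD.
Qed.

Lemma smooth_on_sub W (f : M -> W) (U V : set M) : V `<=` U ->
  smooth_on U f -> smooth_on V f.
Proof.
move=> VU sf a; apply: Cinfty_sub (sf a) => u /cimgP [cu Vu].
by apply/cimgP; split=> //; exact: VU.
Qed.

Lemma smooth_on_cover W (f : M -> W) (U : set M) :
  (forall p, U p -> exists N, N p /\ smooth_on N f) -> smooth_on U f.
Proof.
move=> h a; apply: Cinfty_cover => u /cimgP [cu Uu].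
have [N [Np sN]] := h _ Uu; exists (phi a @` (D a `&` N)); split; last exact: sN.
by apply/cimgP.
Qed.

Lemma smooth_on_ext W (f g : M -> W) (U : set M) : open U ->
  (forall p, U p -> f p = g p) -> smooth_on U f -> smooth_on U g.
Proof.
move=> oU fg sf a; apply: Cinfty_ext (sf a); first exact: open_cimg.
by move=> u /cimgP [_ Uu]; exact: fg.
Qed.

Lemma smooth_on_cst W (U : set M) (w : W) : smooth_on U (fun=> w).
Proof. by move=> a; exact: Cinfty_cst. Qed.

Lemma smooth_on_add W (U : set M) (f g : M -> W) : open U ->
  smooth_on U f -> smooth_on U g -> smooth_on U (fun p => f p + g p).
Proof.
move=> oU sf sg a; have := Cinfty_add (open_cimg (a := a) oU) (sf a) (sg a); exact.
Qed.

Lemma smooth_on_scale W (U : set M) (k : M -> R^o) (f : M -> W) : open U ->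
  smooth_on U k -> smooth_on U f -> smooth_on U (fun p => k p *: f p).
Proof.
move=> oU sf sg a; have := Cinfty_scale (open_cimg (a := a) oU) (sf a) (sg a); exact.
Qed.

Lemma smooth_on_sum W (U : set M) I (r : seq I) (P : pred I) (f : I -> M -> W) :
  open U -> (forall i, P i -> smooth_on U (f i)) ->
  smooth_on U (fun p => \sum_(i <- r | P i) f i p).
Proof.
move=> oU sf a.
have := @Cinfty_sum _ _ _ _ _ r P _ (open_cimg (a := a) oU) (fun i Pi => sf i Pi a).
exact.
Qed.

Lemma smooth_on_entry m k (U : set M) (A : M -> 'M[R]_(m, k)) i j : open U ->
  smooth_on U A -> smooth_on U (fun p => A p i j : R^o).
Proof.
move=> oU sA a; exact: (Cinfty_entry i j (open_cimg (a := a) oU) (sA a)).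
Qed.

Lemma smooth_on_mx m k (U : set M) (A : M -> 'M[R]_(m, k)) : open U ->
  (forall i j, smooth_on U (fun p => A p i j : R^o)) -> smooth_on U A.
Proof.
move=> oU sA a.
exact: (Cinfty_mx (open_cimg (a := a) oU) (fun i j => sA i j a)).
Qed.

Lemma smooth_on_mulmx m k l (U : set M) (A : M -> 'M[R]_(m, k))
    (B : M -> 'M[R]_(k, l)) : open U ->
  smooth_on U A -> smooth_on U B -> smooth_on U (fun p => A p *m B p).
Proof.
move=> oU sA sB a; exact: (Cinfty_mulmx (open_cimg (a := a) oU) (sA a) (sB a)).
Qed.

Lemma smooth_on_comp_coord W a (U : set M) (U' : set 'cV[R]_n) (g : 'cV[R]_n -> W) :
  open U -> open U' -> U `<=` D a -> (forall p, U p -> U' (phi a p)) ->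
  Cinfty U' g -> smooth_on U (fun p => g (phi a p)).
Proof.
move=> oU oU' UD UU' Cg; apply: (smooth_on_chart (a := a)) => //.
apply: Cinfty_ext (Cinfty_sub _ Cg); first exact: open_cimg.
  by move=> u /cimgP [cu _]; rewrite /= psiK.
by move=> u [p [_ Up] <-]; exact: UU'.
Qed.

Lemma cball_compact (u0 : 'cV[R]_n) (r : R) : compact [set u | `|u - u0| <= r].
Proof.
pose A (i : 'I_n) : set R := `[u0 i 0 - r, u0 i 0 + r]%classic.
have cA : compact [set v : 'rV[R]_n | forall i, A i (v ord0 i)].
  by apply: rV_compact => i; exact: segment_compact.
have lT : linear (fun v : 'rV[R]_n => v^T) by move=> s v w; rewrite linearP.
have cT : continuous (fun v : 'rV[R]_n => v^T : 'cV[R]_n).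
  exact: linear_mx_continuous lT.
have AE i x : A i x <-> `|x - u0 i 0| <= r.
  rewrite /A /= in_itv /= ler_norml.
  by split=> /andP[h1 h2]; apply/andP; split; lra.
(* The ball is a product of segments only for r >= 0: in dimension 0 the empty product is a point,
   while a ball of negative radius is empty. *)
have [r0|r0] := leP 0 r; last first.
  have -> : [set u | `|u - u0| <= r] = set0; last exact: compact0.
  apply/seteqP; split=> // u /= h.
  by have := lt_le_trans r0 (normr_ge0 (u - u0)); rewrite ltNge h.
have -> : [set u | `|u - u0| <= r] =
  (fun v : 'rV[R]_n => v^T) @` [set v : 'rV[R]_n | forall i, A i (v ord0 i)].
  apply/seteqP; split=> [u /= h|u [v /= hv <-] /=].
    exists u^T; last by rewrite trmxK.
    move=> i; apply/AE; rewrite mxE; apply: le_trans h.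
    by have := mx_norm_entry (u - u0) i 0; rewrite !mxE.
  apply: mx_norm_le => // i j; rewrite !mxE ord1.
  exact/AE/hv.
by apply: continuous_compact cA; exact: continuous_subspaceT.
Qed.

(** [K] is the image of a compact coordinate ball, closed because [M] is Hausdorff. Off [K] the
    function vanishes on an open set, which is what makes extensions by zero smooth. *)
Lemma manifold_bump p (V : set M) : open V -> V p ->
  exists chi : M -> R^o, exists K : set M,
  [/\ smooth_on setT chi, (\forall q \near p, chi q = 1), closed K, K `<=` V &
      forall q, ~ K q -> chi q = 0].
Proof.
move=> oV Vp; pose a := pref p; have Dp : D a p := pref_dom p.
have [r r0 hr] := near_ball_norm (open_near (open_cimg (a := a) oV) (cimg_coord Dp Vp)).
have r2 : 0 < r / 2 by rewrite divr_gt0.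
have [c [Cc [d d0 c1] c0]] := bump (phi a p) r2.
pose B := [set u : 'cV[R]_n | `|u - phi a p| <= r / 2].
have BV u : B u -> (phi a @` (D a `&` V)) u.
  by move=> Bu; apply: hr; apply: le_lt_trans Bu _; rewrite ltr_pdivrMr //; lra.
pose K := psi a @` B.
have cK : closed K.
  apply: compact_closed; first exact: manifold_hausdorff.
  apply: continuous_compact (@cball_compact _ _).
  apply: continuous_in_subspaceT => u; rewrite inE => /BV /cimgP [cu _].
  exact: param_cont.
pose chi q : R^o := if `[< D a q >] then c (phi a q) else 0.
have chiE q : D a q -> chi q = c (phi a q).
  by move=> Dq; rewrite /chi; case: asboolP.
have chi0 q : ~ K q -> chi q = 0.
  move=> nK; rewrite /chi; case: asboolP => // Dq; apply: c0.
  rewrite leNgt; apply/negP => h; apply: nK.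
  by exists (phi a q); [exact: ltW|rewrite coordK].
exists chi, K; split => //.
- apply: smooth_on_cover => q _; have [Kq|nKq] := pselect (K q).
    exists (D a); split; first by case: Kq => u /BV [s [Ds _] <-] <-; rewrite coordK.
    have h := smooth_on_comp_coord (open_D a) openT (fun s Ds => Ds) (fun s _ => I) Cc.
    apply: smooth_on_ext h; first exact: open_D.
    by move=> s Ds; rewrite chiE.
  exists (~` K); split=> //.
  apply: smooth_on_ext (smooth_on_cst _ 0); first by rewrite openC.
  by move=> s /chi0 ->.
- have n1 := open_near (open_D a) Dp.
  have n2 := near_phi Dp (ball_norm_near (phi a p) d0).
  by apply: filterS2 n1 n2 => q Dq qd; rewrite chiE // c1.
- by move=> q [u /BV /cimgP [_ Vu] <-].
Qed.

(** Extension by zero: [V] and the complement of [K] form an open cover, and the product is smooth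
    on each. *)
Lemma smooth_cut W (V O K : set M) (chi : M -> R^o) (f : M -> W) :
  open V -> open O -> closed K -> K `<=` V -> smooth_on setT chi ->
  (forall q, ~ K q -> chi q = 0) -> smooth_on (V `&` O) f ->
  smooth_on O (fun q => chi q *: f q).
Proof.
move=> oV oO cK KV sc c0 sf; apply: smooth_on_cover => q Oq.
have [Vq|nVq] := pselect (V q).
  exists (V `&` O); split=> //; apply: smooth_on_scale => //.
    exact: openI.
  exact: smooth_on_sub sc.
exists (~` K); split; first by move/KV.
apply: smooth_on_ext (smooth_on_cst _ 0); first by rewrite openC.
by move=> s /c0 ->; rewrite scale0r.
Qed.

Lemma cut_frame_smooth (chi : M -> R^o) (K : set M) a w :
  closed K -> K `<=` D a -> smooth_on setT chi ->
  (forall q, ~ K q -> chi q = 0) ->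
  smooth_vfield (fun p => chi p *: frame a p w).
Proof.
move=> cK KD sc c0 b.
have h : smooth_on (D b) (fun p => chi p *: (tcoord b (frame a p w) : 'cV[R]_n)).
  apply: (smooth_cut (V := D a) (K := K)) => //; try exact: open_D.
  have oab : open (D a `&` D b) by apply: openI; exact: open_D.
  apply: (smooth_on_chart (a := a)) => //.
  have := Cinfty_derive w (@atlas_compat _ _ M a b).
  move=> /(Cinfty_sub (U' := phi a @` (D a `&` (D a `&` D b)))) h.
  apply: Cinfty_ext (h _); first exact: open_cimg.
    by move=> u [p [Dp [_ Db]] <-] /=; rewrite tcoord_frame ?coordK.
  by move=> u [p [Dp [_ Db]] <-]; exists p.
apply: smooth_on_ext h; first exact: open_D.
move=> p Db; have l := tcoord_linear Db (chi p) (frame a p w) 0.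
have t0 : tcoord b (0 : tangent p) = 0 by rewrite /tcoord dirE derive0.
by move: l; rewrite t0 !addr0.
Qed.

End ChartCalculus.

(** * Chart independence and smoothness of the Lie bracket *)

Section LieBracket.
Variable R : realType.

Lemma schwarz_mx (V : normedModType R) m k (U : set V) (f : V -> 'M[R]_(m, k))
    (x u v : V) : open U -> U x -> Cinfty U f ->
  'D_v (fun y => 'D_u f y) x = 'D_u (fun y => 'D_v f y) x.
Proof.
move=> oU Ux Cf.
have E w z i j : ('D_z (fun y => 'D_w f y) x) i j
    = 'D_z (fun y => 'D_w (fun y => f y i j : R^o) y) x.
  have [_ e] := has_diff_entry i j (has_diffE (Cinfty_diff (Cinfty_derive w Cf) Ux)).
  rewrite -e; apply: near_eq_derive.
  apply: filterS (open_near oU Ux) => y Uy.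
  by have [_ ->] := has_diff_entry i j (has_diffE (Cinfty_diff Cf Uy)).
apply/matrixP => i j; apply: (etrans (E u v i j)); apply: (etrans _ (esym (E v u i j))).
exact: (@schwarz R V U (fun y => f y i j : R^o) x u v oU Ux (Cinfty_entry i j oU Cf 2)).
Qed.

Lemma derive_vary_direction n (W : normedModType R) (U : set 'cV[R]_n)
    (F : 'cV[R]_n -> W) (Y : 'cV[R]_n -> 'cV[R]_n) u :
  open U -> U u -> Cinfty U F -> Cinfty U Y ->
  has_diff (fun y => 'D_(Y y) F y) u
    (fun w => 'D_w (fun y => 'D_(Y u) F y) u + 'D_('D_w Y u) F u).
Proof.
move=> oU Uu CF CY.
have dF y : U y -> differentiable F y := Cinfty_diff CF.
have CD j := Cinfty_derive (delta_mx j 0 : 'cV[R]_n) CF.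
have hD j := has_diffE (Cinfty_diff (CD j) Uu).
have hj j := has_diffZ (has_diff_entry j 0 (has_diffE (Cinfty_diff CY Uu))) (hD j).
have hs := has_diff_fsum hj.
apply: has_diff_eq (has_diff_near _ hs) _.
  by apply: filterS (open_near oU Uu) => y Uy; rewrite [RHS]derive_sum_delta //; exact: dF.
move=> w; rewrite big_split /=; congr (_ + _); last first.
  by rewrite [RHS]derive_sum_delta //; exact: dF.
have hj' j := has_diffZ (has_diff_cst (Y u j 0 : R^o) u) (hD j).
have hs' := has_diff_fsum hj'.
have [|_ ->] := has_diff_near (g := fun y => 'D_(Y u) F y) _ hs'.
  by apply: filterS (open_near oU Uu) => y Uy; rewrite [RHS]derive_sum_delta //; exact: dF.
by apply: eq_bigr => j _; rewrite scale0r addr0.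
Qed.

Variables (n : nat) (M : manifold R n).
Implicit Types (a b : atlas M) (p q : M).

Lemma smooth_vfield_chart (X : vfield M) a : smooth_vfield X ->
  Cinfty (phi a @` D a) (fun u => tcoord a (X (psi a u))).
Proof. by move=> sX; have := sX a a; rewrite setIid. Qed.

Lemma tcoord_vfield_has_diff (X : vfield M) a b p : smooth_vfield X ->
  D a p -> D b p ->
  has_diff ((fun q => tcoord b (X q)) \o psi a) (phi a p)
    (fun w => 'D_w (fun u => 'D_(tcoord a (X p)) (phi b \o psi a) u) (phi a p)
      + 'D_('D_w (fun u => tcoord a (X (psi a u))) (phi a p)) (phi b \o psi a) (phi a p)).
Proof.
move=> sX Da Db.
have oU := @open_cimg _ _ _ a _ (open_D b).
have Uu := cimg_coord Da Db.
have CX := Cinfty_sub (U' := phi a @` (D a `&` D b)) _ (smooth_vfield_chart a sX).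
have {}CX := CX (fun u h => proj1 (iffLR (cimgP a (D b) u) h)).
have h := derive_vary_direction oU Uu (@atlas_compat _ _ M a b) CX.
have e : tcoord a (X (psi a (phi a p))) = tcoord a (X p) by rewrite coordK.
cbv beta in h.
rewrite e in h.
apply: has_diff_near h.
apply: filterS (open_near oU Uu) => u /cimgP [cu Du] /=.
have Dau := psi_D cu.
have e1 := dir_chart (X (psi a u)) Dau (transition_diff Dau Du).
by rewrite (psiK cu) in e1; exact: esym e1.
Qed.

Lemma lie_bracket_coord (X Y : vfield M) b p : smooth_vfield X ->
  smooth_vfield Y -> D b p ->
  tcoord b (lie_bracket X Y p) =
    dir (fun q => tcoord b (Y q)) (X p) - dir (fun q => tcoord b (X q)) (Y p).
Proof.
move=> sX sY Db; have Da := pref_dom p; set a := pref p in Da *.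
have oU := @open_cimg _ _ _ a _ (open_D b).
have Uu := cimg_coord Da Db.
have CF := @atlas_compat _ _ M a b.
have [_ eX] := tcoord_vfield_has_diff sX Da Db.
have [_ eY] := tcoord_vfield_has_diff sY Da Db.
have {}eX : dir (fun q => tcoord b (X q)) (Y p) = _ := eX (Y p).
have {}eY : dir (fun q => tcoord b (Y q)) (X p) = _ := eY (X p).
have eXp : tcoord a (X p) = X p := tcoord_pref (X p).
have eYp : tcoord a (Y p) = Y p := tcoord_pref (Y p).
rewrite eXp in eX; rewrite eYp in eY.
apply: (etrans _ (esym (congr2 (fun x y : 'cV[R]_n => x - y) eY eX))).
have eS := schwarz_mx (X p) (Y p) oU Uu CF.
have cancel_eq (V : zmodType) (s t x y : V) : s = t -> x - y = t + x - (s + y).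
  by move=> ->; rewrite opprD addrACA subrr add0r.
apply: (etrans _ (cancel_eq _ _ _ _ _ eS)).
by apply: diffBv; exact: transition_diff.
Qed.

Lemma lie_bracket_smooth (X Y : vfield M) : smooth_vfield X ->
  smooth_vfield Y -> smooth_vfield (lie_bracket X Y).
Proof.
move=> sX sY b; apply: (smooth_on_chart (a := b)) => //; first exact: open_D.
rewrite setIid; set U := phi b @` D b; have oU : open U by exact: open_codom.
have CX := smooth_vfield_chart b sX; have CY := smooth_vfield_chart b sY.
have half (Z1 Z2 : 'cV[R]_n -> 'cV[R]_n) : Cinfty U Z1 -> Cinfty U Z2 ->
    Cinfty U (fun u => 'D_(Z1 u) Z2 u).
  move=> C1 C2.
  have h : Cinfty U (fun u => \sum_j (Z1 u j 0 : R^o) *: 'D_(delta_mx j 0) Z2 u).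
    apply: Cinfty_sum => // j _; apply: Cinfty_scale => //.
      exact: Cinfty_entry.
    exact: Cinfty_derive.
  apply: Cinfty_ext h => // u Uu; rewrite [RHS]derive_sum_delta //.
  exact: Cinfty_diff C2 Uu.
apply: Cinfty_ext (Cinfty_add oU (half _ _ CX CY) (Cinfty_opp oU (half _ _ CY CX))) => // u Uu.
have Db := psi_D Uu.
have cd (Z : vfield M) : smooth_vfield Z -> chart_diff (fun q => tcoord b (Z q)) b (psi b u).
  by move=> sZ; rewrite /chart_diff psiK //; exact: Cinfty_diff (smooth_vfield_chart b sZ) Uu.
have e1 := dir_chart (X (psi b u)) Db (cd Y sY).
have e2 := dir_chart (Y (psi b u)) Db (cd X sX).
rewrite (psiK Uu) in e1 e2.
apply: esym; apply: (etrans (lie_bracket_coord sX sY Db)).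
exact: (congr2 (fun x y : 'cV[R]_n => x - y) e1 e2).
Qed.

End LieBracket.

(** * Locality and tensoriality of connections *)

Section Connections.
Variables (R : realType) (n : nat) (M : manifold R n) (r : nat) (E : vbundle M r).
Implicit Types (a : atlas M) (b : tidx E) (p q : M).

Lemma trivD b p (v w : 'cV[R]_r) : tdom b p ->
  triv b p (v + w) = triv b p v + triv b p w.
Proof. by move=> bp; have := triv_linear bp 1 v w; rewrite !scale1r. Qed.

Lemma triv0 b p : tdom b p -> triv b p 0 = 0.
Proof.
move=> bp; have := trivD 0 0 bp; rewrite addr0 => /(congr1 (fun x => x - triv b p 0)).
by rewrite addrK subrr.
Qed.

Lemma trivZ b p (k : R) (v : 'cV[R]_r) : tdom b p ->
  triv b p (k *: v) = k *: triv b p v.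
Proof. by move=> bp; have := triv_linear bp k v 0; rewrite triv0 // !addr0. Qed.

Lemma triv_sum b p I (s : seq I) (P : pred I) (f : I -> 'cV[R]_r) : tdom b p ->
  triv b p (\sum_(i <- s | P i) f i) = \sum_(i <- s | P i) triv b p (f i).
Proof.
move=> bp; elim: s => [|i s IH]; first by rewrite !big_nil triv0.
by rewrite !big_cons; case: ifP => _ //; rewrite trivD // IH.
Qed.

Lemma triv_inj b p : tdom b p -> injective (triv b p).
Proof. by move=> bp; exact: bij_inj (triv_bij bp). Qed.

Lemma smooth_section_add (s t : section E) :
  smooth_section s -> smooth_section t -> smooth_section (fun p => s p + t p).
Proof.
move=> ss st b; have [c [sc cE]] := ss b; have [d [sd dE]] := st b.
exists (fun p => c p + d p); split.
  by apply: smooth_on_add => //; exact: open_tdom.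
by move=> p bp; rewrite cE // dE // trivD.
Qed.

Lemma smooth_section_scale (f : M -> R^o) (s : section E) : smooth_on setT f ->
  smooth_section s -> smooth_section (fun p => f p *: s p).
Proof.
move=> sf ss b; have [c [sc cE]] := ss b.
exists (fun p => f p *: c p); split.
  apply: smooth_on_scale => //; first exact: open_tdom.
  exact: smooth_on_sub sf.
by move=> p bp; rewrite cE // trivZ.
Qed.

Lemma smooth_section0 : smooth_section (fun p => 0 : fib E p).
Proof.
move=> b; exists (fun=> 0); split; first exact: smooth_on_cst.
by move=> p bp; rewrite triv0.
Qed.

Lemma smooth_section_sum I (l : seq I) (P : pred I) (s : I -> section E) :
  (forall i, P i -> smooth_section (s i)) ->
  smooth_section (fun p => \sum_(i <- l | P i) s i p).
Proof.
move=> h; elim: l => [|i l IH].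
  rewrite (_ : (fun p => _) = (fun p => 0 : fib E p)); first exact: smooth_section0.
  by apply/functional_extensionality_dep => p; rewrite big_nil.
case Pi : (P i).
  rewrite (_ : (fun p => _) = (fun p => s i p + \sum_(i <- l | P i) s i p)).
    by apply: smooth_section_add => //; exact: h.
  by apply/functional_extensionality_dep => p; rewrite big_cons Pi.
rewrite (_ : (fun p => _) = (fun p => \sum_(i <- l | P i) s i p)) //.
by apply/functional_extensionality_dep => p; rewrite big_cons Pi.
Qed.

Lemma cut_triv_smooth (chi : M -> R^o) (K : set M) b (v : 'cV[R]_r) :
  closed K -> K `<=` tdom b -> smooth_on setT chi ->
  (forall q, ~ K q -> chi q = 0) ->
  smooth_section (fun p => chi p *: triv b p v).
Proof.
move=> cK KV sc c0 b'; have [g [sg gE]] := triv_compat b b'.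
exists (fun p => chi p *: (g p *m v)); split.
  apply: (smooth_cut (V := tdom b) (K := K)) => //; try exact: open_tdom.
  apply: smooth_on_mulmx => //; last exact: smooth_on_cst.
  by apply: openI; exact: open_tdom.
move=> p bp'; have [bp|nbp] := pselect (tdom b p).
  by rewrite (gE _ bp bp') trivZ.
have -> : chi p = 0 by apply: c0 => /KV.
by rewrite !scale0r triv0.
Qed.

Lemma smooth_vfield_add (X Y : vfield M) : smooth_vfield X -> smooth_vfield Y ->
  smooth_vfield (fun p => X p + Y p).
Proof.
move=> sX sY a; apply: smooth_on_ext (smooth_on_add _ (sX a) (sY a)).
- exact: open_D.
- move=> p Da; have := tcoord_linear Da 1 (X p) (Y p).
  by rewrite !scale1r => ->.
- exact: open_D.
Qed.

Lemma smooth_vfield_scale (f : M -> R^o) (X : vfield M) : smooth_on setT f ->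
  smooth_vfield X -> smooth_vfield (fun p => f p *: X p).
Proof.
move=> sf sX a.
have sfa : smooth_on (D a) f by exact: smooth_on_sub sf.
apply: smooth_on_ext (smooth_on_scale _ sfa (sX a)).
- exact: open_D.
- move=> p Da; have := tcoord_linear Da (f p) (X p) 0.
  have -> : tcoord a (0 : tangent p) = 0 by rewrite /tcoord dirE derive0.
  by rewrite !addr0 => ->.
- exact: open_D.
Qed.

Lemma smooth_vfield0 : smooth_vfield (fun p : M => 0 : tangent p).
Proof.
move=> a; apply: smooth_on_ext (smooth_on_cst _ 0); first exact: open_D.
by move=> p Da; rewrite /tcoord dirE derive0.
Qed.

Lemma smooth_vfield_sum I (l : seq I) (X : I -> vfield M) :
  (forall i, smooth_vfield (X i)) ->
  smooth_vfield (fun p => \sum_(i <- l) X i p : tangent p).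
Proof.
move=> h; elim: l => [|i l IH].
  rewrite (_ : (fun p => _) = (fun p : M => 0 : tangent p)); first exact: smooth_vfield0.
  by apply/functional_extensionality_dep => p; rewrite big_nil.
rewrite (_ : (fun p => _) = (fun p : M => X i p + (\sum_(i <- l) X i p : tangent p) : tangent p)).
  exact: (smooth_vfield_add (h i) IH).
by apply/functional_extensionality_dep => p; rewrite big_cons.
Qed.

Variables (F : forall p, {vspace fib E p}) (Dl : vfield M -> section E -> section E).
Hypothesis conn : is_connection F Dl.

Lemma Gamma_scale (f : M -> R^o) (s : section E) : smooth_on setT f ->
  Gamma F s -> Gamma F (fun p => f p *: s p).
Proof.
by move=> sf [ss sF]; split=> [|p]; [exact: smooth_section_scale|exact: memvZ].
Qed.

Lemma Gamma0 : Gamma F (fun p => 0).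
Proof. by split=> [|p]; [exact: smooth_section0|exact: mem0v]. Qed.

Lemma conn_sect0 X p : smooth_vfield X -> Dl X (fun q => 0) p = 0.
Proof.
move=> sX; have := conn_addr conn sX Gamma0 Gamma0 p.
have -> : (fun q => 0 + 0) = (fun q => 0 : fib E q).
  by apply/functional_extensionality_dep => q; rewrite addr0.
by move=> /(congr1 (fun x => x - Dl X (fun q => 0) p)); rewrite addrK subrr => <-.
Qed.

Lemma conn_vfield0 s p : Gamma F s -> Dl (fun q => 0) s p = 0.
Proof.
move=> Gs; have := conn_addl conn smooth_vfield0 smooth_vfield0 Gs p.
have -> : (fun q : M => (0 : tangent q) + (0 : tangent q)) = (fun q => 0 : tangent q).
  by apply/functional_extensionality_dep => q; rewrite addr0.
by move=> /(congr1 (fun x => x - Dl (fun q => 0) s p)); rewrite addrK subrr => <-.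
Qed.

Lemma Gamma_sum I (l : seq I) (s : I -> section E) : (forall i, Gamma F (s i)) ->
  Gamma F (fun p => \sum_(i <- l) s i p).
Proof.
move=> h; split=> [|p]; first by apply: smooth_section_sum => i _; have [] := h i.
by apply: memv_suml => i _; have [_] := h i; exact.
Qed.

Lemma conn_sum_sect I (l : seq I) (f : I -> M -> R^o) (s : I -> section E) X p :
  smooth_vfield X -> (forall i, smooth_on setT (f i)) -> (forall i, Gamma F (s i)) ->
  Dl X (fun q => \sum_(i <- l) f i q *: s i q) p
  = \sum_(i <- l) (dir (f i) (X p) *: s i p + f i p *: Dl X (s i) p).
Proof.
move=> sX sf Gs; elim: l => [|i l IH].
  rewrite big_nil (_ : (fun q => _) = (fun q => 0 : fib E q)); first exact: conn_sect0.
  by apply/functional_extensionality_dep => q; rewrite big_nil.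
rewrite big_cons -IH -(conn_leibniz conn (sf i) sX (Gs i)).
rewrite -(conn_addr conn sX).
- congr (Dl X _ p).
  by apply/functional_extensionality_dep => q; rewrite big_cons.
- exact: Gamma_scale.
- by apply: (@Gamma_sum I l (fun i q => f i q *: s i q)) => j; exact: Gamma_scale.
Qed.

Lemma conn_sum_vfield I (l : seq I) (f : I -> M -> R^o) (X : I -> vfield M) s p :
  (forall i, smooth_vfield (X i)) -> (forall i, smooth_on setT (f i)) -> Gamma F s ->
  Dl (fun q => \sum_(i <- l) f i q *: X i q : tangent q) s p
  = \sum_(i <- l) f i p *: Dl (X i) s p.
Proof.
move=> sX sf Gs; elim: l => [|i l IH].
  rewrite big_nil (_ : (fun q => _) = (fun q => 0 : tangent q)); first exact: conn_vfield0.
  by apply/functional_extensionality_dep => q; rewrite big_nil.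
rewrite big_cons -IH -(conn_scalel conn (sf i) (sX i) Gs).
rewrite -(conn_addl conn _ _ Gs).
- congr (Dl _ s p).
  by apply/functional_extensionality_dep => q; rewrite big_cons.
- exact: smooth_vfield_scale.
- by apply: (@smooth_vfield_sum I l (fun i q => f i q *: X i q)) => j; exact: smooth_vfield_scale.
Qed.

(** For a bump function supported where [s] and [t] agree, [chi s = chi t] globally. The Leibniz
    rules for both sides at [p] have the same derivative term, since s p = t p. *)
Lemma conn_local X (s t : section E) p : smooth_vfield X -> Gamma F s -> Gamma F t ->
  (\forall q \near p, s q = t q) -> Dl X s p = Dl X t p.
Proof.
move=> sX Gs Gt st.
have stp : s p = t p := nbhs_singleton st.
have [chi [K [sc c1 cK KV c0]]] := manifold_bump (open_interior [set q | s q = t q]) st.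
have e : (fun q => chi q *: s q) = (fun q => chi q *: t q).
  apply/functional_extensionality_dep => q; have [Kq|nK] := pselect (K q).
    by have /interior_subset /= -> := KV _ Kq.
  by rewrite c0 // !scale0r.
have := congr1 (fun u : section E => Dl X u p) e.
rewrite /= !(conn_leibniz conn sc sX) // stp (nbhs_singleton c1) !scale1r.
by move=> /addrI.
Qed.

Lemma frame_sum a p (w : 'cV[R]_n) : D a p ->
  frame a p w = \sum_i w i 0 *: frame a p (delta_mx i 0).
Proof.
move=> Da; rewrite /frame; apply: derive_sum_delta.
exact: transition_diff Da (pref_dom p).
Qed.

(** The value at [p] depends on [X] through [X p] only, because [X] is near [p] a function
    combination of coordinate fields. *)
Lemma conn_tensorial X (s : section E) a p (chi : M -> R^o) (K : set M) :
  smooth_vfield X -> Gamma F s ->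
  smooth_on setT chi -> closed K -> K `<=` D a -> (forall q, ~ K q -> chi q = 0) ->
  chi p = 1 ->
  Dl X s p = \sum_i tcoord a (X p) i 0 *:
     Dl (fun q => chi q *: frame a q (delta_mx i 0)) s p.
Proof.
move=> sX Gs sc cK KD c0 c1.
pose f i q : R^o := chi q *: (tcoord a (X q) i 0 : R^o).
have sf i : smooth_on setT (f i).
  apply: (smooth_cut (V := D a) (K := K)) => //; first exact: open_D.
    exact: openT.
  rewrite setIT; apply: smooth_on_entry; first exact: open_D.
  exact: sX.
have sF i : smooth_vfield (fun q => chi q *: frame a q (delta_mx i 0)).
  exact: cut_frame_smooth cK KD sc c0.
have sc2 : smooth_on setT (fun q => chi q *: chi q : R^o).
  by apply: smooth_on_scale => //; exact: openT.
(* The square is needed: one factor makes the components of [X] global functions, the other makes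
   the coordinate fields global. *)
have e : (fun q => (chi q *: chi q : R^o) *: X q) = (fun q =>
    \sum_i f i q *: (chi q *: frame a q (delta_mx i 0)) : tangent q).
  apply/functional_extensionality_dep => q; have [Dq|nD] := pselect (D a q).
    rewrite -[in LHS](tcoordK (X q) Dq) frame_sum // scaler_sumr.
    apply: eq_bigr => i _; rewrite /f !scalerA; congr (_ *: _).
    by rewrite /= ![_ *: _]/(_ * _) mulrAC.
  have -> : chi q = 0 by apply: c0 => /KD.
  rewrite scale0r scale0r big1 // => i _; by rewrite scale0r scaler0.
have := congr1 (fun Y => Dl Y s p) e => /=.
rewrite (conn_scalel conn sc2 sX Gs) (conn_sum_vfield _ _ sF sf Gs) c1.
rewrite scale1r scale1r => ->; apply: eq_bigr => i _.
by rewrite /f c1 scale1r.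
Qed.

Lemma conn_vfield_eq0 X (s : section E) p : smooth_vfield X -> Gamma F s ->
  X p = 0 -> Dl X s p = 0.
Proof.
move=> sX Gs X0; have Dp := pref_dom p.
have [chi [K [sc c1 cK KV c0]]] := manifold_bump (open_D (pref p)) Dp.
rewrite (conn_tensorial sX Gs sc cK KV c0 (nbhs_singleton c1)).
by apply: big1 => i _; rewrite X0 tcoord_pref mxE scale0r.
Qed.

End Connections.

Section ChartBalls.
Variables (R : realType) (n : nat) (M : manifold R n).
Implicit Types (p q : M).

Definition chart_ball p (r : R) : set M :=
  [set q | D (pref p) q /\ `|phi (pref p) q - phi (pref p) p| < r].

(** Ensures that [chart_ball p r] corresponds to a full ball of R^n, hence is convex in
    coordinates. *)
Definition inside_chart p (r : R) : Prop :=
  forall u, `|u - phi (pref p) p| < r -> (phi (pref p) @` D (pref p)) u.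

Lemma open_chart_ball p r : open (chart_ball p r).
Proof.
rewrite openE => q [Dq qr].
have h := near_phi Dq (open_near (open_ball_norm (phi (pref p) p) r) qr).
by apply: filterS2 (open_near (open_D (pref p)) Dq) h => s Ds hs; split.
Qed.

Lemma chart_ball_center p r : 0 < r -> chart_ball p r p.
Proof. by move=> r0; split; [exact: pref_dom|rewrite subrr normr0]. Qed.

Lemma chart_ball_le p r s : r <= s -> chart_ball p r `<=` chart_ball p s.
Proof. by move=> rs q [Dq qr]; split=> //; exact: lt_le_trans rs. Qed.

Lemma chart_ball_small p (V : set M) : (\forall q \near p, V q) ->
  exists r, [/\ 0 < r, inside_chart p r & chart_ball p r `<=` V].
Proof.
move=> nV; have Dp := pref_dom p.
have oc : open (phi (pref p) @` D (pref p)) by exact: open_codom.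
have cp : (phi (pref p) @` D (pref p)) (phi (pref p) p) by exists p.
have [r r0 hr] := near_ball_norm (filterI (open_near oc cp) (near_psi Dp nV)).
exists r; split=> // [u /hr []//|q [Dq /hr [_]]].
by rewrite coordK.
Qed.

Lemma chart_ball_psi p r u : inside_chart p r ->
  `|u - phi (pref p) p| < r -> chart_ball p r (psi (pref p) u).
Proof.
move=> ir ur; have cu := ir _ ur; split; first exact: psi_D.
by rewrite psiK.
Qed.

Lemma chart_ball_dir0 p r (f : M -> R) : inside_chart p r ->
  (forall q, chart_ball p r q -> @chart_diff R n M R^o f (pref p) q) ->
  (forall q (v : tangent q), chart_ball p r q -> @dir R n M R^o f q v = 0) ->
  forall q s, chart_ball p r q -> chart_ball p r s -> f q = f s.
Proof.
move=> ir df d0 q s [Dq qr] [Ds sr].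
pose g u : 'M[R]_1 := (f (psi (pref p) u))%:M.
have h : g (phi (pref p) q) = g (phi (pref p) s).
  apply: (@ball_constant _ _ _ _ g (phi (pref p) p) r) => // u ur.
  have Bu := chart_ball_psi ir ur; have cu := ir _ ur.
  have dfu := df _ Bu; rewrite /chart_diff psiK // in dfu.
  apply: has_diff_mx => i j; rewrite !ord1.
  apply: has_diff_eq (has_diff_ext _ (has_diffE dfu)) _ => [y|v].
    by rewrite /g mxE eqxx mulr1n.
  rewrite mxE.
  have := d0 _ (frame (pref p) (psi (pref p) u) v) Bu.
  have Du := psi_D cu.
  rewrite (dir_chart _ Du) ?frameK ?psiK //; last exact: df.
by move: h => /matrixP /(_ 0 0); rewrite /g !mxE !eqxx !mulr1n !coordK.
Qed.

End ChartBalls.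

(** * Parallel frames of a flat connection *)

Section FlatFrame.
Variables (R : realType) (n : nat) (M : manifold R n) (r : nat) (E : vbundle M r).
Local Notation full := (fun p : M => fullv : {vspace fib E p}).
Variable (Dl : vfield M -> section E -> section E).
Hypothesis conn : is_connection full Dl.

Lemma Gamma_full (s : section E) : smooth_section s -> Gamma full s.
Proof. by move=> ss; split=> // p; exact: memvf. Qed.

(** Supplies the global section on which [Dl] can be evaluated when only local components are
    known. *)
Lemma local_section b (N : set M) p (h : M -> 'cV[R]_r) : open N -> N p ->
  N `<=` tdom b -> smooth_on N h ->
  exists S : section E, smooth_section S /\ \forall q \near p, S q = triv b q (h q).
Proof.
move=> oN Np Nb sh.
have [chi [K [sc c1 cK KN c0]]] := manifold_bump oN Np.
exists (fun q => chi q *: triv b q (h q)); split; last first.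
  by apply: filterS c1 => q ->; rewrite scale1r.
move=> b'; have [g [sg gE]] := triv_compat b b'.
exists (fun q => chi q *: (g q *m h q)); split.
  apply: (smooth_cut (V := N) (K := K)) => //; first exact: open_tdom.
  have oNb : open (N `&` tdom b') by apply: openI => //; exact: open_tdom.
  apply: smooth_on_mulmx => //; last exact: (smooth_on_sub (@subIsetl _ N _) sh).
  by apply: smooth_on_sub sg => q [Nq bq]; split=> //; exact: Nb.
move=> q b'q; have [Nq|nN] := pselect (N q).
  by rewrite (gE _ (Nb _ Nq) b'q) trivZ.
have -> : chi q = 0 by apply: c0 => /KN.
by rewrite !scale0r triv0.
Qed.

Section Local.
Variables (a : atlas M) (b : tidx E) (chi : M -> R^o) (K V1 : set M).
Hypotheses (sc : smooth_on setT chi) (cK : closed K) (KV : K `<=` D a `&` tdom b).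
Hypotheses (c0 : forall q, ~ K q -> chi q = 0) (oV1 : open V1).
Hypothesis (c1 : forall q, V1 q -> chi q = 1).

Let KD : K `<=` D a. Proof. by move=> q /KV []. Qed.
Let Kb : K `<=` tdom b. Proof. by move=> q /KV []. Qed.
Let V1K q : V1 q -> D a q /\ tdom b q.
Proof.
move=> /c1 c1q; apply: KV; apply: contrapT => /c0.
by rewrite c1q => /eqP; rewrite oner_eq0.
Qed.

(** Together with [cut_triv], global fields that coincide over [V1] with the coordinate fields and
    with the frame of the trivialization. *)
Definition cut_frame (i : 'I_n) : vfield M := fun q => chi q *: frame a q (delta_mx i 0).
Definition cut_triv (k : 'I_r) : section E := fun q => chi q *: triv b q (delta_mx k 0).
Local Notation X := cut_frame.
Local Notation t := cut_triv.

Lemma cut_frame_smoothf i : smooth_vfield (X i).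
Proof. exact: cut_frame_smooth cK KD sc c0. Qed.

Lemma cut_triv_smoothf k : smooth_section (t k).
Proof. exact: cut_triv_smooth cK Kb sc c0. Qed.

Lemma tcoord_cut_frame i q : V1 q -> tcoord a (X i q) = delta_mx i 0.
Proof.
by move=> Vq; rewrite /X c1 // scale1r frameK //; have [] := V1K Vq.
Qed.

Variable c : 'I_n -> 'I_r -> M -> 'cV[R]_r.
Hypothesis cs : forall i k, smooth_on (tdom b) (c i k).
Hypothesis cE : forall i k p, tdom b p -> Dl (X i) (t k) p = triv b p (c i k p).

Definition christoffel (i : 'I_n) (p : M) : 'M[R]_r := \matrix_(l, k) c i k p l 0.

(** [S] has the germ of a combination of the [cut_triv] fields with global coefficients, so the
    Leibniz rule yields the usual local expression: partial derivative plus Christoffel term. *)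
Lemma conn_formula (S : section E) (h : M -> 'cV[R]_r) (N : set M) p i :
  open N -> N p -> N `<=` V1 -> smooth_on N h -> smooth_section S ->
  (\forall q \near p, S q = triv b q (h q)) ->
  Dl (X i) S p = triv b p ('D_(delta_mx i 0) (h \o psi a) (phi a p)
     + christoffel i p *m h p).
Proof.
move=> oN Np NV sh sS Sh; have Vp := NV _ Np; have [Da bp] := V1K Vp.
have [chi2 [K2 [sc2 c12 cK2 KN2 c02]]] := manifold_bump oN Np.
pose f k q : R^o := chi2 q *: (h q k 0 : R^o).
have sf k : smooth_on setT (f k).
  apply: (smooth_cut (V := N) (K := K2)) => //; first exact: openT.
  by rewrite setIT; exact: smooth_on_entry.
have nN := open_near oN Np.
pose S' q := \sum_k f k q *: t k q.
have sS' : smooth_section S'.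
  apply: (@smooth_section_sum _ _ _ _ _ _ _ _ (fun k q => f k q *: t k q)) => k _.
  apply: smooth_section_scale => //; exact: cut_triv_smoothf.
have SS' : \forall q \near p, S q = S' q.
  apply: filterS2 (filterI Sh c12) nN => q [-> c2q] Nq.
  have [_ bq] := V1K (NV _ Nq).
  rewrite {1}(cV_sum_delta (h q)) triv_sum //; apply: eq_bigr => k _.
  by rewrite /f c2q scale1r trivZ // /t c1 ?scale1r //; exact: NV.
rewrite (conn_local conn (cut_frame_smoothf i) (Gamma_full sS) (Gamma_full sS') SS').
rewrite (conn_sum_sect conn _ p (cut_frame_smoothf i) sf (fun k => Gamma_full (cut_triv_smoothf k))).
have dh : chart_diff h a p := smooth_chart_diff sh Da Np.
have dk k : dir (f k) (X i p) = ('D_(delta_mx i 0) (h \o psi a) (phi a p)) k 0.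
  have fh : \forall q \near p, (h q k 0 : R^o) = f k q.
    by apply: filterS c12 => q c2q; rewrite /f c2q scale1r.
  have hk := has_diff_entry k 0 (has_diffE dh).
  rewrite -(dir_near (X i p) fh) (dir_chart (W := R^o) _ Da); last by have [] := hk.
  by rewrite tcoord_cut_frame //; have [_ ->] := hk.
have e : 'D_(delta_mx i 0) (h \o psi a) (phi a p) + christoffel i p *m h p
  = \sum_k (('D_(delta_mx i 0) (h \o psi a) (phi a p)) k 0 *: delta_mx k 0
            + h p k 0 *: c i k p).
  rewrite big_split -cV_sum_delta; congr (_ + _).
  apply/matrixP => l m; rewrite !ord1 mxE summxE; apply: eq_bigr => k _.
  by rewrite !mxE mulrC.
rewrite e triv_sum //; apply: eq_bigr => k _.
rewrite trivD // !trivZ // dk cE // /t c1 // scale1r; congr (_ + _ *: _).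
by rewrite /f (nbhs_singleton c12) scale1r.
Qed.

Hypothesis flatD : flat full Dl.

Lemma cut_frame_bracket i j p : V1 p -> lie_bracket (X i) (X j) p = 0.
Proof.
move=> Vp; have [Da bp] := V1K Vp.
apply: (tcoord_inj Da).
apply: (etrans (lie_bracket_coord (cut_frame_smoothf i) (cut_frame_smoothf j) Da)).
have d0 k (v : tangent p) : dir (fun q => tcoord a (X k q)) v = 0.
  rewrite (dir_near (g := fun=> delta_mx k 0)); first by rewrite dirE; exact: derive_cst.
  by apply: filterS (open_near oV1 Vp) => q Vq; exact: tcoord_cut_frame.
have t0 : tcoord a (0 : tangent p) = 0 by rewrite /tcoord dirE derive0.
apply: (etrans (congr2 (fun x y : 'cV[R]_n => x - y) (d0 j (X i p)) (d0 i (X j p)))).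
by rewrite subrr t0.
Qed.

(** Column [k] of the vanishing curvature matrix, obtained by applying flatness to a frame section;
    the coordinate fields commute over [V1], so there is no bracket term. *)
Lemma christoffel_flat i j k p : V1 p ->
  'D_(delta_mx i 0) (c j k \o psi a) (phi a p) + christoffel i p *m c j k p
  = 'D_(delta_mx j 0) (c i k \o psi a) (phi a p) + christoffel j p *m c i k p.
Proof.
move=> Vp; have [Da bp] := V1K Vp.
have sX := cut_frame_smoothf; have Gt := Gamma_full (cut_triv_smoothf k).
have := flatD (sX i) (sX j) Gt p.
rewrite (conn_vfield_eq0 conn (lie_bracket_smooth (sX i) (sX j)) Gt); last first.
  exact: cut_frame_bracket.
rewrite subr0 => e0.
have F i' j' : Dl (X i') (Dl (X j') (t k)) p = triv b p
  ('D_(delta_mx i' 0) (c j' k \o psi a) (phi a p) + christoffel i' p *m c j' k p).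
  apply: (conn_formula (N := V1)) => //.
  - by apply: smooth_on_sub (cs j' k) => q /V1K [].
  - by have [] := conn_Gamma conn (sX j') Gt.
  - by apply: filterS (open_near oV1 Vp) => q /V1K [_ bq]; exact: cE.
have e1 : Dl (X i) (Dl (X j) (t k)) p = Dl (X j) (Dl (X i) (t k)) p.
  exact: subr0_eq e0.
have Fij := F i j; have Fji := F j i.
have e2 := etrans (esym Fij) (etrans e1 Fji).
exact: (triv_inj bp e2).
Qed.

Lemma local_parallel p0 : V1 p0 ->
  exists G : 'cV[R]_n -> 'M[R]_r, exists s : R, [/\ 0 < s, G (phi a p0) = 1%:M,
    (forall u, `|u - phi a p0| < s -> (phi a @` (D a `&` V1)) u) &
    forall (w : 'cV[R]_r) q, D a q -> `|phi a q - phi a p0| < s ->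
      exists S : section E, [/\ smooth_section S,
        \forall q' \near q, S q' = triv b q' (G (phi a q') *m w) &
        forall Y, smooth_vfield Y -> Dl Y S q = 0]].
Proof.
move=> Vp; have [Da bp] := V1K Vp.
pose U := phi a @` (D a `&` V1).
have oU : open U by exact: open_cimg.
have Uu : U (phi a p0) by exact: cimg_coord.
(* A section with components [h] is parallel when dh is minus the Christoffel term, whence the
   sign. *)
pose A i u : 'M[R]_r := - christoffel i (psi a u).
have sG i : smooth_on V1 (christoffel i).
  apply: smooth_on_mx => // l k.
  have sck : smooth_on V1 (c i k) by apply: smooth_on_sub (cs i k) => q /V1K [].
  by apply: smooth_on_ext (smooth_on_entry l 0 oV1 sck) => // q _; rewrite mxE.
have CA i : Cinfty U (A i) by apply: Cinfty_opp => //; exact: sG.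
have Ac i u l k : A i u l k = - (c i k (psi a u) l 0) by rewrite !mxE.
have dA i j u l k : U u -> ('D_(delta_mx i 0) (A j) u) l k
    = - ('D_(delta_mx i 0) (c j k \o psi a) u) l 0.
  move=> /[dup] Uu' /cimgP [cu Vu]; have [Du bu] := V1K Vu.
  have [_ <-] := has_diff_entry l k (has_diffE (Cinfty_diff (CA j) Uu')).
  have dc : chart_diff (c j k) a (psi a u) := smooth_chart_diff (cs j k) Du bu.
  rewrite /chart_diff psiK // in dc.
  have h := has_diffN (has_diff_entry l 0 (has_diffE dc)).
  have [|_ ->] := has_diff_ext (g := fun y => A j y l k : R^o) _ h; last by [].
  by move=> y; rewrite Ac.
have [x i j Ux|G [G1 nG]] := @frobenius R n r U (phi a p0) A oU Uu CA.
  apply/matrixP => l k.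
  have /cimgP [cx Vx] := Ux.
  have := christoffel_flat i j k Vx; rewrite psiK // => /matrixP /(_ l 0).
  have eM i' j' : (A i' x *m A j' x) l k = (christoffel i' (psi a x) *m c j' k (psi a x)) l 0.
    by rewrite mulNmx mulmxN opprK !mxE; apply: eq_bigr => q _; rewrite !mxE.
  have mxB (Y Z : 'M[R]_r) l' k' : (Y - Z) l' k' = Y l' k' - Z l' k' by rewrite !mxE.
  rewrite !mxB !eM !dA // [LHS]mxE [RHS]mxE.
  move: (('D_(delta_mx i 0) (c j k \o psi a) x) l 0) (('D_(delta_mx j 0) (c i k \o psi a) x) l 0).
  by move=> d1 d2 e; lra.
have [s1 s10 h1] := near_ball_norm nG.
have [s2 s20 h2] := near_ball_norm (open_near oU Uu).
pose s := Num.min s1 s2.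
have s0 : 0 < s by rewrite lt_min s10.
exists G, s; split=> //.
  by move=> u; rewrite lt_min => /andP[_]; exact: h2.
move=> w q Dq qs.
pose B := [set u | `|u - phi a p0| < s].
have oB : open B by exact: open_ball_norm.
have BU : B `<=` U by move=> u; rewrite /B /= lt_min => /andP[_]; exact: h2.
have hG u : B u -> has_diff G u (fun v => (\sum_i v i 0 *: A i u) *m G u).
  by rewrite /B /= lt_min => /andP[+ _]; exact: h1.
have CG : Cinfty B G.
  by apply: Cinfty_linear_system hG => // i; exact: Cinfty_sub (CA i).
pose N := [set q' | D a q' /\ B (phi a q')].
have oN : open N.
  rewrite openE => q' [Dq' Bq'].
  apply: filterS2 (open_near (open_D a) Dq') (near_phi Dq' (open_near oB Bq')).
  by move=> z; split.
have NV : N `<=` V1.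
  by move=> q' [Dq' /BU /cimgP [_]]; rewrite coordK.
have Nq : N q by [].
pose h q' := G (phi a q') *m w.
have sh : smooth_on N h.
  apply: smooth_on_mulmx => //; last exact: smooth_on_cst.
  by apply: (smooth_on_comp_coord (U' := B)) => // z [].
have [S [sS Sh]] := local_section oN Nq (fun z Nz => proj2 (V1K (NV z Nz))) sh.
exists S; split=> // Y sY.
have [_ bq] := V1K (NV _ Nq).
rewrite (conn_tensorial conn sY (Gamma_full sS) sc cK KD c0 (c1 (NV _ Nq))).
apply: big1 => i _.
rewrite -/(X i) (conn_formula i oN Nq NV sh sS Sh).
have -> : 'D_(delta_mx i 0) (h \o psi a) (phi a q) + christoffel i q *m h q = 0.
  have hGw := has_diff_mulmx (hG _ qs) (has_diff_cst w (phi a q)).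
  have [|_ ->] := has_diff_near (g := h \o psi a) _ hGw.
    have oc : open (phi a @` D a) by exact: open_codom.
    have cq : (phi a @` D a) (phi a q) by exists q.
    by apply: filterS (open_near oc cq) => u cu; rewrite /= /h psiK.
  by rewrite sum_delta_scale mulmx0 add0r /A coordK // -mulmxA mulNmx addNr.
by rewrite triv0 // scaler0.
Qed.

End Local.

(** The radius is chosen before [v]: one fundamental matrix, equal to 1 at the centre, transports
    every initial vector. *)
Theorem flat_parallel_frame (p0 : M) : flat full Dl ->
  exists rho : R, [/\ 0 < rho, inside_chart p0 rho &
    forall v : fib E p0, exists s : section E, s p0 = v /\
      parallel_on full Dl (chart_ball p0 rho) s].
Proof.
move=> flatD; pose a := pref p0; have Da : D a p0 := pref_dom p0.
have [b bp] := tdom_cover E p0.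
have oV : open (D a `&` tdom b) by apply: openI; [exact: open_D|exact: open_tdom].
have [chi [K [sc c1 cK KV c0]]] := manifold_bump oV (conj Da bp).
pose V1 := [set q | chi q = 1]^°.
have oV1 : open V1 by exact: open_interior.
have c1' q : V1 q -> chi q = 1 by move=> /interior_subset.
have KD : K `<=` D a by move=> q /KV [].
have Kb : K `<=` tdom b by move=> q /KV [].
have ex (ik : 'I_n * 'I_r) : exists c : M -> 'cV[R]_r, smooth_on (tdom b) c /\
    forall p, tdom b p -> Dl (cut_frame a chi ik.1) (cut_triv b chi ik.2) p = triv b p (c p).
  have sX := cut_frame_smooth (delta_mx ik.1 0) cK KD sc c0.
  have Gt := Gamma_full (cut_triv_smooth (delta_mx ik.2 0) cK Kb sc c0).
  by have [ss _] := conn_Gamma conn sX Gt; exact: ss b.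
have [c hc] := choice ex.
have cs i k : smooth_on (tdom b) (c (i, k)) by have [] := hc (i, k).
have cE i k p : tdom b p -> Dl (cut_frame a chi i) (cut_triv b chi k) p = triv b p (c (i, k) p).
  by have [_ h] := hc (i, k); exact: h.
have Vp0 : V1 p0 by exact: c1.
have [G [s [s0 G1 sU hS]]] :=
  @local_parallel a b chi K V1 sc cK KV c0 oV1 c1' (fun i k => c (i, k)) cs cE flatD p0 Vp0.
exists s; split=> //; first by move=> u /sU /cimgP [].
move=> v; have [g gK Kg] := triv_bij bp.
exists (fun q => triv b q (G (phi a q) *m g v)); split; first by rewrite G1 mul1mx Kg.
move=> q [Dq qs]; have [S [sS nS dS]] := hS (g v) q Dq qs.
by exists S; split=> //; exact: Gamma_full.
Qed.

End FlatFrame.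

(** * Para-Hermitian bundles *)

Section ParaHermitianAlgebra.
Variables (R : realType) (n : nat) (M : manifold R n) (E : para_hermitian M).
Implicit Types (p : M).

Lemma EplusP p (u : fib E p) : reflect (Defs.inv E p u = u) (u \in Eplus E p).
Proof.
rewrite /Eplus /passmx.leigenspace memv_ker add_lfunE opp_lfunE scale_lfunE id_lfunE.
by rewrite scale1r subr_eq0; exact: eqP.
Qed.

Lemma EminusP p (u : fib E p) : reflect (Defs.inv E p u = - u) (u \in Eminus E p).
Proof.
rewrite /Eminus /passmx.leigenspace memv_ker add_lfunE opp_lfunE scale_lfunE id_lfunE.
by rewrite scaleN1r opprK addr_eq0; exact: eqP.
Qed.

Lemma double_eq0 (V : lmodType R) (u : V) : u + u = 0 -> u = 0.
Proof.
rewrite -mulr2n -scaler_nat => /eqP; rewrite scaler_eq0 pnatr_eq0 /=.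
by move=> /eqP.
Qed.

Lemma half_double (V : lmodType R) (u : V) : 2^-1 *: (u + u) = u.
Proof.
rewrite scalerDr -scalerDl (_ : 2^-1 + 2^-1 = 1) ?scale1r //.
by have := splitr (1 : R); rewrite !mul1r.
Qed.

Lemma Eplus_Eminus0 p : (Eplus E p :&: Eminus E p = 0)%VS.
Proof.
apply/eqP; rewrite -subv0; apply/subvP => u; rewrite memv_cap => /andP[/EplusP h1 /EminusP].
rewrite h1 memv0 => h2; apply/eqP; apply: double_eq0.
by rewrite {2}h2 subrr.
Qed.

Lemma Eminus_Eplus0 p : (Eminus E p :&: Eplus E p = 0)%VS.
Proof. by rewrite capvC Eplus_Eminus0. Qed.

Lemma pi_plus_mem p u : pi_plus E p u \in Eplus E p.
Proof. exact: memv_pi. Qed.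

Lemma pi_minus_mem p u : pi_minus E p u \in Eminus E p.
Proof. exact: memv_pi. Qed.

Lemma pi_add p u : pi_plus E p u + pi_minus E p u = u.
Proof.
by apply: daddv_pi_add; [exact: Eplus_Eminus0|rewrite [(_ + _)%VS]eig_sum memvf].
Qed.

Lemma pi_plus_id p u : u \in Eplus E p -> pi_plus E p u = u.
Proof. by apply: daddv_pi_id; exact: Eplus_Eminus0. Qed.

Lemma pi_minus_id p u : u \in Eminus E p -> pi_minus E p u = u.
Proof. by apply: daddv_pi_id; exact: Eminus_Eplus0. Qed.

Lemma pi_plus0 p u : u \in Eminus E p -> pi_plus E p u = 0.
Proof.
move=> /pi_minus_id h; have := pi_add u; rewrite h => /(congr1 (fun x => x - u)).
by rewrite addrK subrr.
Qed.

Lemma pi_minus0 p u : u \in Eplus E p -> pi_minus E p u = 0.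
Proof.
move=> /pi_plus_id h; have := pi_add u; rewrite h => /(congr1 (fun x => - u + x)).
by rewrite addKr addNr.
Qed.

Lemma inv_pi p u : Defs.inv E p u = pi_plus E p u - pi_minus E p u.
Proof.
rewrite -{1}(pi_add u) linearD /=.
by rewrite (EplusP _ (pi_plus_mem u)) (EminusP _ (pi_minus_mem u)).
Qed.

Lemma pi_plusE p u : pi_plus E p u = 2^-1 *: (u + Defs.inv E p u).
Proof.
rewrite inv_pi -{2}[u]pi_add addrACA subrr addr0.
by rewrite half_double.
Qed.

Lemma tauZl p c (u v : fib E p) : tau (c *: u) v = c * tau u v.
Proof.
have t0 : tau 0 v = 0.
  have := tau_linear v 1 0 0; rewrite scale1r addr0 mul1r.
  by move=> /(congr1 (fun x => x - tau 0 v)); rewrite addrK subrr => <-.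
by rewrite -[c *: u]addr0 tau_linear t0 addr0.
Qed.

Lemma tauDl p (u u' v : fib E p) : tau (u + u') v = tau u v + tau u' v.
Proof. by rewrite -[u]scale1r tau_linear mul1r scale1r. Qed.

Lemma tau0l p (v : fib E p) : tau 0 v = 0.
Proof. by rewrite -(scale0r 0) tauZl mul0r. Qed.

Lemma tauNl p (u v : fib E p) : tau (- u) v = - tau u v.
Proof. by rewrite -scaleN1r tauZl mulN1r. Qed.

Lemma tauZr p c (u v : fib E p) : tau u (c *: v) = c * tau u v.
Proof. by rewrite tau_sym tauZl tau_sym. Qed.

Lemma tauDr p (u v v' : fib E p) : tau u (v + v') = tau u v + tau u v'.
Proof. by rewrite tau_sym tauDl !(tau_sym _ u). Qed.

Lemma tau0r p (u : fib E p) : tau u 0 = 0.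
Proof. by rewrite tau_sym tau0l. Qed.

Lemma tauNr p (u v : fib E p) : tau u (- v) = - tau u v.
Proof. by rewrite tau_sym tauNl tau_sym. Qed.

Lemma tau_suml p I (r : seq I) (P : pred I) (F : I -> fib E p) v :
  tau (\sum_(i <- r | P i) F i) v = \sum_(i <- r | P i) tau (F i) v.
Proof.
elim: r => [|i r IH]; first by rewrite !big_nil tau0l.
by rewrite !big_cons; case: ifP => // _; rewrite tauDl IH.
Qed.

Lemma tau_sumr p I (r : seq I) (P : pred I) (F : I -> fib E p) u :
  tau u (\sum_(i <- r | P i) F i) = \sum_(i <- r | P i) tau u (F i).
Proof. by rewrite tau_sym tau_suml; apply: eq_bigr => i _; exact: tau_sym. Qed.

(** On an eigenbundle, the skewness of the involution reads 2 tau(u, v) = 0 up to sign. *)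
Lemma tau_plus p (u v : fib E p) : u \in Eplus E p -> v \in Eplus E p -> tau u v = 0.
Proof.
move=> /EplusP hu /EplusP hv; have := inv_tau (p0 := E) u v.
by rewrite hu hv; lra.
Qed.

Lemma tau_minus p (u v : fib E p) : u \in Eminus E p -> v \in Eminus E p -> tau u v = 0.
Proof.
move=> /EminusP hu /EminusP hv; have := inv_tau (p0 := E) u v.
by rewrite hu hv tauNl tauNr; lra.
Qed.

Lemma dim_fib p : \dim (fullv : {vspace fib E p}) = (2 * n)%N.
Proof.
have [b bp] := tdom_cover E p.
pose lM := GRing.isLinear.Build _ _ _ _ _ (triv_linear bp).
pose L : {linear 'cV[R]_(2 * n) -> fib E p} := HB.pack (triv b p) lM.
have [g gK Kg] := triv_bij bp.
have k0 : lker (linfun L) == 0%VS.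
  by apply/lker0P => v w; rewrite !lfunE /=; exact: (can_inj gK).
have im : limg (linfun L) = fullv.
  apply/eqP; rewrite eqEsubv subvf; apply/subvP => u _.
  by rewrite -(Kg u) -[triv b p _]/(L _) -lfunE memv_img // memvf.
rewrite -im limg_dim_eq; first by rewrite dimvf dim_matrix; exact: muln1.
by rewrite (eqP k0) capv0.
Qed.

Lemma dim_Eplus p : \dim (Eplus E p) = n.
Proof.
have := dimv_disjoint_sum (Eplus_Eminus0 p).
have er : \dim (Eminus E p) = \dim (Eplus E p) := esym (eig_rank E p).
rewrite [(_ + _)%VS]eig_sum dim_fib er.
by move=> /eqP; rewrite addnn -mul2n eqn_pmul2l // => /eqP <-.
Qed.

Lemma dim_Eminus p : \dim (Eminus E p) = n.
Proof. by rewrite -[LHS](eig_rank E p); exact: dim_Eplus. Qed.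

Section DualFrames.
Variables (p : M) (e f : 'I_n -> fib E p).
Hypotheses (eE : forall i, e i \in Eplus E p) (fE : forall i, f i \in Eminus E p).
Hypothesis dual : forall i j, tau (e i) (f j) = (i == j)%:R / 2%:R.

Lemma tau_dual_suml (x : 'I_n -> R) j : tau (\sum_i x i *: e i) (f j) = x j / 2.
Proof.
rewrite tau_suml (bigD1 j) //= big1 => [|i ij].
  by rewrite tauZl dual eqxx addr0 mulrA mulr1.
by rewrite tauZl dual (negbTE ij) mul0r mulr0.
Qed.

Lemma tau_dual_sumr (x : 'I_n -> R) j : tau (e j) (\sum_i x i *: f i) = x j / 2.
Proof.
rewrite tau_sumr (bigD1 j) //= big1 => [|i ij].
  by rewrite tauZr dual eqxx addr0 mulrA mulr1.
by rewrite tauZr dual eq_sym (negbTE ij) mul0r mulr0.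
Qed.

(** Since [l] recovers the coefficients of a combination, the [g i] are free, hence a basis by
    dimension. *)
Lemma free_span_dim (F : {vspace fib E p}) (g : 'I_n -> fib E p) (l : fib E p -> 'I_n -> R) :
  (forall i, g i \in F) -> \dim F = n ->
  (forall x j, l (\sum_i x i *: g i) j = x j) ->
  forall u, u \in F -> u = \sum_i l u i *: g i.
Proof.
move=> gF dF lg u uF.
pose X := [tuple g i | i < n].
have Xi (i : 'I_n) : X`_i = g i by rewrite (nth_map i) ?size_enum_ord // nth_ord_enum.
have sX (x : 'I_n -> R) : \sum_i x i *: X`_i = \sum_i x i *: g i.
  by apply: eq_bigr => i _; rewrite Xi.
have fX : free X.
  apply/freeP => x; rewrite sX => x0 i.
  have l0 j : l 0 j = 0.
    have := lg (fun=> 0) j; rewrite big1 // => k _; exact: scale0r.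
  by rewrite -(lg x i) x0.
have bX : basis_of F X.
  rewrite basisEfree fX dF size_tuple leqnn andbT /=.
  by apply/span_subvP => v /mapP [i _ ->].
have uX : u \in <<X>>%VS by rewrite (span_basis bX).
have [y ->] : exists y : 'I_n -> R, u = \sum_i y i *: g i.
  by exists (fun i => vector.coord X i u); rewrite -sX; exact: coord_span.
by apply: eq_bigr => i _; rewrite lg.
Qed.

Lemma Eplus_dual_frame u : u \in Eplus E p ->
  u = \sum_i (2 * tau u (f i)) *: e i.
Proof.
apply: (free_span_dim (l := fun u i => 2 * tau u (f i)) eE (dim_Eplus p)) => x j.
by rewrite tau_dual_suml mulrC divfK ?pnatr_eq0.
Qed.

Lemma Eminus_dual_frame u : u \in Eminus E p ->
  u = \sum_i (2 * tau (e i) u) *: f i.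
Proof.
apply: (free_span_dim (l := fun u i => 2 * tau (e i) u) fE (dim_Eminus p)) => x j.
by rewrite tau_dual_sumr mulrC divfK ?pnatr_eq0.
Qed.

End DualFrames.

(** Take bases of both eigenspaces and correct the second by half the inverse of the pairing matrix
    [T]. A vector in the kernel of [T] would give an element of E^+ orthogonal to E^-; as E^+ is
    isotropic, nondegeneracy forces it to vanish. *)
Lemma dual_frame_exists p : exists e f : 'I_n -> fib E p,
  [/\ forall i, e i \in Eplus E p, forall i, f i \in Eminus E p &
      forall i j, tau (e i) (f j) = (i == j)%:R / 2%:R].
Proof.
pose e (i : 'I_n) : fib E p := (vbasis (Eplus E p))`_i.
pose f (i : 'I_n) : fib E p := (vbasis (Eminus E p))`_i.
have szE : size (vbasis (Eplus E p)) = n by rewrite size_tuple dim_Eplus.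
have szF : size (vbasis (Eminus E p)) = n by rewrite size_tuple dim_Eminus.
have eE i : e i \in Eplus E p by apply: vbasis_mem; rewrite mem_nth // szE.
have fE i : f i \in Eminus E p by apply: vbasis_mem; rewrite mem_nth // szF.
pose T : 'M[R]_n := \matrix_(i, j) tau (e i) (f j).
have span_f u : u \in Eminus E p -> exists x : 'I_n -> R, u = \sum_i x i *: f i.
  move=> uF; exists (fun i => vector.coord (vbasis (Eminus E p)) (cast_ord (esym (dim_Eminus p)) i) u).
  rewrite {1}(coord_vbasis uF) (reindex (cast_ord (esym (dim_Eminus p)))) /=; last first.
    by exists (cast_ord (dim_Eminus p)) => i _; rewrite ?cast_ordK ?cast_ordKV.
  by [].
have free_e (x : 'I_n -> R) : \sum_i x i *: e i = 0 -> forall i, x i = 0.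
  move=> x0 i.
  have fb := basis_free (vbasisP (Eplus E p)).
  have := freeP fb (fun k => x (cast_ord (dim_Eplus p) k)).
  move=> /(_ _ (cast_ord (esym (dim_Eplus p)) i)); rewrite cast_ordKV; apply.
  rewrite -[RHS]x0 [RHS](reindex (cast_ord (dim_Eplus p))) //=.
  by exists (cast_ord (esym (dim_Eplus p))) => k _; rewrite ?cast_ordK ?cast_ordKV.
have fT : T \in unitmx.
  rewrite -row_free_unit -kermx_eq0; apply/eqP.
  apply/row_matrixP => k; set x := row k (kermx T); rewrite row0.
    have xT : x *m T = 0 by rewrite /x -row_mul mulmx_ker row0.
    clearbody x.
    pose u := \sum_i x 0 i *: e i.
    have uE : u \in Eplus E p by apply: memv_suml => i _; exact: memvZ.
    have ufj j : tau u (f j) = 0.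
      have /matrixP /(_ 0 j) := xT; rewrite mxE [X in _ = X]mxE => <-.
      by rewrite /u tau_suml; apply: eq_bigr => i _; rewrite tauZl mxE.
    have u0 : u = 0.
      apply: tau_nondeg => v; rewrite -(pi_add v) tauDr.
      rewrite (tau_plus uE (pi_plus_mem v)) add0r.
      have [y ->] := span_f _ (pi_minus_mem v).
      by rewrite tau_sumr big1 // => j _; rewrite tauZr ufj mulr0.
    apply/rowP => i; rewrite [RHS]mxE; exact: (free_e (fun i => x 0 i) u0 i).
pose B := 2^-1 *: invmx T.
exists e, (fun j => \sum_k B k j *: f k); split=> //.
  by move=> j; apply: memv_suml => k _; exact: memvZ.
move=> i j; rewrite tau_sumr.
have -> : (i == j)%:R / 2%:R = (T *m B) i j.
  by rewrite /B -scalemxAr mulmxV // !mxE mulrC.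
rewrite mxE; apply: eq_bigr => k _; rewrite tauZr mulrC; congr (_ * _).
by rewrite mxE.
Qed.

End ParaHermitianAlgebra.

(** * The sum of the two connections on E *)

Section SplitConnection.
Variables (R : realType) (n : nat) (M : manifold R n) (C : quasi_codazzi M).
Local Notation full := (fun p : M => fullv : {vspace fib C p}).

Lemma smooth_inv (s : section C) : smooth_section s ->
  smooth_section (fun p => Defs.inv C p (s p)).
Proof.
move=> ss b; have [c [sc cE]] := ss b; have [J [sJ JE]] := inv_smooth (p0 := C) b.
exists (fun p => J p *m c p); split.
  by apply: smooth_on_mulmx => //; exact: open_tdom.
by move=> p bp; rewrite cE // JE.
Qed.

Lemma smooth_pi_plus (s : section C) : smooth_section s ->
  smooth_section (fun p => pi_plus C p (s p)).
Proof.
move=> ss.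
have -> : (fun p => pi_plus C p (s p)) = (fun p => (2^-1 : R^o) *: (s p + Defs.inv C p (s p))).
  by apply/functional_extensionality_dep => p; rewrite pi_plusE.
apply: (@smooth_section_scale _ _ _ _ _ (fun=> 2^-1 : R^o)).
  exact: smooth_on_cst.
by apply: smooth_section_add => //; exact: smooth_inv.
Qed.

Lemma smooth_pi_minus (s : section C) : smooth_section s ->
  smooth_section (fun p => pi_minus C p (s p)).
Proof.
move=> ss.
have -> : (fun p => pi_minus C p (s p)) = (fun p => s p + (-1 : R^o) *: pi_plus C p (s p)).
  apply/functional_extensionality_dep => p; rewrite scaleN1r -[in s p]/(s p).
  by rewrite -{2}(pi_add (s p)) addrAC subrr add0r.
apply: smooth_section_add => //.
apply: (@smooth_section_scale _ _ _ _ _ (fun=> -1 : R^o)).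
  exact: smooth_on_cst.
exact: smooth_pi_plus.
Qed.

Lemma Gamma_plus (s : section C) : smooth_section s ->
  Gamma (Eplus C) (fun p => pi_plus C p (s p)).
Proof. by move=> ss; split; [exact: smooth_pi_plus|move=> p; exact: pi_plus_mem]. Qed.

Lemma Gamma_minus (s : section C) : smooth_section s ->
  Gamma (Eminus C) (fun p => pi_minus C p (s p)).
Proof. by move=> ss; split; [exact: smooth_pi_minus|move=> p; exact: pi_minus_mem]. Qed.

(* [E^+] and [E^-] come without local trivializations, so parallel frames are
   produced on [E] and then projected. *)
Definition split_conn (X : vfield M) (s : section C) : section C := fun p =>
  nabla_plus C X (fun q => pi_plus C q (s q)) p
  + nabla_minus C X (fun q => pi_minus C q (s q)) p.

Lemma split_conn_is_connection : is_connection full split_conn.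
Proof.
have cp := nabla_plus_conn C; have cm := nabla_minus_conn C.
split.
- move=> X s sX [ss _]; apply: Gamma_full; apply: smooth_section_add.
    by have [] := conn_Gamma cp sX (Gamma_plus ss).
  by have [] := conn_Gamma cm sX (Gamma_minus ss).
- move=> X Y s sX sY [ss _] p.
  rewrite /split_conn (conn_addl cp sX sY (Gamma_plus ss)).
  by rewrite (conn_addl cm sX sY (Gamma_minus ss)) addrACA.
- move=> f X s sf sX [ss _] p.
  rewrite /split_conn (conn_scalel cp sf sX (Gamma_plus ss)).
  by rewrite (conn_scalel cm sf sX (Gamma_minus ss)) scalerDr.
- move=> X s t sX [ss _] [st _] p; rewrite /split_conn.
  have -> : (fun q => pi_plus C q (s q + t q)) = (fun q => pi_plus C q (s q) + pi_plus C q (t q)).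
    by apply/functional_extensionality_dep => q; rewrite linearD.
  have -> : (fun q => pi_minus C q (s q + t q)) = (fun q => pi_minus C q (s q) + pi_minus C q (t q)).
    by apply/functional_extensionality_dep => q; rewrite linearD.
  rewrite (conn_addr cp sX (Gamma_plus ss) (Gamma_plus st)).
  by rewrite (conn_addr cm sX (Gamma_minus ss) (Gamma_minus st)) addrACA.
- move=> f X s sf sX [ss _] p; rewrite /split_conn.
  have -> : (fun q => pi_plus C q (f q *: s q)) = (fun q => f q *: pi_plus C q (s q)).
    by apply/functional_extensionality_dep => q; rewrite linearZ.
  have -> : (fun q => pi_minus C q (f q *: s q)) = (fun q => f q *: pi_minus C q (s q)).
    by apply/functional_extensionality_dep => q; rewrite linearZ.
  rewrite (conn_leibniz cp sf sX (Gamma_plus ss)).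
  rewrite (conn_leibniz cm sf sX (Gamma_minus ss)) addrACA -scalerDr pi_add.
  by rewrite -scalerDr.
Qed.

Lemma pi_plus_split_conn X (s : section C) p : smooth_vfield X -> smooth_section s ->
  pi_plus C p (split_conn X s p) = nabla_plus C X (fun q => pi_plus C q (s q)) p.
Proof.
move=> sX ss; rewrite /split_conn linearD /=.
have [_ hp] := conn_Gamma (nabla_plus_conn C) sX (Gamma_plus ss).
have [_ hm] := conn_Gamma (nabla_minus_conn C) sX (Gamma_minus ss).
by rewrite pi_plus_id // pi_plus0 // addr0.
Qed.

Lemma pi_minus_split_conn X (s : section C) p : smooth_vfield X -> smooth_section s ->
  pi_minus C p (split_conn X s p) = nabla_minus C X (fun q => pi_minus C q (s q)) p.
Proof.
move=> sX ss; rewrite /split_conn linearD /=.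
have [_ hp] := conn_Gamma (nabla_plus_conn C) sX (Gamma_plus ss).
have [_ hm] := conn_Gamma (nabla_minus_conn C) sX (Gamma_minus ss).
by rewrite pi_minus0 // pi_minus_id // add0r.
Qed.

Hypothesis flat_plus : flat (Eplus C) (nabla_plus C).
Hypothesis flat_minus : flat (Eminus C) (nabla_minus C).

Lemma sub3_add0 (V : zmodType) (c1 c2 c3 a1 a2 a3 b1 b2 b3 : V) :
  c1 = a1 + b1 -> c2 = a2 + b2 -> c3 = a3 + b3 ->
  a1 - a2 - a3 = 0 -> b1 - b2 - b3 = 0 -> c1 - c2 - c3 = 0.
Proof.
move=> -> -> -> ha hb; rewrite !opprD.
by rewrite (addrACA a1) (addrACA (a1 - a2)) ha hb addr0.
Qed.

Lemma split_conn_flat : flat full split_conn.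
Proof.
move=> X Y s sX sY [ss _] p.
have e1 Z : smooth_vfield Z -> (fun q => pi_plus C q (split_conn Z s q))
    = nabla_plus C Z (fun q => pi_plus C q (s q)).
  by move=> sZ; apply/functional_extensionality_dep => q; rewrite pi_plus_split_conn.
have e2 Z : smooth_vfield Z -> (fun q => pi_minus C q (split_conn Z s q))
    = nabla_minus C Z (fun q => pi_minus C q (s q)).
  by move=> sZ; apply/functional_extensionality_dep => q; rewrite pi_minus_split_conn.
have e3 Z1 Z2 : smooth_vfield Z1 -> smooth_vfield Z2 ->
    split_conn Z1 (split_conn Z2 s) p
    = nabla_plus C Z1 (nabla_plus C Z2 (fun q => pi_plus C q (s q))) p
      + nabla_minus C Z1 (nabla_minus C Z2 (fun q => pi_minus C q (s q))) p.
  by move=> s1 s2; rewrite {1}/split_conn (e1 _ s2) (e2 _ s2).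
exact: (sub3_add0 (e3 X Y sX sY) (e3 Y X sY sX) erefl
  (flat_plus sX sY (Gamma_plus ss) p) (flat_minus sX sY (Gamma_minus ss) p)).
Qed.

Lemma parallel_plus V (s : section C) : parallel_on full split_conn V s ->
  parallel_on (Eplus C) (nabla_plus C) V (fun p => pi_plus C p (s p)).
Proof.
move=> h p Vp; have [S [[sS _] nS dS]] := h p Vp.
exists (fun q => pi_plus C q (S q)); split; first exact: Gamma_plus.
  by apply: filterS nS => q ->.
by move=> X sX; rewrite -pi_plus_split_conn // dS // linear0.
Qed.

Lemma parallel_minus V (s : section C) : parallel_on full split_conn V s ->
  parallel_on (Eminus C) (nabla_minus C) V (fun p => pi_minus C p (s p)).
Proof.
move=> h p Vp; have [S [[sS _] nS dS]] := h p Vp.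
exists (fun q => pi_minus C q (S q)); split; first exact: Gamma_minus.
  by apply: filterS nS => q ->.
by move=> X sX; rewrite -pi_minus_split_conn // dS // linear0.
Qed.

End SplitConnection.

(** * Local Legendre embeddings *)

(** The minimum starts from 1 so that it stays positive for an empty index set. *)
Lemma common_radius (R : realType) (I : finType) (Q : I -> R -> Prop) :
  (forall i r s, s <= r -> Q i r -> Q i s) ->
  (forall i, exists r, 0 < r /\ Q i r) -> exists r, 0 < r /\ forall i, Q i r.
Proof.
move=> mono /choice [f hf]; exists (\big[Num.min/1]_i f i); split.
  by apply: lt_bigmin => // i _; have [] := hf i.
move=> i; have [_] := hf i; apply: mono; exact: bigmin_le.
Qed.

Section LowerLipschitz.
Variables (R : realType) (n m : nat).

(* A left inverse [B] of ['D F u0] makes [B *m F - id] a contraction near [u0]. *)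
Lemma immersion_lower_lipschitz (U : set 'cV[R]_n) (F : 'cV[R]_n -> 'cV[R]_m)
    (u0 : 'cV[R]_n) : open U -> U u0 -> Cinfty U F ->
  (forall v, 'D_v F u0 = 0 -> v = 0) ->
  exists c : R, 0 < c /\ exists2 r : R, 0 < r &
    forall u u', `|u - u0| < r -> `|u' - u0| < r -> c * `|u - u'| <= `|F u - F u'|.
Proof.
move=> oU U0 CF inj.
have dF := Cinfty_diff CF.
pose J : 'M[R]_(m, n) := \matrix_(i, k) ('D_(delta_mx k 0) F u0) i 0.
have JE v : 'D_v F u0 = J *m v.
  rewrite derive_sum_delta; last exact: dF.
  apply/matrixP => i j; rewrite summxE !mxE; apply: eq_bigr => k _.
  by rewrite !mxE ord1 mulrC.
have [B BJ] : exists B : 'M[R]_(n, m), B *m J = 1%:M.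
  have : row_free J^T.
    rewrite -kermx_eq0; apply/eqP/row_matrixP => k; set x := row k (kermx J^T).
    have xJ : x *m J^T = 0 by rewrite /x -row_mul mulmx_ker row0.
    clearbody x; rewrite row0.
    have : J *m x^T = 0 by rewrite -[J *m _]trmxK trmx_mul trmxK xJ trmx0.
    by rewrite -JE => /inj xT0; rewrite -[x]trmxK xT0 trmx0.
  move=> /row_freeP [B JB]; exists B^T.
  by rewrite -[J]trmxK -trmx_mul JB trmx1.
pose H u := B *m F u - u.
have hH u : U u -> has_diff H u (fun v => B *m 'D_v F u - v).
  move=> Uu; have h := has_diffB (has_diff_mulmx (has_diff_cst B u) (has_diffE (dF _ Uu))) (has_diff_id u).
  by apply: has_diff_eq h _ => v; rewrite mul0mx addr0.
have CH : Cinfty U H.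
  apply: Cinfty_add => //; last exact: Cinfty_opp (Cinfty_id _).
  by apply: Cinfty_mulmx => //; exact: Cinfty_cst.
have H0 v : 'D_v H u0 = 0.
  by have [_ ->] := hH _ U0; rewrite JE mulmxA BJ mul1mx subrr.
(* The derivative of [H] is a sum over n directions, so this bound on each partial derivative makes
   [H] Lipschitz with constant 1/2. *)
pose eps : R := (2 * (n%:R + 1))^-1.
have n1 : (0 : R) < n%:R + 1 by apply: ltr_wpDl.
have eps0 : 0 < eps by rewrite invr_gt0 mulr_gt0.
have nearH (k : 'I_n) : \forall u \near u0, `|'D_(delta_mx k 0) H u| < eps.
  have /cvgrPdist_lt /(_ eps eps0) := Cinfty_cont (Cinfty_derive (delta_mx k 0) CH) U0.
  by apply: filterS => u; rewrite H0 sub0r normrN.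
have [r1 [r10 hr1]] : exists r, 0 < r /\ forall (k : 'I_n) u, `|u - u0| < r ->
    `|'D_(delta_mx k 0) H u| < eps.
  apply: (common_radius (Q := fun k r => forall u, `|u - u0| < r ->
    `|'D_(delta_mx k 0) H u| < eps)).
    by move=> k r s sr h u us; apply: h; exact: lt_le_trans sr.
  by move=> k; have [r r0 h] := near_ball_norm (nearH k); exists r.
have [r2 r20 hr2] := near_ball_norm (open_near oU U0).
pose r := Num.min r1 r2.
have r0 : 0 < r by rewrite lt_min r10.
have hr u : `|u - u0| < r -> U u /\ forall k : 'I_n, `|'D_(delta_mx k 0) H u| < eps.
  by rewrite lt_min => /andP[h1 h2]; split; [exact: hr2|move=> k; exact: hr1].
have HL u u' : `|u - u0| < r -> `|u' - u0| < r -> `|H u - H u'| <= `|u - u'| / 2.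
  move=> ur u'r.
  have uE : u' + (u - u') = u by rewrite addrC subrK.
  have seg t : 0 <= t <= 1 -> `|u' + t *: (u - u') - u0| < r.
    by move=> t01; apply: ball_segment => //; rewrite uE.
  have K0 : 0 <= `|u - u'| / 2 by rewrite divr_ge0.
  have := @mean_value_ineq R _ _ _ H u' (u - u') _ K0; rewrite uE; apply => t /seg /hr [Uu hk].
    exact: Cinfty_diff CH Uu.
  rewrite derive_sum_delta; last exact: Cinfty_diff CH Uu.
  apply: le_trans (sum_scale_bound _ (C := eps) _) _.
    by move=> k; exact: ltW.
  rewrite mulrCA ler_wpM2l // /eps invfM mulrCA -[leRHS]mulr1 ler_wpM2l ?invr_ge0 //.
  by rewrite ler_pdivrMr // mul1r lerDl.
have B1 : 0 < m%:R * `|B| + 1 by rewrite ltr_wpDl ?mulr_ge0.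
(* Half of |u - u'| is bounded by |B (F u - F u')|, which costs a factor m |B|; the added 1 keeps
   the denominator positive. *)
exists ((2 * (m%:R * `|B| + 1))^-1); split; first by rewrite invr_gt0 mulr_gt0.
exists r => // u u' ur u'r.
have h1 := HL u u' ur u'r.
have h2 : `|u - u'| / 2 <= `|B *m (F u - F u')|.
  have -> : B *m (F u - F u') = (H u - H u') + (u - u').
    rewrite mulmxBr /H; move: (B *m F u) (B *m F u') => y y'.
    by apply/matrixP => i j; rewrite !mxE; ring.
  have := lerB_dist (u - u') (- (H u - H u')); rewrite opprK normrN [_ + (H u - _)]addrC.
  by move: h1; lra.
have h3 := mx_norm_mulmx B (F u - F u').
rewrite mulrC ler_pdivrMr ?mulr_gt0 //.
have h4 : m%:R * `|B| * `|F u - F u'| <= (m%:R * `|B| + 1) * `|F u - F u'|.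
  by rewrite ler_wpM2r // lerDl.
have := le_trans h2 (le_trans h3 h4).
by move: (m%:R * `|B| + 1) `|F u - F u'| `|u - u'| => q f w; lra.
Qed.

End LowerLipschitz.

Lemma sub_sub_eq0 (V : zmodType) (x y z : V) : x - y - z = 0 -> z = 0 -> x = y.
Proof. by move=> + z0; rewrite z0 subr0; exact: subr0_eq. Qed.

Section Pairings.
Variables (R : realType) (n : nat) (M : manifold R n) (C : quasi_codazzi M).

Lemma smooth_tau (s t : section C) : smooth_section s -> smooth_section t ->
  smooth_on setT (fun q => tau (s q) (t q) : R^o).
Proof.
move=> ss st; apply: smooth_on_cover => p _.
have [b bp] := tdom_cover C p; exists (tdom b); split=> //.
have [c [sc cE]] := ss b; have [d [sd dE]] := st b.
have ob : open (tdom b) by exact: open_tdom.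
have h : smooth_on (tdom b) (fun q => \sum_i \sum_j (c q i 0 : R^o) *: ((d q j 0 : R^o) *:
   (tau (triv b q (delta_mx i 0)) (triv b q (delta_mx j 0)) : R^o))).
  apply: smooth_on_sum => // i _; apply: smooth_on_sum => // j _.
  apply: smooth_on_scale => //; first exact: smooth_on_entry.
  apply: smooth_on_scale => //; first exact: smooth_on_entry.
  exact: tau_smooth.
apply: smooth_on_ext h => // q bq.
rewrite cE // dE // [in RHS](cV_sum_delta (c q)) [in RHS](cV_sum_delta (d q)) !triv_sum //.
rewrite tau_suml; apply: eq_bigr => i _; rewrite tau_sumr; apply: eq_bigr => j _.
by rewrite !trivZ // tauZl tauZr.
Qed.

Lemma exists_vfield p (v : tangent p) : exists X : vfield M, smooth_vfield X /\ X p = v.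
Proof.
have Dp := pref_dom p.
have [chi [K [sc c1 cK KV c0]]] := manifold_bump (open_D (pref p)) Dp.
exists (fun q => chi q *: frame (pref p) q (tcoord (pref p) v)); split.
  exact: cut_frame_smooth cK KV sc c0.
by rewrite (nbhs_singleton c1) scale1r tcoordK.
Qed.

Lemma smooth_Phi (X : vfield M) : smooth_vfield X ->
  smooth_section (fun q => Phi C q (X q)).
Proof.
move=> sX b; have [P hP] := choice (fun a => @Phi_smooth _ _ _ C b a).
(* The chart varies with [q], so smoothness is not visible here. Injectivity of the trivialization
   identifies [c] with the expression in any fixed chart, which is smooth. *)
pose c q := P (pref q) q *m tcoord (pref q) (X q).
have cE q : tdom b q -> Phi C q (X q) = triv b q (c q).
  by move=> bq; have [_ h] := hP (pref q); apply: h => //; exact: pref_dom.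
exists c; split=> //; apply: smooth_on_cover => p bp.
pose a := pref p; have Da : D a p := pref_dom p.
exists (tdom b `&` D a); split=> //.
have oV : open (tdom b `&` D a) by apply: openI; [exact: open_tdom|exact: open_D].
have [sP PE] := hP a.
have h : smooth_on (tdom b `&` D a) (fun q => P a q *m tcoord a (X q)).
  apply: smooth_on_mulmx => //.
  by apply: smooth_on_sub (sX a) => q [].
apply: (smooth_on_ext oV _ h) => q [bq Dq].
apply: (triv_inj bq); apply: (etrans (esym (PE q bq Dq (X q)))).
exact: cE.
Qed.

Lemma near_one_interior (chi : M -> R^o) p : (\forall q \near p, chi q = 1) ->
  [/\ open [set q | chi q = 1]^°, [set q | chi q = 1]^° p &
      forall q, [set q | chi q = 1]^° q -> chi q = 1].
Proof. by move=> h; split=> //; [exact: open_interior|move=> q /interior_subset]. Qed.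

Section Generic.
(** Stated abstractly to be used twice: with (E^+, E^-) for the forms dx_i and with the roles
    exchanged for dp_i. *)
Variables (F F' : forall p, {vspace fib C p}).
Variables (Dl D' : vfield M -> section C -> section C).
Variable pr : forall p, 'End(fib C p).
Hypothesis pr_Gamma : forall s : section C, smooth_section s -> Gamma F (fun p => pr p (s p)).
Hypothesis dualH : forall X s t, smooth_vfield X -> Gamma F s -> Gamma F' t ->
  forall p, dir (fun q => tau (s q) (t q) : R^o) (X p)
            = tau (Dl X s p) (t p) + tau (s p) (D' X t p).

(** By duality both terms of the derivative of the pairing contain a covariant derivative of a
    parallel section. *)
Lemma pairing_constant p0 r (e f : section C) : inside_chart p0 r ->
  parallel_on F Dl (chart_ball p0 r) e -> parallel_on F' D' (chart_ball p0 r) f ->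
  forall q s, chart_ball p0 r q -> chart_ball p0 r s ->
  tau (e q) (f q) = tau (e s) (f s).
Proof.
move=> ir pe pf; apply: (chart_ball_dir0 (f := fun q => tau (e q) (f q)) ir).
  move=> q Bq; have [s [[ss _] ns _]] := pe q Bq; have [t [[st _] nt _]] := pf q Bq.
  have [Dq _] := Bq.
  apply: (chart_diff_near (W := R^o) (f := fun q => tau (s q) (t q)) Dq).
    by apply: filterS2 ns nt => z -> ->.
  exact: smooth_chart_diff (smooth_tau ss st) Dq I.
move=> q v Bq; have [s [Gs ns ds]] := pe q Bq; have [t [Gt nt dt]] := pf q Bq.
have [X [sX Xq]] := exists_vfield v.
rewrite (dir_near (W := R^o) (g := fun q => tau (s q) (t q) : R^o)); last first.
  by apply: filterS2 ns nt => z -> ->.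
by rewrite -Xq dualH // ds // dt // tau0l tau0r addr0.
Qed.

Hypothesis torsionH : rel_torsion_free (fun p (v : tangent p) => pr p (Phi C p v)) Dl.

Variables (p0 : M) (r : R) (g : section C).
Hypotheses (ir : inside_chart p0 r) (pg : parallel_on F' D' (chart_ball p0 r) g).
Hypothesis r0 : 0 < r.
Local Notation a := (pref p0).

(* For [pr = pi_plus], [g = f_i] these are the components of [dx_i] in the chart
   [a]; for [pr = pi_minus], [g = e_i] those of [dp_i]. *)
Definition pairing_form (k : 'I_n) (q : M) : R^o :=
  2 * tau (pr q (Phi C q (frame a q (delta_mx k 0)))) (g q).

(** Replaces the coordinate fields and the local section [g] near [q] by global ones, to which the
    connections apply. *)
Lemma pairing_form_germ q : chart_ball p0 r q ->
  exists (X : 'I_n -> vfield M) (t : section C),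
  [/\ forall k, smooth_vfield (X k), Gamma F' t /\ (forall Y, smooth_vfield Y -> D' Y t q = 0),
      forall k, \forall z \near q, pairing_form k z = 2 * tau (pr z (Phi C z (X k z))) (t z),
      forall k, tcoord a (X k q) = delta_mx k 0 &
      forall k l, lie_bracket (X k) (X l) q = 0].
Proof.
move=> Bq; have [Dq _] := Bq; have [b bq] := tdom_cover C q.
have [t [Gt nt dt]] := pg Bq.
have oV : open (D a `&` tdom b) by apply: openI; [exact: open_D|exact: open_tdom].
have [chi [K [sc c1 cK KV c0]]] := manifold_bump oV (conj Dq bq).
have [oV1 V1q c1'] := near_one_interior c1.
have KD : K `<=` D a by move=> z /KV [].
exists (cut_frame a chi), t; split.
- by move=> k; exact: cut_frame_smooth cK KD sc c0.
- by split.
- move=> k; apply: filterS2 c1 nt => z c1z ->.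
  by rewrite /pairing_form /cut_frame c1z scale1r.
- by move=> k; exact: (tcoord_cut_frame KV c0 c1' k V1q).
- by move=> k l; exact: (cut_frame_bracket sc cK KV c0 oV1 c1' k l V1q).
Qed.

Lemma pairing_section_smooth (X : vfield M) (t : section C) : smooth_vfield X ->
  Gamma F' t -> smooth_on setT (fun z => 2 * tau (pr z (Phi C z (X z))) (t z) : R^o).
Proof.
move=> sX [st _].
have [ss _] := pr_Gamma (smooth_Phi sX).
have h := smooth_on_scale openT (smooth_on_cst setT (2 : R^o)) (smooth_tau ss st).
exact: h.
Qed.

Lemma pairing_form_smooth k : smooth_on (chart_ball p0 r) (pairing_form k).
Proof.
apply: smooth_on_cover => q Bq; have [X [t [sX [Gt _] nX _ _]]] := pairing_form_germ Bq.
exists ([set z | pairing_form k z = 2 * tau (pr z (Phi C z (X k z))) (t z)]^°); split.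
  exact: nX.
apply: smooth_on_ext (smooth_on_sub _ (pairing_section_smooth (sX k) Gt)) => //.
  exact: open_interior.
by move=> z /interior_subset ->.
Qed.

(** Closedness of the form. As [t] is parallel, duality leaves only the covariant derivative of
    Phi(X_k) along X_l, paired with [t]; torsion-freeness and [X_l, X_k] = 0 make it symmetric in k
    and l. *)
Lemma pairing_form_dir k l q : chart_ball p0 r q ->
  'D_(delta_mx l 0) (pairing_form k \o psi a) (phi a q)
  = 'D_(delta_mx k 0) (pairing_form l \o psi a) (phi a q).
Proof.
move=> Bq; have [Dq _] := Bq.
have [X [t [sX [Gt dt] nX Xk brk]]] := pairing_form_germ Bq.
have E i j : 'D_(delta_mx j 0) (pairing_form i \o psi a) (phi a q)
   = 2 * tau (Dl (X j) (fun z => pr z (Phi C z (X i z))) q) (t q).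
  have cd : chart_diff (pairing_form i) a q := smooth_chart_diff (pairing_form_smooth i) Dq Bq.
  have Gs := pr_Gamma (smooth_Phi (sX i)).
  rewrite -(Xk j) -(dir_chart _ Dq cd) (dir_near _ (nX i)).
  have ts := smooth_tau (proj1 Gs) (proj1 Gt).
  have cd2 := smooth_chart_diff ts (pref_dom q) I.
  have [_ e] := has_diffZ (has_diff_cst (2 : R^o) _) (has_diffE cd2).
  rewrite dirE; apply: (etrans (e (X j q))); rewrite scale0r addr0.
  congr (2 * _); apply: (etrans (dualH (sX j) Gs Gt q)).
  by rewrite dt // tau0r addr0.
apply: (etrans (E k l)); apply: (etrans _ (esym (E l k))).
congr (2 * tau _ _).
have tz : pr q (Phi C q (lie_bracket (X l) (X k) q)) = 0 by rewrite brk !linear0.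
exact: (sub_sub_eq0 (torsionH (sX l) (sX k) q) tz).
Qed.

Lemma pairing_potential : exists x : 'cV[R]_n -> R^o, exists s : R, [/\ 0 < s, s <= r &
  forall u, `|u - phi a p0| < s ->
    has_diff x u (fun v => \sum_k v k 0 *: pairing_form k (psi a u))].
Proof.
pose U := [set u | `|u - phi a p0| < r].
have oU : open U by exact: open_ball_norm.
have U0 : U (phi a p0) by rewrite /U /= subrr normr0.
have Cth k : Cinfty U (pairing_form k \o psi a).
  apply: Cinfty_sub (pairing_form_smooth k a) => u Uu.
  have Bu := chart_ball_psi ir Uu; have cu := ir Uu.
  by apply/cimgP.
have [u i j Uu|x nx] := poincare oU U0 Cth.
  have := pairing_form_dir j i (chart_ball_psi ir Uu).
  by rewrite psiK //; exact: ir.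
have [s s0 hs] := near_ball_norm nx.
exists x, (Num.min s r); split; first by rewrite lt_min s0.
  by rewrite ge_min lexx orbT.
by move=> u; rewrite lt_min => /andP[us _]; exact: hs.
Qed.

Lemma pairing_form_sum q (v : 'cV[R]_n) : chart_ball p0 r q ->
  \sum_k v k 0 *: pairing_form k q = 2 * tau (pr q (Phi C q (frame a q v))) (g q).
Proof.
move=> [Dq _]; rewrite (frame_sum _ Dq) !linear_sum tau_suml mulr_sumr.
by apply: eq_bigr => k _; rewrite [in RHS]linearZ [in RHS]linearZ tauZl mulrCA.
Qed.

End Generic.

Lemma dual_minus X s t : smooth_vfield X -> Gamma (Eminus C) s -> Gamma (Eplus C) t ->
  forall p, dir (fun q => tau (s q) (t q) : R^o) (X p)
            = tau (nabla_minus C X s p) (t p) + tau (s p) (nabla_plus C X t p).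
Proof.
move=> sX Gs Gt p.
rewrite (dir_near (W := R^o) (g := fun q => tau (t q) (s q) : R^o)); last first.
  by apply: nearW => q; exact: tau_sym.
by rewrite (nabla_dual sX Gt Gs) addrC !(tau_sym _ (s p)) (tau_sym (t p)).
Qed.

End Pairings.

Section LocalStructure.
Variables (R : realType) (n : nat) (M : manifold R n) (C : quasi_codazzi M).

Lemma Phi_inj p (v : tangent p) : Phi C p v = 0 -> v = 0.
Proof.
have h := limg_ker_dim (Phi C p) fullv.
rewrite Phi_rank dimvf dim_matrix capfv in h.
have /eqP : \dim (lker (Phi C p)) = 0%N.
  by apply: (@addIn n); rewrite h add0n; exact: muln1.
rewrite dimv_eq0 => /lker0P inj Pv; apply: inj; by rewrite Pv linear0.
Qed.

Lemma Phi_split p (v : tangent p) : Phi C p v = Phi_plus C v + Phi_minus C v.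
Proof. by rewrite /Phi_plus /Phi_minus pi_add. Qed.

(** Both eigenbundles are isotropic, so only mixed terms of [omega] survive. In dual frames this is
    the vanishing of the 2-form sum_i dp_i ^ dx_i. *)
Lemma lagrangian_pairing p (v w : tangent p) :
  tau (Phi_plus C w) (Phi_minus C v) = tau (Phi_plus C v) (Phi_minus C w).
Proof.
have := @Phi_lagrangian _ _ _ C p v w; rewrite /omega inv_pi (Phi_split v).
rewrite -/(Phi_plus C w) -/(Phi_minus C w) tauDl !tauDr !tauNr.
rewrite (tau_plus (pi_plus_mem _) (pi_plus_mem _)).
rewrite (tau_minus (pi_minus_mem _) (pi_minus_mem _)) (tau_sym (Phi_minus C v)).
by lra.
Qed.

Lemma parallel_mem (F : forall p, {vspace fib C p}) Dl U (e : section C) p :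
  parallel_on F Dl U e -> U p -> e p \in F p.
Proof.
move=> pe Up; have [s [[_ sF] ns _]] := pe p Up.
by rewrite -(nbhs_singleton ns).
Qed.

Lemma parallel_sub (F : forall p, {vspace fib C p}) Dl (U V : set M) (e : section C) :
  V `<=` U -> parallel_on F Dl U e -> parallel_on F Dl V e.
Proof. by move=> VU pe p /VU; exact: pe. Qed.

(** The differentials dx and dp are given by pairings with the dual frame rather than by expansions
    of Phi^+ and Phi^-. The comparison of two pieces uses this form, and [local_structure_yields]
    recovers the expansions. *)
Definition local_structure (U : set M) (leg : M -> contact_space R n)
    (e f : 'I_n -> section C) : Prop :=
  [/\ legendre_embedding U leg,
      (forall i, parallel_on (Eplus C) (nabla_plus C) U (e i)) /\
      (forall i, parallel_on (Eminus C) (nabla_minus C) U (f i)),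
      forall p, U p -> forall i j, tau (e i p) (f j p) = (i == j)%:R / 2%:R,
      forall p (v : tangent p) i, U p ->
        xpart (dir leg v) i 0 = 2 * tau (Phi_plus C v) (f i p) &
      forall p (v : tangent p) i, U p ->
        ppart (dir leg v) i 0 = 2 * tau (Phi_minus C v) (e i p)].

Lemma local_structure_sub (U V : set M) leg e f : V `<=` U ->
  local_structure U leg e f -> local_structure V leg e f.
Proof.
move=> VU [[h1 h2 h3 h4 h5] [pe pf] du hx hp]; split.
- split.
  + exact: smooth_on_sub h1.
  + by move=> p v /VU; exact: h2.
  + move=> p q; rewrite !inE => /VU Up /VU Uq; apply: h3; rewrite inE //.
  + move=> V' oV' V'V; have [W oW e1] := h4 V' oV' (subset_trans V'V VU).
    exists W => //; rewrite e1; apply/seteqP; split=> w [Ww].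
      move=> fw; split=> //; have : (leg @` V') w by rewrite e1.
      by move=> [q Vq <-]; exists q => //; exact: V'V.
    by move=> [q Vq qw]; split=> //; exists q => //; exact: VU.
  + by move=> p v /VU; exact: h5.
- by split=> i; apply: parallel_sub VU _.
- by move=> p /VU; exact: du.
- by move=> p v i /VU; exact: hx.
- by move=> p v i /VU; exact: hp.
Qed.

Section FromFrames.
Variables (p0 : M) (r : R) (e f : 'I_n -> section C).
Hypotheses (r0 : 0 < r) (ir : inside_chart p0 r).
Hypothesis pe : forall i, parallel_on (Eplus C) (nabla_plus C) (chart_ball p0 r) (e i).
Hypothesis pf : forall i, parallel_on (Eminus C) (nabla_minus C) (chart_ball p0 r) (f i).
Hypothesis dual : forall p, chart_ball p0 r p ->
  forall i j, tau (e i p) (f j p) = (i == j)%:R / 2%:R.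
Local Notation a := (pref p0).
Local Notation u0 := (phi a p0).

Let th i := pairing_form (pi_plus C) p0 (f i).
Let et i := pairing_form (pi_minus C) p0 (e i).

Let plusG (s : section C) : smooth_section s -> Gamma (Eplus C) (fun p => pi_plus C p (s p)).
Proof. exact: Gamma_plus. Qed.
Let minusG (s : section C) : smooth_section s -> Gamma (Eminus C) (fun p => pi_minus C p (s p)).
Proof. exact: Gamma_minus. Qed.

Let th_smooth i k : smooth_on (chart_ball p0 r) (th i k).
Proof. exact: (pairing_form_smooth plusG (pf i)). Qed.
Let et_smooth i k : smooth_on (chart_ball p0 r) (et i k).
Proof. exact: (pairing_form_smooth minusG (pe i)). Qed.

Let th_sum i q (v : tangent q) : chart_ball p0 r q ->
  \sum_k tcoord a v k 0 *: th i k q = 2 * tau (Phi_plus C v) (f i q).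
Proof.
move=> Bq; have [Dq _] := Bq.
by have := pairing_form_sum (pi_plus C) (f i) (tcoord a v) Bq; rewrite tcoordK.
Qed.

Let et_sum i q (v : tangent q) : chart_ball p0 r q ->
  \sum_k tcoord a v k 0 *: et i k q = 2 * tau (Phi_minus C v) (e i q).
Proof.
move=> Bq; have [Dq _] := Bq.
by have := pairing_form_sum (pi_minus C) (e i) (tcoord a v) Bq; rewrite tcoordK.
Qed.

Let plus_expand q (v : tangent q) : chart_ball p0 r q ->
  Phi_plus C v = \sum_i (2 * tau (Phi_plus C v) (f i q)) *: e i q.
Proof.
move=> Bq; apply: (Eplus_dual_frame _ (dual Bq)); last exact: pi_plus_mem.
by move=> i; exact: parallel_mem (pe i) Bq.
Qed.

Let minus_expand q (v : tangent q) : chart_ball p0 r q ->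
  Phi_minus C v = \sum_i (2 * tau (Phi_minus C v) (e i q)) *: f i q.
Proof.
move=> Bq; have := Eminus_dual_frame (fun i => parallel_mem (pf i) Bq) (dual Bq) (pi_minus_mem (Phi C q v)).
by move=> h; rewrite {1}/Phi_minus h; apply: eq_bigr => i _; rewrite tau_sym.
Qed.

(** The identity [lagrangian_pairing] written in components. *)
Let cotangent_symm q (v w : tangent q) : chart_ball p0 r q ->
  \sum_i (2 * tau (Phi_minus C v) (e i q)) * (2 * tau (Phi_plus C w) (f i q))
  = \sum_i (2 * tau (Phi_minus C w) (e i q)) * (2 * tau (Phi_plus C v) (f i q)).
Proof.
move=> Bq.
have E (v' w' : tangent q) :
  \sum_i (2 * tau (Phi_minus C v') (e i q)) * (2 * tau (Phi_plus C w') (f i q))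
  = 2 * tau (Phi_plus C w') (Phi_minus C v').
  rewrite [in RHS](minus_expand v' Bq) tau_sumr mulr_sumr; apply: eq_bigr => i _.
  by rewrite tauZr mulrCA.
by rewrite !E lagrangian_pairing.
Qed.

Let inball u : `|u - u0| < r -> chart_ball p0 r (psi a u).
Proof. exact: chart_ball_psi ir. Qed.

Let cimg_ball u : `|u - u0| < r -> (phi a @` D a) u.
Proof. exact: ir. Qed.

Let form_Cinfty (g : M -> R^o) : smooth_on (chart_ball p0 r) g ->
  Cinfty [set u | `|u - u0| < r] (g \o psi a).
Proof.
move=> sg; apply: Cinfty_sub (sg a) => u ur; apply/cimgP.
by split; [exact: cimg_ball|exact: inball].
Qed.

Lemma first_potentials : exists (x y : 'I_n -> 'cV[R]_n -> R^o) (s : R),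
  [/\ 0 < s, s <= r & forall i u, `|u - u0| < s ->
    has_diff (x i) u (fun v => \sum_k v k 0 *: th i k (psi a u)) /\
    has_diff (y i) u (fun v => \sum_k v k 0 *: et i k (psi a u))].
Proof.
have hx i := pairing_potential plusG (@nabla_dual _ _ _ C) (@nabla_plus_torsion _ _ _ C) ir (pf i) r0.
have hy i := pairing_potential minusG (@dual_minus _ _ _ C) (@nabla_minus_torsion _ _ _ C) ir (pe i) r0.
have [x {}hx] := choice hx; have [y {}hy] := choice hy.
have [s [s0 hs]] : exists s, 0 < s /\ forall i : 'I_n, s <= r /\ forall u, `|u - u0| < s ->
    has_diff (x i) u (fun v => \sum_k v k 0 *: th i k (psi a u)) /\
    has_diff (y i) u (fun v => \sum_k v k 0 *: et i k (psi a u)).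
  apply: (common_radius (Q := fun i s => s <= r /\ forall u, `|u - u0| < s ->
    has_diff (x i) u (fun v => \sum_k v k 0 *: th i k (psi a u)) /\
    has_diff (y i) u (fun v => \sum_k v k 0 *: et i k (psi a u)))).
    move=> i s1 s2 s21 [s1r h]; split; first exact: le_trans s1r.
    by move=> u us; apply: h; exact: lt_le_trans s21.
  move=> i; have [s1 [s10 s1r h1]] := hx i; have [s2 [s20 s2r h2]] := hy i.
  exists (Num.min s1 s2); rewrite lt_min s10 s20; split=> //.
  rewrite ge_min s1r; split=> // u; rewrite lt_min => /andP[us1 us2].
  by split; [exact: h1|exact: h2].
exists x, y, (Num.min s r); split; first by rewrite lt_min s0.
  by rewrite ge_min lexx orbT.
by move=> i u; rewrite lt_min => /andP[us _]; have [_ h] := hs i; exact: h.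
Qed.

Section ContactPotential.
Variables (x y : 'I_n -> 'cV[R]_n -> R^o) (s : R).
Hypotheses (s0 : 0 < s) (sr : s <= r).
Hypothesis hxy : forall i u, `|u - u0| < s ->
    has_diff (x i) u (fun v => \sum_k v k 0 *: th i k (psi a u)) /\
    has_diff (y i) u (fun v => \sum_k v k 0 *: et i k (psi a u)).
Let B := [set u | `|u - u0| < s].
Let oB : open B. Proof. exact: open_ball_norm. Qed.
Let Br u : B u -> `|u - u0| < r.
Proof. by move=> us; exact: lt_le_trans sr. Qed.
Let BU u : B u -> chart_ball p0 r (psi a u).
Proof. by move=> /Br; exact: inball. Qed.

Let th_C i k : Cinfty B (th i k \o psi a).
Proof. by apply: Cinfty_sub (form_Cinfty (th_smooth i k)) => u /Br. Qed.
Let et_C i k : Cinfty B (et i k \o psi a).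
Proof. by apply: Cinfty_sub (form_Cinfty (et_smooth i k)) => u /Br. Qed.

Let x_C i : Cinfty B (x i).
Proof.
apply: (Cinfty_primitive (th := fun k => th i k \o psi a) oB (th_C i)) => u Bu.
by have [] := hxy i Bu.
Qed.

Let y_C i : Cinfty B (y i).
Proof.
apply: (Cinfty_primitive (th := fun k => et i k \o psi a) oB (et_C i)) => u Bu.
by have [] := hxy i Bu.
Qed.

(* The components of [sum_i p_i dx_i]. *)
Let ze (k : 'I_n) (u : 'cV[R]_n) : R^o := \sum_i y i u *: (th i k (psi a u) : R^o).

Let ze_C k : Cinfty B (ze k).
Proof.
apply: Cinfty_sum => // i _; apply: Cinfty_scale => //; exact: th_C.
Qed.

(** Differentiating p_i dx_i gives second derivatives of x_i, symmetric because dx_i is closed, and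
    the products of dp_i with dx_i, whose sum is symmetric by the Lagrangian condition. *)
Let ze_closed u k l : B u ->
  'D_(delta_mx k 0) (ze l) u = 'D_(delta_mx l 0) (ze k) u.
Proof.
move=> Bu; have Bq := BU Bu; have cu := cimg_ball (Br Bu).
have E k' l' : 'D_(delta_mx k' 0) (ze l') u = \sum_i y i u * 'D_(delta_mx k' 0) (th i l' \o psi a) u
    + \sum_i et i k' (psi a u) * th i l' (psi a u).
  have hi i := has_diffZ (proj2 (hxy i Bu)) (has_diffE (Cinfty_diff (th_C i l') Bu)).
  have [_ e1] := has_diff_fsum hi.
  rewrite [LHS]e1 big_split; congr (_ + _).
  by apply: eq_bigr => i _; rewrite sum_delta_scale.
apply: (etrans (E k l)); apply: (etrans _ (esym (E l k))).
apply: (congr2 (fun u v : R => u + v)).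
  apply: eq_bigr => i _; apply: (congr1 (fun w : R => y i u * w)).
  have := pairing_form_dir plusG (@nabla_dual _ _ _ C) (@nabla_plus_torsion _ _ _ C) (pf i) l k Bq.
  by rewrite psiK.
exact: (cotangent_symm (frame a (psi a u) (delta_mx k 0)) (frame a (psi a u) (delta_mx l 0)) Bq).
Qed.

Lemma contact_potential : exists (z : 'cV[R]_n -> R^o) (t : R), [/\ 0 < t, t <= s &
  forall u, `|u - u0| < t -> has_diff z u (fun v => \sum_k v k 0 *: ze k u)].
Proof.
have U0 : B u0 by rewrite /B /= subrr normr0.
have [z nz] := poincare oB U0 ze_C (fun u k l Bu => ze_closed k l Bu).
have [t t0 ht] := near_ball_norm nz.
exists z, (Num.min t s); split; first by rewrite lt_min t0.
  by rewrite ge_min lexx orbT.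
by move=> u; rewrite lt_min => /andP[us _]; exact: ht.
Qed.

Section LegendreMap.
Variables (z : 'cV[R]_n -> R^o) (t : R).
Hypotheses (t0 : 0 < t) (ts : t <= s).
Hypothesis hz : forall u, `|u - u0| < t -> has_diff z u (fun v => \sum_k v k 0 *: ze k u).
Let T := [set u | `|u - u0| < t].
Let oT : open T. Proof. exact: open_ball_norm. Qed.
Let TB u : T u -> B u. Proof. by move=> ut; exact: lt_le_trans ts. Qed.

Let X u : 'cV[R]_n := \col_i x i u.
Let Y u : 'cV[R]_n := \col_i y i u.
Let leg q : contact_space R n := (X (phi a q), Y (phi a q), z (phi a q)).

Let X_diff u : B u -> has_diff X u (fun v => \col_i \sum_k v k 0 *: th i k (psi a u)).
Proof.
move=> Bu; apply: has_diff_mx => i j; have [h _] := hxy i Bu.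
by apply: has_diff_eq (has_diff_ext _ h) _ => [w|v]; rewrite !mxE.
Qed.

Let Y_diff u : B u -> has_diff Y u (fun v => \col_i \sum_k v k 0 *: et i k (psi a u)).
Proof.
move=> Bu; apply: has_diff_mx => i j; have [_ h] := hxy i Bu.
by apply: has_diff_eq (has_diff_ext _ h) _ => [w|v]; rewrite !mxE.
Qed.

Let X_C : Cinfty B X.
Proof.
apply: Cinfty_mx => // i j; apply: Cinfty_ext (x_C i) => // u _; by rewrite mxE.
Qed.
Let Y_C : Cinfty B Y.
Proof.
apply: Cinfty_mx => // i j; apply: Cinfty_ext (y_C i) => // u _; by rewrite mxE.
Qed.
Let z_C : Cinfty T z.
Proof.
apply: (Cinfty_primitive (th := ze) oT _ hz) => k.
by apply: Cinfty_sub (ze_C k) => u /TB.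
Qed.

Let ball_T q : chart_ball p0 t q -> T (phi a q). Proof. by case. Qed.
Let ball_r q : chart_ball p0 t q -> chart_ball p0 r q.
Proof. by apply: chart_ball_le; exact: le_trans sr. Qed.

Lemma leg_dir q (v : tangent q) : chart_ball p0 t q ->
  dir leg v = (\col_i (2 * tau (Phi_plus C v) (f i q)),
               \col_i (2 * tau (Phi_minus C v) (e i q)),
               \sum_i y i (phi a q) * (2 * tau (Phi_plus C v) (f i q))).
Proof.
move=> Bq; have [Dq _] := Bq; have Tq := ball_T Bq; have Brq := ball_r Bq.
have h := has_diff_pair (has_diff_pair (X_diff (TB Tq)) (Y_diff (TB Tq))) (hz Tq).
have h' : @has_diff R 'cV[R]_n (contact_space R n) (leg \o psi a) (phi a q)
   (fun v => (\col_i \sum_k v k 0 *: th i k (psi a (phi a q)),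
      \col_i \sum_k v k 0 *: et i k (psi a (phi a q)), \sum_k v k 0 *: ze k (phi a q))).
  apply: has_diff_near h.
  have oc : open (phi a @` D a) by exact: open_codom.
  have cq : (phi a @` D a) (phi a q) by exists q.
  by apply: filterS (open_near oc cq) => u cu; rewrite /= /leg psiK.
have [dl el] := h'.
rewrite (dir_chart v Dq dl) el coordK //; congr (_, _, _).
- by apply/matrixP => i j; rewrite !mxE th_sum.
- by apply/matrixP => i j; rewrite !mxE et_sum.
- under eq_bigr => k _ do rewrite scaler_sumr.
  rewrite exchange_big; apply: eq_bigr => i _.
  rewrite -(th_sum i v Brq) mulr_sumr; apply: eq_bigr => k _.
  by rewrite coordK // scalerA mulrC -scalerA.
Qed.

Lemma leg_smooth_on : smooth_on (chart_ball p0 t) leg.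
Proof.
have X_CT : Cinfty T X by apply: Cinfty_sub X_C => u /TB.
have Y_CT : Cinfty T Y by apply: Cinfty_sub Y_C => u /TB.
have CT := Cinfty_pair oT (Cinfty_pair oT X_CT Y_CT) z_C.
apply: (smooth_on_comp_coord (g := fun u => (X u, Y u, z u) : contact_space R n) _ oT _ _ CT).
- exact: open_chart_ball.
- by move=> q [].
- by move=> q [].
Qed.

Lemma leg_immersive q (v : tangent q) : chart_ball p0 r q ->
  (forall i, tau (Phi_plus C v) (f i q) = 0) ->
  (forall i, tau (Phi_minus C v) (e i q) = 0) -> v = 0.
Proof.
move=> Bq hf he; apply: Phi_inj; rewrite Phi_split (plus_expand v Bq) (minus_expand v Bq).
rewrite big1 ?big1 ?addr0 // => i _; first by rewrite he mulr0 scale0r.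
by rewrite hf mulr0 scale0r.
Qed.

(** The map (x, p) without z is already an immersion, since dx and dp determine Phi^+ and Phi^-;
    [F_leg] passes its lower Lipschitz bound on to [leg]. *)
Let F u : 'cV[R]_(n + n) := col_mx (X u) (Y u).

Lemma potentials_lower_lipschitz : exists c : R, 0 < c /\ exists2 w : R, 0 < w &
  forall u u', `|u - u0| < w -> `|u' - u0| < w -> c * `|u - u'| <= `|F u - F u'|.
Proof.
have T0 : T u0 by rewrite /T /= subrr normr0.
have hF u : B u -> has_diff F u (fun v => col_mx (\col_i \sum_k v k 0 *: th i k (psi a u))
    (\col_i \sum_k v k 0 *: et i k (psi a u))).
  move=> Bu; apply: has_diff_mx => i j.
  have hX := has_diff_entry _ 0 (X_diff Bu); have hY := has_diff_entry _ 0 (Y_diff Bu).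
  rewrite ord1; case: (splitP i) => [k ik|k ik].
    have -> : i = lshift n k by apply: val_inj.
    by apply: has_diff_eq (has_diff_ext _ (hX k)) _ => [w|v]; rewrite /F col_mxEu.
  have -> : i = rshift n k by apply: val_inj.
  by apply: has_diff_eq (has_diff_ext _ (hY k)) _ => [w|v]; rewrite /F col_mxEd.
have CF : Cinfty B F.
  apply: Cinfty_mx => // i j; rewrite ord1; case: (splitP i) => [k ik|k ik].
    have -> : i = lshift n k by apply: val_inj.
    apply: Cinfty_ext (Cinfty_entry k 0 oB X_C) => // u _; by rewrite /F col_mxEu.
  have -> : i = rshift n k by apply: val_inj.
  apply: Cinfty_ext (Cinfty_entry k 0 oB Y_C) => // u _; by rewrite /F col_mxEd.
apply: (immersion_lower_lipschitz oB (TB T0) CF) => v.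
have [_ ->] := hF _ (TB T0); rewrite -col_mx0 => /eq_col_mx [/matrixP hX /matrixP hY].
have Dp := pref_dom p0; have Bp : chart_ball p0 r p0 by exact: chart_ball_center.
rewrite -(frameK v Dp).
have -> : frame a p0 v = 0.
  apply: (leg_immersive Bp) => i.
    have := hX i 0; rewrite !mxE coordK // -[v](frameK v Dp) th_sum //.
    by rewrite frameK // => /eqP; rewrite mulf_eq0 pnatr_eq0 /= => /eqP.
  have := hY i 0; rewrite !mxE coordK // -[v](frameK v Dp) et_sum //.
  by rewrite frameK // => /eqP; rewrite mulf_eq0 pnatr_eq0 /= => /eqP.
by rewrite /tcoord dirE derive0.
Qed.

Lemma F_leg q q' : `|F (phi a q) - F (phi a q')| <= `|leg q - leg q'|.
Proof.
have nXY : `|leg q - leg q'| = Num.max (Num.max `|X (phi a q) - X (phi a q')|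
   `|Y (phi a q) - Y (phi a q')|) `|z (phi a q) - z (phi a q')| by [].
rewrite nXY /F opp_col_mx add_col_mx; apply: mx_norm_le => [|i j].
  by rewrite !le_max normr_ge0.
rewrite mxE; case: (splitP i) => k _; rewrite !le_max.
  by rewrite (mx_norm_entry (X (phi a q) - X (phi a q')) k j).
by rewrite (mx_norm_entry (Y (phi a q) - Y (phi a q')) k j) orbT.
Qed.

(** The lower Lipschitz bound gives injectivity and the continuity of the inverse at once. *)
Lemma leg_embedding : exists w : R, [/\ 0 < w, w <= t &
  legendre_embedding (chart_ball p0 w) leg].
Proof.
have [c [c0 [w0 w00 hw]]] := potentials_lower_lipschitz.
exists (Num.min w0 t); rewrite lt_min w00 t0 ge_min lexx orbT; split=> //.
set w := Num.min w0 t.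
have wt : chart_ball p0 w `<=` chart_ball p0 t.
  by apply: chart_ball_le; rewrite ge_min lexx orbT.
have ww0 : chart_ball p0 w `<=` chart_ball p0 w0.
  by apply: chart_ball_le; rewrite ge_min lexx.
have low q q' : chart_ball p0 w q -> chart_ball p0 w q' ->
    c * `|phi a q - phi a q'| <= `|leg q - leg q'|.
  move=> /ww0 [_ qw] /ww0 [_ q'w]; apply: le_trans (F_leg q q'); exact: hw.
split.
- exact: smooth_on_sub wt leg_smooth_on.
- move=> q v /wt Bq; rewrite leg_dir // => dl0.
  have half0 (V : R) : 2 * V = 0 -> V = 0.
    by move=> /eqP; rewrite mulf_eq0 pnatr_eq0 /= => /eqP.
  have d1 := congr1 (fun j : contact_space R n => j.1.1) dl0.
  have d2 := congr1 (fun j : contact_space R n => j.1.2) dl0.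
  apply: (leg_immersive (ball_r Bq)) => i; apply: half0.
    by have /matrixP /(_ i 0) := d1; rewrite !mxE.
  by have /matrixP /(_ i 0) := d2; rewrite !mxE.
- move=> q q'; rewrite !inE => Bq Bq' e1.
  have := low q q' Bq Bq'; rewrite e1 subrr normr0 => h.
  have : `|phi a q - phi a q'| <= 0 by rewrite -(pmulr_rle0 _ c0).
  rewrite normr_le0 subr_eq0 => /eqP e2.
  by have [Dq _] := Bq; have [Dq' _] := Bq'; rewrite -(coordK Dq) e2 coordK.
- move=> V oV VU.
  (* A union of balls of radius c * eps around the points [leg q], where [eps] is such that points
     within [eps] of [q] lie in [V]. If [leg q'] falls in such a ball, the lower bound puts [q']
     within [eps] of [q]. *)
  pose W := [set j : contact_space R n | exists q eps, [/\ V q, 0 < eps,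
    forall q', chart_ball p0 w q' -> `|phi a q' - phi a q| < eps -> V q' &
    `|j - leg q| < c * eps]].
  exists W.
    rewrite openE => j [q [eps [Vq e0 he hj]]].
    have := open_near (open_ball_norm (leg q) (c * eps)) hj.
    by apply: filterS => j' hj'; exists q, eps.
  apply/seteqP; split=> [j [q Vq <-]|j [[q [eps [Vq e0 he hj]]] [q' Bq' qj]]].
    split; last by exists q => //; exact: VU.
    have [Dq _] := VU _ Vq.
    have [eps e0 he] := near_ball_norm (near_psi Dq (open_near oV Vq)).
    exists q, eps; split=> //; last by rewrite subrr normr0 mulr_gt0.
    by move=> q' [Dq' _] /he; rewrite coordK.
  exists q' => //; apply: he => //.
  rewrite -(ltr_pM2l c0); apply: le_lt_trans hj; rewrite -qj.
  by apply: low => //; exact: VU.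
- move=> q v /wt Bq; rewrite /contact_form leg_dir // /zpart /xpart /ppart /=.
  apply/eqP; rewrite subr_eq0; apply/eqP; apply: eq_bigr => i _.
  by rewrite !mxE.
Qed.

Lemma leg_structure : exists w : R, [/\ 0 < w, w <= t &
  local_structure (chart_ball p0 w) leg e f].
Proof.
have [w [w0 wt emb]] := leg_embedding; exists w; split=> //.
have ws : chart_ball p0 w `<=` chart_ball p0 t by exact: chart_ball_le.
have wr q : chart_ball p0 w q -> chart_ball p0 r q by move=> /ws; exact: ball_r.
split=> //.
- by split=> i; apply: parallel_sub wr _.
- by move=> q /wr; exact: dual.
- by move=> q v i /ws Bq; rewrite leg_dir // /xpart /= mxE.
- by move=> q v i /ws Bq; rewrite leg_dir // /ppart /= mxE.
Qed.

End LegendreMap.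
End ContactPotential.
End FromFrames.

Hypothesis flat_plus : flat (Eplus C) (nabla_plus C).
Hypothesis flat_minus : flat (Eminus C) (nabla_minus C).

Theorem local_structure_exists (p0 : M) : exists (r : R) leg (e f : 'I_n -> section C),
  0 < r /\ local_structure (chart_ball p0 r) leg e f.
Proof.
have fl := split_conn_flat flat_plus flat_minus.
have [r [r0 ir hr]] := flat_parallel_frame (split_conn_is_connection C) p0 fl.
have [e0 [f0 [eE fE du]]] := dual_frame_exists C p0.
have [se hse] := choice (fun i => hr (e0 i)).
have [sf hsf] := choice (fun i => hr (f0 i)).
(* Projecting keeps the section parallel and does not change its value at [p0], which lies in E^+
   already; so the dual relations at [p0] spread over the ball. *)
pose e i : section C := fun p => pi_plus C p (se i p).
pose f i : section C := fun p => pi_minus C p (sf i p).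
have pe i : parallel_on (Eplus C) (nabla_plus C) (chart_ball p0 r) (e i).
  by apply: parallel_plus; have [] := hse i.
have pf i : parallel_on (Eminus C) (nabla_minus C) (chart_ball p0 r) (f i).
  by apply: parallel_minus; have [] := hsf i.
have dual p : chart_ball p0 r p -> forall i j, tau (e i p) (f j p) = (i == j)%:R / 2%:R.
  move=> Bp i j.
  rewrite (pairing_constant (@nabla_dual _ _ _ C) ir (pe i) (pf j) Bp (chart_ball_center p0 r0)).
  have [hi _] := hse i; have [hj _] := hsf j.
  by rewrite /e /f hi hj pi_plus_id // pi_minus_id // du.
have [x [y [s [s0 sr hxy]]]] := first_potentials r0 ir pe pf.
have [z [t [t0 ts hz]]] := contact_potential ir pe pf dual s0 sr hxy.
have [w [w0 _ ls]] := leg_structure r0 ir pe pf dual sr hxy t0 ts hz.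
by exists w; eexists; exists e, f; split; [exact: w0|exact: ls].
Qed.

End LocalStructure.

(** * Gluing *)

Section AffineLegendre.
Variables (R : realType) (n : nat).

Lemma affine_legendre_id : @affine_legendre_equiv R n (fun j => j).
Proof.
exists 1%:M, 1%:M, 0, 0, 0, 0; split.
- exact: unitmx1.
- by rewrite trmx1 invmx1.
- by rewrite mulmx0.
- by move=> [[x p] z]; rewrite /xpart /ppart /zpart /= !mul1mx trmx0 mul0mx mxE !addr0.
Qed.

Lemma affine_legendre_comp (F G : contact_space R n -> contact_space R n) :
  affine_legendre_equiv F -> affine_legendre_equiv G ->
  affine_legendre_equiv (fun j => G (F j)).
Proof.
move=> [A1 [A1' [b1 [b1' [c1 [d1 [u1 e1 f1 h1]]]]]]].
move=> [A2 [A2' [b2 [b2' [c2 [d2 [u2 e2 f2 h2]]]]]]].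
have t1 : A1^T \in unitmx by rewrite unitmx_tr.
have t2 : A2^T \in unitmx by rewrite unitmx_tr.
(* The second shift of z is evaluated at A1 x + b1: it adds A1^T c2 to the linear part and c2^T b1
   to the constant. *)
exists (A2 *m A1), (A2' *m A1'), (A2 *m b1 + b2), (A2' *m b1' + b2'),
  (c1 + A1^T *m c2), (d1 + d2 + (c2^T *m b1) 0 0); split.
- by rewrite unitmx_mul u1 u2.
- have t12 : (A2 *m A1)^T \in unitmx by rewrite unitmx_tr unitmx_mul u1 u2.
  apply: (can_inj (mulmxK t12)); rewrite mulVmx // trmx_mul e1 e2.
  by rewrite mulmxA -[_ *m _ *m A1^T]mulmxA mulVmx // mulmx1 mulVmx.
- rewrite mulmxDr f1 f2 !mulmxA; congr (_ + _).
  by rewrite -[A2' *m A1' *m A1^T]mulmxA e1 mulVmx // mulmx1.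
- move=> j; rewrite h2 h1 /xpart /ppart /zpart /=; congr (_, _, _).
  + by rewrite mulmxDr mulmxA addrA.
  + by rewrite mulmxDr mulmxA addrA.
  + have -> : (c1 + A1^T *m c2)^T = c1^T + c2^T *m A1.
      by rewrite linearD /= trmx_mul trmxK.
    rewrite mulmxDl mulmxDr -mulmxA [(_ + _ : 'M_1) 0 0]mxE [in RHS]mxE.
    by move: ((c1^T *m _) 0 0) ((c2^T *m (A1 *m _)) 0 0) ((c2^T *m b1) 0 0) => s1 s2 s3; lra.
Qed.

End AffineLegendre.

Section Gluing.
Variables (R : realType) (n : nat) (M : manifold R n) (C : quasi_codazzi M).

Lemma linear_pair_continuous (V W : normedModType R) (L : V * W -> R^o) :
  (forall l : V -> R^o, linear l -> continuous l) ->
  (forall l : W -> R^o, linear l -> continuous l) ->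
  linear L -> continuous L.
Proof.
move=> cV cW lL.
have e : L = (fun p => L (p.1, 0) + L (0, p.2)).
  apply/funext => -[v w] /=; have := lL 1 (v, 0) (0, w); rewrite !scale1r => <-.
  by congr L; congr (_, _); rewrite /= ?addr0 ?add0r.
have c1 : continuous (fun v => L (v, 0)).
  apply: cV => s v w; rewrite -lL; congr L; congr (_, _).
  by rewrite /= scaler0 addr0.
have c2 : continuous (fun w => L (0, w)).
  apply: cW => s v w; rewrite -lL; congr L; congr (_, _).
  by rewrite /= scaler0 addr0.
rewrite e => -[v w].
apply: (@continuousD _ _ _ (fun p => L (p.1, 0)) (fun p => L (0, p.2))).
  apply: (@continuous_comp _ _ _ fst (fun v => L (v, 0))); last exact: c1.
  exact: cvg_fst.
apply: (@continuous_comp _ _ _ snd (fun w => L (0, w))); last exact: c2.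
exact: cvg_snd.
Qed.

Lemma linear_contact_continuous (L : contact_space R n * contact_space R n -> R^o) :
  linear L -> continuous L.
Proof.
have cc (l : contact_space R n -> R^o) : linear l -> continuous l.
  apply: linear_pair_continuous; last exact: linear_scalar_continuous.
  by move=> l' ; apply: linear_pair_continuous => l''; exact: linear_mx_continuous.
by apply: linear_pair_continuous.
Qed.

Section Pair.
Variables (U U' : set M) (leg leg' : M -> contact_space R n).
Variables (e f e' f' : 'I_n -> section C) (q0 : M) (r : R).
Hypotheses (S : local_structure U leg e f) (S' : local_structure U' leg' e' f').
Hypotheses (r0 : 0 < r) (ir : inside_chart q0 r).
Hypotheses (BU : chart_ball q0 r `<=` U) (BU' : chart_ball q0 r `<=` U').
Local Notation B := (chart_ball q0 r).

Let Bq0 : B q0. Proof. exact: chart_ball_center. Qed.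

(** Each coordinate of the relation between the two Legendre maps says that some linear [L] is
    constant along the pair, so it is enough to check the differentials. *)
Lemma functional_constant (L : contact_space R n * contact_space R n -> R^o) :
  linear L -> (forall q (v : tangent q), B q -> L (dir leg v, dir leg' v) = 0) ->
  forall q s, B q -> B s -> L (leg q, leg' q) = L (leg s, leg' s).
Proof.
move=> lL dL; have cL := linear_contact_continuous lL.
have [[sl _ _ _ _] _ _ _ _] := S; have [[sl' _ _ _ _] _ _ _ _] := S'.
have h a q : D a q -> B q -> has_diff ((fun q => L (leg q, leg' q)) \o psi a) (phi a q)
   (fun v => L ('D_v (leg \o psi a) (phi a q), 'D_v (leg' \o psi a) (phi a q))).
  move=> Dq Bq.
  have d1 : chart_diff leg a q := smooth_chart_diff sl Dq (BU Bq).
  have d2 : chart_diff leg' a q := smooth_chart_diff sl' Dq (BU' Bq).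
  exact: (has_diff_lin lL cL (has_diff_pair (has_diffE d1) (has_diffE d2))).
apply: (chart_ball_dir0 (f := fun q => L (leg q, leg' q)) ir).
  by move=> q Bq; have [Dq _] := Bq; have [] := h _ _ Dq Bq.
move=> q v Bq; have [_ e1] := h _ _ (pref_dom q) Bq.
by rewrite dirE; apply: (etrans (e1 v)); exact: dL.
Qed.

(** The transition matrices, f' = A f and e' = A' e. Their entries are pairings of parallel
    sections, so the values at [q0] are valid on the whole ball. *)
Let A : 'M[R]_n := \matrix_(i, j) (2 * tau (e j q0) (f' i q0)).
Let A' : 'M[R]_n := \matrix_(i, j) (2 * tau (e' i q0) (f j q0)).

Let memb q : B q -> [/\ forall i, e i q \in Eplus C q, forall i, f i q \in Eminus C q,
   forall i, e' i q \in Eplus C q & forall i, f' i q \in Eminus C q].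
Proof.
move=> Bq; have [_ [pe pf] _ _ _] := S; have [_ [pe' pf'] _ _ _] := S'.
split=> i; [exact: parallel_mem (pe i) (BU Bq)|exact: parallel_mem (pf i) (BU Bq)
  |exact: parallel_mem (pe' i) (BU' Bq)|exact: parallel_mem (pf' i) (BU' Bq)].
Qed.

Let A_const q i j : B q -> A i j = 2 * tau (e j q) (f' i q).
Proof.
move=> Bq; have [_ [pe _] _ _ _] := S; have [_ [_ pf'] _ _ _] := S'.
rewrite mxE; congr (2 * _).
exact: (pairing_constant (@nabla_dual _ _ _ C) ir (parallel_sub BU (pe j))
  (parallel_sub BU' (pf' i)) Bq0 Bq).
Qed.

Let A'_const q i j : B q -> A' i j = 2 * tau (e' i q) (f j q).
Proof.
move=> Bq; have [_ [_ pf] _ _ _] := S; have [_ [pe' _] _ _ _] := S'.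
rewrite mxE; congr (2 * _).
exact: (pairing_constant (@nabla_dual _ _ _ C) ir (parallel_sub BU' (pe' i))
  (parallel_sub BU (pf j)) Bq0 Bq).
Qed.

Let f'E q i : B q -> f' i q = \sum_j A i j *: f j q.
Proof.
move=> Bq; have [eE fE _ fE'] := memb Bq; have [_ _ du _ _] := S.
rewrite {1}(Eminus_dual_frame fE (du _ (BU Bq)) (fE' i)).
by apply: eq_bigr => j _; rewrite (A_const i j Bq).
Qed.

Let e'E q i : B q -> e' i q = \sum_j A' i j *: e j q.
Proof.
move=> Bq; have [eE fE eE' _] := memb Bq; have [_ _ du _ _] := S.
rewrite {1}(Eplus_dual_frame eE (du _ (BU Bq)) (eE' i)).
by apply: eq_bigr => j _; rewrite (A'_const i j Bq).
Qed.

Let A'A : A' *m A^T = 1%:M.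
Proof.
have [_ _ du _ _] := S; have [_ _ du' _ _] := S'.
apply/matrixP => i k; rewrite mxE [RHS]mxE.
have := du' _ (BU' Bq0) i k; rewrite (e'E i Bq0) tau_suml => h.
have -> : (i == k)%:R = 2 * ((i == k)%:R / 2%:R) :> R by rewrite mulrC divfK // pnatr_eq0.
rewrite -h mulr_sumr; apply: eq_bigr => j _.
by rewrite tauZl [A^T j k]mxE (A_const k j Bq0) mulrCA.
Qed.

Let AA' : A^T *m A' = 1%:M. Proof. exact: mulmx1C. Qed.
Let A_unit : A \in unitmx.
Proof. by rewrite -unitmx_tr; have [] := mulmx1_unit A'A. Qed.
Let A'E : A' = invmx A^T.
Proof.
have u : A^T \in unitmx by rewrite unitmx_tr.
by apply: (can_inj (mulmxK u)); rewrite mulVmx.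
Qed.

Let dx q (v : tangent q) : B q -> xpart (dir leg' v) = A *m xpart (dir leg v).
Proof.
move=> Bq; have [_ _ _ hx _] := S; have [_ _ _ hx' _] := S'.
apply/matrixP => i j; rewrite ord1 (hx' _ _ _ (BU' Bq)) (f'E i Bq) tau_sumr mulr_sumr mxE.
by apply: eq_bigr => k _; rewrite tauZr (hx _ _ _ (BU Bq)) mulrCA.
Qed.

Let dp q (v : tangent q) : B q -> ppart (dir leg' v) = A' *m ppart (dir leg v).
Proof.
move=> Bq; have [_ _ _ _ hp] := S; have [_ _ _ _ hp'] := S'.
apply/matrixP => i j; rewrite ord1 (hp' _ _ _ (BU' Bq)) (e'E i Bq) tau_sumr mulr_sumr mxE.
by apply: eq_bigr => k _; rewrite tauZr (hp _ _ _ (BU Bq)) mulrCA.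
Qed.

Let b := xpart (leg' q0) - A *m xpart (leg q0).
Let b' := ppart (leg' q0) - A' *m ppart (leg q0).
(** Forced by the contact condition: with x' = A x + b and p' = A' p + b', the form p' dx' equals p
    dx + (A^T b') dx. *)
Let c := A^T *m b'.

Let sub_entry0 (x y : 'cV[R]_n) i : x = y -> (x - y) i 0 = 0.
Proof. by move=> ->; rewrite subrr mxE. Qed.

Let contact_transform (X P k : 'cV[R]_n) :
  ((A' *m P + k)^T *m (A *m X)) 0 0 = (P^T *m X) 0 0 + ((A^T *m k)^T *m X) 0 0.
Proof.
have -> : (A' *m P + k)^T *m (A *m X) = P^T *m (A'^T *m A *m X) + (A^T *m k)^T *m X.
  by rewrite linearD /= !trmx_mul trmxK mulmxDl !mulmxA.
have -> : A'^T *m A = 1%:M by rewrite -[A]trmxK -trmx_mul AA' trmx1.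
by rewrite mul1mx mxE.
Qed.

Let xE q : B q -> xpart (leg' q) = A *m xpart (leg q) + b.
Proof.
move=> Bq; apply/eqP; rewrite addrC -subr_eq; apply/eqP/matrixP => i j.
rewrite ord1.
pose L (J : contact_space R n * contact_space R n) : R^o :=
  (xpart J.2 - A *m xpart J.1) i 0.
have lL : linear L.
  by move=> s v w; rewrite /L /xpart /= mulmxDr -scalemxAr !mxE [_ *: _]mulrDr; lra.
apply: (functional_constant lL _ Bq Bq0) => p v Bp.
exact: (sub_entry0 i (dx v Bp)).
Qed.

Let pE q : B q -> ppart (leg' q) = A' *m ppart (leg q) + b'.
Proof.
move=> Bq; apply/eqP; rewrite addrC -subr_eq; apply/eqP/matrixP => i j.
rewrite ord1.
pose L (J : contact_space R n * contact_space R n) : R^o :=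
  (ppart J.2 - A' *m ppart J.1) i 0.
have lL : linear L.
  by move=> s v w; rewrite /L /ppart /= mulmxDr -scalemxAr !mxE [_ *: _]mulrDr; lra.
apply: (functional_constant lL _ Bq Bq0) => p v Bp.
exact: (sub_entry0 i (dp v Bp)).
Qed.

Let dz q (v : tangent q) : B q ->
  zpart (dir leg' v) = zpart (dir leg v) + (c^T *m xpart (dir leg v)) 0 0.
Proof.
move=> Bq; have [[_ _ _ _ ct] _ _ _ _] := S; have [[_ _ _ _ ct'] _ _ _ _] := S'.
have z1 := ct _ v (BU Bq); have z2 := ct' _ v (BU' Bq).
have dotE (x y : 'cV[R]_n) : \sum_i x i 0 * y i 0 = (x^T *m y) 0 0.
  by rewrite mxE; apply: eq_bigr => i _; rewrite mxE.
rewrite /contact_form dotE in z1; rewrite /contact_form dotE in z2.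
have {}z1 := subr0_eq z1; have {}z2 := subr0_eq z2.
rewrite (dx v Bq) (pE Bq) in z2; apply: (etrans z2).
apply: (etrans (contact_transform _ _ _)).
by apply: (congr1 (fun y : R => y + _)); exact: esym z1.
Qed.

Lemma local_glue : exists2 F, affine_legendre_equiv F &
  forall p, B p -> leg' p = F (leg p).
Proof.
pose d : R := zpart (leg' q0) - zpart (leg q0) - (c^T *m xpart (leg q0)) 0 0.
exists (fun j : contact_space R n => (A *m xpart j + b, A' *m ppart j + b',
  zpart j + (c^T *m xpart j) 0 0 + d) : contact_space R n).
  exists A, A', b, b', c, d; split=> //.
  by rewrite /c mulmxA A'A mul1mx.
move=> p Bp.
have zE : zpart (leg' p) = zpart (leg p) + (c^T *m xpart (leg p)) 0 0 + d.
  pose L (J : contact_space R n * contact_space R n) : R^o :=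
    zpart J.2 - zpart J.1 - (c^T *m xpart J.1) 0 0.
  have lL : linear L.
    move=> s v w.
    have e1 : (c^T *m (s *: xpart v.1 + xpart w.1)) 0 0
      = s * (c^T *m xpart v.1) 0 0 + (c^T *m xpart w.1) 0 0.
      by rewrite mulmxDr -scalemxAr mxE [X in X + _]mxE.
    have alg (a1 b1 c1 a2 b2 c2 : R) : s * a1 + a2 - (s * b1 + b2) - (s * c1 + c2)
      = s * (a1 - b1 - c1) + (a2 - b2 - c2) by ring.
    apply: (etrans _ (alg _ _ _ _ _ _)).
    by apply: (congr1 (fun y : R => _ - y)); exact: e1.
  have := functional_constant lL _ Bp Bq0; rewrite /L /= -/d => <-.
    by lra.
  have sub0 (x y w : R) : x = y + w -> x - y - w = 0 by move=> ->; ring.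
  by move=> q v Bq; exact: (sub0 _ _ _ (dz v Bq)).
rewrite -xE // -pE // -zE; by case: (leg' p) => [[]].
Qed.

End Pair.

Lemma local_structure_yields (U : set M) leg (e f : 'I_n -> section C) :
  local_structure U leg e f ->
  (forall p (v : tangent p), U p ->
     Phi_plus C v = \sum_(i < n) xpart (dir leg v) i 0 *: e i p) /\
  (forall p (v : tangent p), U p ->
     Phi_minus C v = \sum_(i < n) ppart (dir leg v) i 0 *: f i p).
Proof.
move=> [_ [pe pf] du hx hp]; split=> p v Up.
  apply: (etrans (Eplus_dual_frame (fun i => parallel_mem (pe i) Up) (du p Up) (pi_plus_mem (Phi C p v)))).
  by apply: eq_bigr => i _; rewrite hx.
apply: (etrans (Eminus_dual_frame (fun i => parallel_mem (pf i) Up) (du p Up) (pi_minus_mem (Phi C p v)))).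
by apply: eq_bigr => i _; rewrite hp // tau_sym.
Qed.

End Gluing.

Section Covering.
Variables (R : realType) (n : nat) (M : manifold R n).

(* A cover is refined by chart balls so finely that two overlapping ones lie in
   a common member of the cover; [K j] are closed neighbourhoods inside the
   members of a countable subcover, and the ball around [p] avoids or is
   swallowed by each of the finitely many [K j] preceding the first one
   attached to [p]. *)
Lemma chart_ball_refinement (V : M -> set M) :
  (forall p, open (V p)) -> (forall p, V p p) -> (exists p : M, True) ->
  exists (c : M -> M) (s : M -> R), [/\ forall p, 0 < s p,
    forall p, inside_chart p (s p), forall p, chart_ball p (s p) `<=` V (c p) &
    forall p q y, chart_ball p (s p) y -> chart_ball q (s q) y ->
      exists z, chart_ball p (s p) `<=` V z /\ chart_ball q (s q) `<=` V z].
Proof.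
move=> oV Vp [pstar _].
have exK p : exists K : set M, [/\ closed K, K `<=` V p & K^° p].
  have [chi [K [_ c1 cK KV c0]]] := manifold_bump (oV p) (Vp p).
  exists K; split=> //; apply: filterS c1 => q c1q.
  by apply: contrapT => /c0; rewrite c1q => /eqP; rewrite oner_eq0.
have [K hK] := choice exK.
have [B cB [oB bB]] := @manifold_second_countable _ _ M.
have exS p : exists S, [/\ B S, S p & S `<=` (K p)^°].
  have [_ _ Kp] := hK p.
  have [S [BS Sp] SK] := bB p _ (open_nbhs_nbhs (conj (open_interior (K p)) Kp)).
  by exists S.
have [S hS] := choice exS.
have /countable_injP [code code_inj] := cB.
pose k p := code (S p).
have kS p q : k p = k q -> S p = S q.
  by apply: code_inj; rewrite inE; [have [] := hS p|have [] := hS q].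
(* One representative per basic open set makes the subcover countable. Indices that are not attained
   get [pstar], which still names a member of the cover. *)
pose cen j := xget pstar [set q | k q = j].
have kcen p : k (cen (k p)) = k p by exact: (@xgetPex _ pstar [set q | k q = k p] (ex_intro _ p erefl)).
have Kk p : (K (cen (k p)))^° p.
  have [_ _ h] := hS (cen (k p)); apply: h; rewrite (kS _ p) //.
  by have [] := hS p.
have near_ok p : \forall x \near p, (K (cen (k p)))^° x /\ forall j : 'I_(k p),
    (K (cen j) p -> V (cen j) x) /\ (~ K (cen j) p -> ~ K (cen j) x).
  have h1 : \forall x \near p, (K (cen (k p)))^° x.
    by apply: open_near; [exact: open_interior|exact: Kk].
  have h2 : \forall x \near p, forall j : 'I_(k p),
    (K (cen j) p -> V (cen j) x) /\ (~ K (cen j) p -> ~ K (cen j) x).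
    apply: filter_forall => j; have [cK KV _] := hK (cen j).
    have [Kp|nKp] := pselect (K (cen j) p).
      have := open_near (oV (cen j)) (KV _ Kp); apply: filterS => x Vx.
      by split.
    have oK : open (~` K (cen j)) by rewrite openC.
    by have := open_near oK nKp; apply: filterS => x nKx; split.
  by apply: filterS2 h1 h2 => x.
have [s hs] := choice (fun p => chart_ball_small (near_ok p)).
exists (fun p => cen (k p)), s; split.
- by move=> p; have [] := hs p.
- by move=> p; have [] := hs p.
- move=> p y By; have [_ _ h] := hs p; have [Ky _] := h _ By.
  by have [_ KV _] := hK (cen (k p)); apply: KV; exact: interior_subset.
(* The smaller index provides the common member. If k p < k q, the ball around [q] contains [y], a
   point of [K (cen (k p))]; so [q] lies in that set too, for otherwise its ball would avoid it, and
   the ball is then inside [V (cen (k p))]. *)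
have wlog_case p q y : (k p <= k q)%N -> chart_ball p (s p) y -> chart_ball q (s q) y ->
    chart_ball p (s p) `<=` V (cen (k p)) /\ chart_ball q (s q) `<=` V (cen (k p)).
  have inV z : chart_ball z (s z) `<=` K (cen (k z)).
    move=> x Bx; have [_ _ h] := hs z; have [Kx _] := h _ Bx.
    exact: interior_subset.
  have KV z : K z `<=` V z by have [] := hK z.
  move=> pq By By'; split; first by apply: subset_trans (inV p) (KV _).
  move: pq; rewrite leq_eqVlt => /orP[/eqP ->|pq].
    by apply: subset_trans (inV q) (KV _).
  have [_ _ h] := hs q; have [_ /(_ (Ordinal pq)) [h1 h2]] := h _ By'.
  have Kq : K (cen (k p)) q.
    by apply: contrapT => /h2; apply; exact: inV.
  by move=> x Bx; have [_ /(_ (Ordinal pq)) [+ _]] := h _ Bx; exact.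
move=> p q y By By'; case: (leqP (k p) (k q)) => kpq.
  by exists (cen (k p)); exact: wlog_case kpq By By'.
exists (cen (k q)).
by have [h1 h2] := wlog_case q p y (ltnW kpq) By' By; split.
Qed.

End Covering.

Lemma tau_dual_sum (R : realType) (n : nat) (M : manifold R n) (E : para_hermitian M)
    (p : M) (e f : 'I_n -> fib E p) :
  (forall i j, tau (e i) (f j) = (i == j)%:R / 2%:R) -> forall x y : 'I_n -> R,
  tau (\sum_i x i *: e i) (\sum_i y i *: f i) = (\sum_i x i * y i) / 2%:R.
Proof.
move=> dual x y; rewrite tau_sumr mulr_suml; apply: eq_bigr => i _.
by rewrite tauZr (tau_dual_suml dual) mulrCA mulrA.
Qed.

Theorem theorem4p4 (R : realType) (n : nat) (M : manifold R n)
    (C : quasi_codazzi M)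
    (flat_plus : flat (Eplus C) (nabla_plus C))
    (flat_minus : flat (Eminus C) (nabla_minus C)) :
  exists Q : quasi_hessian M, yields C Q.
Proof.
(* The refinement needs a base point; the empty manifold is presented by no pieces. *)
have [nonempty|empty] := pselect (exists p : M, True); last first.
  exists (@QuasiHessian R n M False (fun=> set0) (fun _ _ => 0)
    (fun a => match a with end) (fun p => False_ind _ (empty (ex_intro _ p I)))
    (fun a => match a with end) (fun a => match a with end)).
  by case.
have ex p : exists w : R * (M -> contact_space R n) * ('I_n -> section C) * ('I_n -> section C),
    0 < w.1.1.1 /\ local_structure (chart_ball p w.1.1.1) w.1.1.2 w.1.2 w.2.
  have [r [leg [e [f [r0 h]]]]] := local_structure_exists flat_plus flat_minus p.
  by exists (r, leg, e, f).
have [w hw] := choice ex.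
pose V p := chart_ball p (w p).1.1.1.
have oV p : open (V p) by exact: open_chart_ball.
have Vp p : V p p by apply: chart_ball_center; have [] := hw p.
have [c [s [s0 si sV s2]]] := chart_ball_refinement oV Vp nonempty.
pose leg p := (w (c p)).1.1.2.
pose U p := chart_ball p (s p).
have LS p : local_structure (U p) (leg p) (w (c p)).1.2 (w (c p)).2.
  by have [_ h] := hw (c p); apply: local_structure_sub h; exact: sV.
have glue a b : exists2 F, affine_legendre_equiv F &
    forall p, U a p -> U b p -> leg b p = F (leg a p).
  have [[y [Ua Ub]]|no] := pselect (exists y, U a y /\ U b y); last first.
    exists (fun j => j); first exact: affine_legendre_id.
    by move=> p Ua Ub; case: no; exists p.
  have [z [az bz]] := s2 a b y Ua Ub.
  have [_ hz] := hw z.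
  (* The two pieces are not compared on their overlap. Each is compared with the larger piece around
     [z] over its own full ball, and the two equivalences are composed. *)
  have [F aF hF] := local_glue (LS a) hz (s0 a) (si a) (@subset_refl _ _) az.
  have [G aG hG] := local_glue hz (LS b) (s0 b) (si b) bz (@subset_refl _ _).
  exists (fun j => G (F j)); first exact: affine_legendre_comp.
  by move=> p Up Up'; rewrite hG // hF.
pose Q := @QuasiHessian R n M M U leg (fun p => open_chart_ball p (s p))
  (fun p => ex_intro (fun a => U a p) p (chart_ball_center p (s0 p)))
  (fun p => let: And5 h _ _ _ _ := LS p in h) glue.
exists Q => p; have lsp := LS p.
have [hx hp] := local_structure_yields lsp.
have [_ [pe pf] du dxE dpE] := lsp.
split.
  exists (w (c p)).1.2, (w (c p)).2; split=> //.
(* Isotropy of E^+ and E^- leaves the two mixed pairings, each equal to half a sum of products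
   because tau(e_i, f_i) = 1/2. *)
move=> q v v' Uq; rewrite /qc_h !Phi_split.
have duq := du q Uq.
rewrite tauDl !tauDr (tau_plus (pi_plus_mem _) (pi_plus_mem _)).
rewrite (tau_minus (pi_minus_mem _) (pi_minus_mem _)) add0r addr0.
rewrite (tau_sym (pi_minus C q _)).
etransitivity; first by apply: (congr2 (fun a b : R => a + b));
  [exact: (etrans (congr2 _ (hx q v Uq) (hp q v' Uq)) (tau_dual_sum duq _ _))
  |exact: (etrans (congr2 _ (hx q v' Uq) (hp q v Uq)) (tau_dual_sum duq _ _))].
rewrite -mulrDl -big_split /=; apply: (congr1 (fun a : R => a / 2%:R)).
apply: eq_bigr => i _. exact: (congr2 (fun a b : R => a + b) erefl (mulrC _ _)).
Qed.
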